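(* Let $N$ be a smooth manifold and let $g_i=(v_{M_i},\boldsymbol{x}_{M_i})$ ($i=1,\dots,n$), $A_j,B_j$ ($j=1,\dots,g$), $g_\infty=(v_\infty,\boldsymbol{x}_\infty)$, $w$ be smooth $H$-valued functions on $N$ and $(\boldsymbol{\mu},\boldsymbol{s})$ a smooth $\mathfrak{c}$-valued function on $N$, where $H=G\ltimes\mathfrak{g}^*$. Let $C_i=(e^{\boldsymbol{\mu}_i},\boldsymbol{s}_i)\in H$ ($i=1,\dots,n$) be fixed. Write $$M_i=(u_{M_i},-\mathrm{Ad}^*(u_{M_i}^{-1})\boldsymbol{j}_{M_i})=(v_{M_i},\boldsymbol{x}_{M_i})(e^{-\boldsymbol{\mu}_i},-\boldsymbol{s}_i)(v_{M_i},\boldsymbol{x}_{M_i})^{-1},$$ $$A_i=(u_{A_i},-\mathrm{Ad}^*(u_{A_i}^{-1})\boldsymbol{j}_{A_i}),\qquad B_i=(u_{B_i},-\mathrm{Ad}^*(u_{B_i}^{-1})\boldsymbol{j}_{B_i}),$$ and suppose that $$K_{n+2g}^{-1}=(u_{K_{n+2g}},-\mathrm{Ad}^*(u_{K_{n+2g}}^{-1})\boldsymbol{j}_{K_{n+2g}}):=[B_g,A_g^{-1}]\cdots[B_1,A_1^{-1}]M_n\cdots M_1$$ satisfies $K_{n+2g}^{-1}=(v_\infty,\boldsymbol{x}_\infty)(e^{-\boldsymbol{\mu}},-\boldsymbol{s})(v_\infty,\boldsymbol{x}_\infty)^{-1}$. Then the two-form on $N$ \begin{align*} \Omega=&\frac{k}{4\pi}\sum_{i=1}^{n}\langle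 C_ig_i^{-1}\delta g_iC_i^{-1}\wedge g_i^{-1}\delta g_i\rangle-\frac{k}{4\pi}\sum_{i=1}^{n+2g}\langle\delta K_iK_i^{-1}\wedge\delta K_{i-1}K_{i-1}^{-1}\rangle\\ &-\frac{k}{4\pi}\sum_{i=1}^{g}\Big(\langle A_i^{-1}\delta A_i\wedge B_i^{-1}\delta B_i\rangle+\langle\delta(B_iA_iB_i^{-1})\,B_iA_i^{-1}B_i^{-1}\wedge\delta B_i\,B_i^{-1}\rangle\Big)\\ &+\frac{k}{2\pi}\delta\langle(\boldsymbol{\mu},\boldsymbol{s}),w^{-1}\delta w\rangle+\frac{k}{4\pi}\langle K_{n+2g}^{-1}\delta K_{n+2g}\wedge\delta g_\infty g_\infty^{-1}\rangle+\frac{k}{4\pi}\langle(\delta\boldsymbol{\mu},\delta\boldsymbol{s})\wedge g_\infty^{-1}\delta g_\infty\rangle \end{align*} is given by $$\Omega=\frac{k}{2\pi}\,\delta\Big(\langle(\boldsymbol{\mu},\boldsymbol{s}),w^{-1}\delta w\rangle+\Theta+\langle\boldsymbol{j}_{K_{n+2g}},\delta v_\infty v_\infty^{-1}\rangle-\langle\mathrm{Ad}^*(v_\infty)\boldsymbol{x}_\infty-\tfrac12\boldsymbol{s},\delta\boldsymbol{\mu}\rangle\Big),$$ where $\Theta$ is the one-form \begin{align*} \Theta=&\sum_{i=1}^n\langle\delta(u_{M_{i-1}}\cdots u_{M_1})(u_{M_{i-1}}\cdots u_{M_1})^{-1}-\delta v_{M_i}v_{M_i}^{-1},\ \boldsymbol{j}_{M_i}\rangle\\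 &+\sum_{i=1}^g\Big(\langle\delta W_{i-1}\,W_{i-1}^{-1},\boldsymbol{j}_{A_i}\rangle-\langle\delta(u_{A_i}^{-1}u_{B_i}^{-1}u_{A_i}W_{i-1})(u_{A_i}^{-1}u_{B_i}^{-1}u_{A_i}W_{i-1})^{-1},\boldsymbol{j}_{A_i}\rangle\Big)\\ &+\sum_{i=1}^g\Big(\langle\delta(u_{A_i}^{-1}u_{B_i}^{-1}u_{A_i}W_{i-1})(u_{A_i}^{-1}u_{B_i}^{-1}u_{A_i}W_{i-1})^{-1},\boldsymbol{j}_{B_i}\rangle-\langle\delta(u_{B_i}^{-1}u_{A_i}W_{i-1})(u_{B_i}^{-1}u_{A_i}W_{i-1})^{-1},\boldsymbol{j}_{B_i}\rangle\Big), \end{align*} with $u_{H_i}=[u_{B_i},u_{A_i}^{-1}]=u_{B_i}u_{A_i}^{-1}u_{B_i}^{-1}u_{A_i}$ and $W_{i-1}=u_{H_{i-1}}\cdots u_{H_1}u_{M_n}\cdots u_{M_1}$.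
   Context: $G$ is a connected finite-dimensional real Lie group, $\mathfrak{g}$ its Lie algebra, $\mathfrak{g}^*$ the dual, $\langle\,,\rangle$ the canonical pairing. $\mathrm{Ad}^*(g)$ is the algebraic dual of $\mathrm{Ad}(g)$: $\langle\mathrm{Ad}^*(g)\boldsymbol{j},\xi\rangle=\langle\boldsymbol{j},\mathrm{Ad}(g)\xi\rangle$ (so the coadjoint action of $g$ is $\mathrm{Ad}^*(g^{-1})$). $H=G\ltimes\mathfrak{g}^*$ has multiplication $(u_1,\boldsymbol{a}_1)(u_2,\boldsymbol{a}_2)=(u_1u_2,\boldsymbol{a}_1+\mathrm{Ad}^*(u_1^{-1})\boldsymbol{a}_2)$. Its Lie algebra $\mathfrak{h}$ is $\mathfrak{g}\oplus\mathfrak{g}^*$ as a vector space, with $\mathfrak{g}^*$ an abelian ideal on which $\mathfrak{g}$ acts by the coadjoint representation. The pairing is extended to the symmetric, non-degenerate, $\mathrm{Ad}(H)$-invariant bilinear form on $\mathfrak{h}$ for which $\mathfrak{g}$ and $\mathfrak{g}^*$ are isotropic: $\langle(\xi,\boldsymbol{j}),(\eta,\boldsymbol{k})\rangle=\langle\boldsymbol{j},\eta\rangle+\langle\boldsymbol{k},\xi\rangle$. Any element of $H$ can be uniquely written $(u,-\mathrm{Ad}^*(u^{-1})\boldsymbol{j})$ with $u\in G$, $\boldsymbol{j}\in\mathfrak{g}^*$; this defines the functions $u_X,\boldsymbol{j}_X$ for $X=M_i,A_i,B_i,K_{n+2g}^{-1}$ (subscript $K_{n+2g}$ in the last case). $\mathfrak{c}$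 is an abelian Cartan subalgebra of $\mathfrak{h}$ of the form $\mathfrak{c}=\mathfrak{c}_0\oplus\mathfrak{c}_1$ with $\mathfrak{c}_0\subset\mathfrak{g}$, $\mathfrak{c}_1\subset\mathfrak{g}^*$; hence $\exp(\boldsymbol{\mu},\boldsymbol{s})=(e^{\boldsymbol{\mu}},\boldsymbol{s})$ for $(\boldsymbol{\mu},\boldsymbol{s})\in\mathfrak{c}$. For $i=1,\dots,n$, $(\boldsymbol{\mu}_i,\boldsymbol{s}_i)$ are constant elements of (possibly different) Cartan subalgebras of $\mathfrak{h}$, with $[\boldsymbol{\mu}_i,\boldsymbol{s}_i]=0$, so that $\exp(\boldsymbol{\mu}_i,\boldsymbol{s}_i)=(e^{\boldsymbol{\mu}_i},\boldsymbol{s}_i)$. $k$ is a nonzero real constant; $n,g\ge0$ are integers. $\delta$ is the exterior derivative on $N$; for a group-valued function $h$, $h^{-1}\delta h$ and $\delta h\,h^{-1}$ are the pull-backs of the left- and right-invariant Maurer–Cartan forms. For Lie algebra valued one-forms $\alpha,\beta$, $\langle\alpha\wedge\beta\rangle(X,Y)=\langle\alpha(X),\beta(Y)\rangle-\langle\alpha(Y),\beta(X)\rangle$. Group elements act on $\mathfrak{h}$-valued forms by conjugation, i.e. the adjoint action. Group commutator: $[B,A^{-1}]=BA^{-1}B^{-1}A$. Empty products are $1$. The elements $K_i$ are: $K_0=1$; $K_i^{-1}=M_i\cdots M_1$ for $1\le i\le n$; and for $1\le j\le g$, $K_{n+2j-1}^{-1}=A_j[B_{j-1},A_{j-1}^{-1}]\cdots[B_1,A_1^{-1}]M_n\cdots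 M_1$ and $K_{n+2j}^{-1}=[B_j,A_j^{-1}]\cdots[B_1,A_1^{-1}]M_n\cdots M_1$. *)

(* Defs.v *)
From HB Require Import structures.
From mathcomp Require Import all_boot all_order all_algebra.
From mathcomp Require Import all_classical all_reals all_analysis.
Set Implicit Arguments.
Unset Strict Implicit.
Unset Printing Implicit Defensive.
Import Order.TTheory GRing.Theory Num.Theory numFieldNormedType.Exports.
Local Open Scope classical_set_scope.
Local Open Scope ring_scope.

(* U is meant to be open in a finite-dimensional space E; this is then the    *)
(* usual C^k, since the 'D_v f for all v cover the partial derivatives.       *)
Fixpoint Ck (R : realType) (E F : normedModType R) (k : nat) (U : set E)
    (f : E -> F) : Prop :=
  match k with
  | 0%N => forall x, U x -> {for x, continuous f}
  | k'.+1 => (forall x, U x -> differentiable f x) /\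
             (forall v, Ck k' U (fun x => 'D_v f x))
  end.

Definition smooth_on (R : realType) (E F : normedModType R) (U : set E)
  (f : E -> F) : Prop := forall k, Ck k U f.

(* cmap is only meaningful on cdom, and cinv on the image of cdom.            *)
Record chart (R : realType) (E : normedModType R) (M : Type) := Chart {
  cdom : set M;
  cmap : M -> E;
  cinv : E -> M }.

Section Manifolds.
Context {R : realType}.

Definition is_chart (E : normedModType R) (M : topologicalType)
    (c : chart E M) : Prop :=
  [/\ open (cdom c), open (cmap c @` cdom c),
      {within cdom c, continuous (cmap c)},
      {within cmap c @` cdom c, continuous (cinv c)} &
      forall x, cdom c x -> cinv c (cmap c x) = x].

Definition smooth_map (E E' : normedModType R) (M M' : topologicalType)
    (atl : set (chart E M)) (atl' : set (chart E' M')) (f : M -> M') : Prop :=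
  continuous f /\
  forall c c', atl c -> atl' c' ->
    smooth_on (cmap c @` (cdom c `&` f @^-1` cdom c'))
              (fun z => cmap c' (f (cinv c z))).

(* The third clause on charts says that the transition maps are smooth.       *)
Definition smooth_manifold (E : normedModType R) (M : topologicalType)
    (atl : set (chart E M)) : Prop :=
  [/\ hausdorff_space M, @second_countable M,
      forall c, atl c -> is_chart c,
      forall x, exists2 c, atl c & cdom c x &
      smooth_map atl atl (fun x : M => x)].

Definition vect_chart (E : normedModType R) : chart E E :=
  Chart setT (fun x => x) (fun x => x).

Arguments vect_chart E : clear implicits.

Definition vect_atlas (E : normedModType R) : set (chart E E) :=
  [set vect_chart E].
Arguments vect_atlas E : clear implicits.

Definition prod_chart (E E' : normedModType R) (M M' : Type)
    (c : chart E M) (c' : chart E' M') : chart (E * E')%type (M * M')%type :=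
  Chart (cdom c `*` cdom c')
        (fun p => (cmap c p.1, cmap c' p.2))
        (fun z => (cinv c z.1, cinv c' z.2)).

Definition prod_atlas (E E' : normedModType R) (M M' : Type)
    (atl : set (chart E M)) (atl' : set (chart E' M')) :
    set (chart (E * E')%type (M * M')%type) :=
  [set p | exists c c', [/\ atl c, atl' c' & p = prod_chart c c']].

(* A tangent vector of N at x is represented by its components v : E in a     *)
(* chart c around x.  A one-form (with values in W) sends (c, x, v) to its    *)
(* value on that tangent vector, and similarly for two-forms; only charts c   *)
(* of the atlas and points x in cdom c matter.  All the forms used below are  *)
(* pull-backs by smooth maps, wedge products and exterior derivatives of      *)
(* such, so that their values do not depend on the chart used to represent    *)
(* the tangent vectors.                                                       *)
Definition form1 (E : normedModType R) (N : Type) (W : Type) : Type :=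
  chart E N -> N -> E -> W.
Definition form2 (E : normedModType R) (N : Type) (W : Type) : Type :=
  chart E N -> N -> E -> E -> W.

Definition dfun (E W : normedModType R) (N : Type) (f : N -> W) : form1 E N W :=
  fun c x v => 'D_v (fun z => f (cinv c z)) (cmap c x).

(* d alpha (X, Y) = X (alpha Y) - Y (alpha X) for the (commuting) coordinate  *)
(* fields X, Y with constant components v, v' in the chart c.                 *)
Definition dform (E : normedModType R) (N : Type) (alpha : form1 E N R^o) :
    form2 E N R :=
  fun c x v v' =>
    'D_v (fun z => alpha c (cinv c z) v') (cmap c x) -
    'D_v' (fun z => alpha c (cinv c z) v) (cmap c x).

Definition wedge (E : normedModType R) (N W : Type) (b : W -> W -> R)
    (alpha beta : form1 E N W) : form2 E N R :=
  fun c x v v' =>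
    b (alpha c x v) (beta c x v') - b (alpha c x v') (beta c x v).

(* gchart1 is the chart at 1 used to identify the tangent space at 1, i.e.    *)
(* the Lie algebra, with E.  The axioms are kept apart, in lie_group, so that *)
(* the operations and charts of semidirect below can be given as plain data.  *)
Record lie_data (E : normedModType R) := LieData {
  gcar :> topologicalType;
  gatlas : set (chart E gcar);
  gone : gcar;
  gmul : gcar -> gcar -> gcar;
  ginv : gcar -> gcar;
  gchart1 : chart E gcar }.
Arguments gatlas {E} l : rename.
Arguments gone {E} l : rename.
Arguments gchart1 {E} l : rename.

Record lie_group (E : normedModType R) (G : lie_data E) : Prop := {
  lie_manifold : smooth_manifold (gatlas G);
  lie_mulA : associative (@gmul E G);
  lie_mul1g : left_id (gone G) (@gmul E G);
  lie_mulVg : left_inverse (gone G) (@ginv E G) (@gmul E G);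
  lie_smooth_mul : smooth_map (prod_atlas (gatlas G) (gatlas G)) (gatlas G)
                     (fun p : (G * G)%type => gmul p.1 p.2);
  lie_smooth_inv : smooth_map (gatlas G) (gatlas G) (@ginv E G);
  lie_chart1_atlas : gatlas G (gchart1 G);
  lie_chart1_dom : cdom (gchart1 G) (gone G) }.

Section LieNotions.
Context {E : normedModType R} {G : lie_data E}.
Implicit Types xi eta : E.

Definition Ad (x : G) xi : E :=
  'D_xi (fun z => cmap (gchart1 G) (gmul (gmul x (cinv (gchart1 G) z)) (ginv x)))
        (cmap (gchart1 G) (gone G)).

(* [xi, eta] = ad(xi) eta, with ad the derivative of Ad at 1.                 *)
Definition lie_bracket xi eta : E :=
  'D_xi (fun z => Ad (cinv (gchart1 G) z) eta) (cmap (gchart1 G) (gone G)).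

Definition one_param_subgroup (gam : R^o -> G) xi : Prop :=
  [/\ smooth_map (vect_atlas R^o) (gatlas G) gam,
      forall s t : R, gam (s + t) = gmul (gam s) (gam t) &
      'D_1 (fun t : R^o => cmap (gchart1 G) (gam t)) 0 = xi].

(* This determines e: a one-parameter subgroup is determined by its velocity. *)
Definition exponential_map (e : E -> G) : Prop :=
  forall xi, one_param_subgroup (fun t : R^o => e (t *: xi)) xi.

(* h^-1 (delta h) and (delta h) h^-1: the tangent vector dh(v) at h(x) is     *)
(* translated to 1 by h(x)^-1, on the left, resp. on the right.               *)
Definition mc_left (EN : normedModType R) (N : Type) (h : N -> G) :
    form1 EN N E :=
  fun c x v =>
    'D_v (fun z => cmap (gchart1 G) (gmul (ginv (h x)) (h (cinv c z)))) (cmap c x).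
Definition mc_right (EN : normedModType R) (N : Type) (h : N -> G) :
    form1 EN N E :=
  fun c x v =>
    'D_v (fun z => cmap (gchart1 G) (gmul (h (cinv c z)) (ginv (h x)))) (cmap c x).

(* [b, a^-1] = b a^-1 b^-1 a                                                  *)
Definition commV (b a : G) : G := gmul (gmul (gmul b (ginv a)) (ginv b)) a.

(* M_i ... M_1; families are numbered from 1, as in all that follows.         *)
Fixpoint Mprod (M : nat -> G) (i : nat) : G :=
  if i is i'.+1 then gmul (M i'.+1) (Mprod M i') else gone G.

(* [B_j, A_j^-1] ... [B_1, A_1^-1] M_n ... M_1                                *)
Fixpoint Wprod (n : nat) (M A B : nat -> G) (j : nat) : G :=
  if j is j'.+1 then gmul (commV (B j'.+1) (A j'.+1)) (Wprod n M A B j')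
  else Mprod M n.

(* K_i^-1; for i = n + 2j - 1 and i = n + 2j the integer j is uphalf (i - n). *)
Definition Kinv (n : nat) (M A B : nat -> G) (i : nat) : G :=
  if (i <= n)%N then Mprod M i
  else let j := uphalf (i - n) in
       if odd (i - n) then gmul (A j) (Wprod n M A B j.-1)
       else Wprod n M A B j.

End LieNotions.

(* A Cartan subalgebra is a nilpotent, self-normalizing subalgebra.           *)
Definition nilpotent_sub (V : vectType R) (br : V -> V -> V) (c : {vspace V}) :
    Prop :=
  exists k : nat, forall (s : seq V) (y : V),
    size s = k -> all [in c] s -> y \in c -> foldr br y s = 0.

Definition cartan_subalgebra (V : vectType R) (br : V -> V -> V)
    (c : {vspace V}) : Prop :=
  [/\ forall x y, x \in c -> y \in c -> br x y \in c,
      nilpotent_sub br c &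
      forall x, (forall y, y \in c -> br x y \in c) -> x \in c].

Definition abelian_sub (V : vectType R) (br : V -> V -> V) (c : {vspace V}) :
    Prop := forall x y, x \in c -> y \in c -> br x y = 0.

End Manifolds.

Arguments vect_chart {R} E.
Arguments vect_atlas {R} E.
Arguments gatlas {R E} l.
Arguments gone {R E} l.
Arguments gchart1 {R E} l.
Arguments lie_bracket {R E} G xi eta.

(* The Lie algebra g of G is 'rV[R]_d, and its dual is 'cV[R]_d.              *)
Section Semidirect.
Context {R : realType} {d : nat} {G : lie_data 'rV[R]_d}.

Definition dpair (j : 'cV[R]_d) (xi : 'rV[R]_d) : R := (xi *m j) 0 0.

(* The transpose of Ad u, so that dpair (Ads u j) xi = dpair j (Ad u xi).     *)
Definition Ads (u : G) (j : 'cV[R]_d) : 'cV[R]_d := lin1_mx (Ad u) *m j.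

(* The coadjoint representation of g: minus the transpose of ad xi.           *)
Definition coad (xi : 'rV[R]_d) (j : 'cV[R]_d) : 'cV[R]_d :=
  - (lin1_mx (lie_bracket G xi) *m j).

Definition semi_mul (p q : (G * 'cV[R]_d)%type) : (G * 'cV[R]_d)%type :=
  (gmul p.1 q.1, p.2 + Ads (ginv p.1) q.2).

Definition semi_inv (p : (G * 'cV[R]_d)%type) : (G * 'cV[R]_d)%type :=
  (ginv p.1, - Ads p.1 p.2).

Definition semidirect : lie_data ('rV[R]_d * 'cV[R]_d)%type :=
  @LieData R ('rV[R]_d * 'cV[R]_d)%type (G * 'cV[R]_d)%type
    (prod_atlas (gatlas G) (vect_atlas 'cV[R]_d))
    (gone G, 0) semi_mul semi_inv
    (prod_chart (gchart1 G) (vect_chart 'cV[R]_d)).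

Definition Hpair (u : G) (a : 'cV[R]_d) : semidirect := (u, a).

Definition Hfst (X : semidirect) : G := X.1.
Definition Hsnd (X : semidirect) : 'cV[R]_d := X.2.

(* The j such that X = (u, - Ad^*(u^-1) j).                                   *)
Definition jpart (X : semidirect) : 'cV[R]_d :=
  xget 0 [set j | X = Hpair (Hfst X) (- Ads (ginv (Hfst X)) j)].

Definition bracketH (X Y : 'rV[R]_d * 'cV[R]_d) : 'rV[R]_d * 'cV[R]_d :=
  (lie_bracket G X.1 Y.1, coad X.1 Y.2 - coad Y.1 X.2).

Definition pairH (X Y : 'rV[R]_d * 'cV[R]_d) : R :=
  dpair X.2 Y.1 + dpair Y.2 X.1.

End Semidirect.

Arguments semidirect {R d} G.
Arguments bracketH {R d} G X Y.

Section TwoForm.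
Context {R : realType} {d : nat} {G : lie_data 'rV[R]_d}.
Context {EN : normedModType R} {N : Type}.
Local Notation H := (semidirect G).
Local Notation g := 'rV[R]_d.
Local Notation gs := 'cV[R]_d.

Context (e : g -> G) (n gen : nat).
Context (mui : nat -> g) (si : nat -> gs).
Context (gM A B : nat -> N -> H).

Definition Cel (i : nat) : H := Hpair (e (mui i)) (si i).

Definition Mfun (i : nat) (x : N) : H :=
  gmul (gmul (gM i x) (Hpair (e (- mui i)) (- si i))) (ginv (gM i x)).

Definition KVfun (i : nat) (x : N) : H :=
  Kinv n (fun l => Mfun l x) (fun l => A l x) (fun l => B l x) i.
Definition Kfun (i : nat) (x : N) : H := ginv (KVfun i x).

Definition BABV (i : nat) (x : N) : H :=
  gmul (gmul (B i x) (A i x)) (ginv (B i x)).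

Definition uM (i : nat) (x : N) : G := Hfst (Mfun i x).
Definition uA (i : nat) (x : N) : G := Hfst (A i x).
Definition uB (i : nat) (x : N) : G := Hfst (B i x).

Definition PuM (i : nat) (x : N) : G := Mprod (fun l => uM l x) i.
Definition Wfun (i : nat) (x : N) : G :=
  Wprod n (fun l => uM l x) (fun l => uA l x) (fun l => uB l x) i.

(* u_{B_i}^-1 u_{A_i} W_{i-1} and u_{A_i}^-1 u_{B_i}^-1 u_{A_i} W_{i-1}       *)
Definition BAW (i : nat) (x : N) : G :=
  gmul (gmul (ginv (uB i x)) (uA i x)) (Wfun i.-1 x).
Definition ABAW (i : nat) (x : N) : G :=
  gmul (gmul (gmul (ginv (uA i x)) (ginv (uB i x))) (uA i x)) (Wfun i.-1 x).

Definition Theta : form1 EN N R^o := fun c x v =>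
  \sum_(1 <= i < n.+1)
     dpair (jpart (Mfun i x))
       (mc_right (PuM i.-1) c x v - mc_right (fun y => Hfst (gM i y)) c x v) +
  \sum_(1 <= i < gen.+1)
     (dpair (jpart (A i x)) (mc_right (Wfun i.-1) c x v) -
      dpair (jpart (A i x)) (mc_right (ABAW i) c x v)) +
  \sum_(1 <= i < gen.+1)
     (dpair (jpart (B i x)) (mc_right (ABAW i) c x v) -
      dpair (jpart (B i x)) (mc_right (BAW i) c x v)).

Context (ginf w : N -> H) (mu : N -> g) (s : N -> gs) (k : R).

Definition mus_w : form1 EN N R^o := fun c x v =>
  pairH (mu x, s x) (mc_left w c x v).

Definition Omega : form2 EN N R := fun c x v v' =>
  k / (4 * pi) * (\sum_(1 <= i < n.+1)
     wedge pairH (fun c x v => Ad (Cel i) (mc_left (gM i) c x v))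
                 (mc_left (gM i)) c x v v')
  - k / (4 * pi) * (\sum_(1 <= i < (n + 2 * gen).+1)
     wedge pairH (mc_right (Kfun i)) (mc_right (Kfun i.-1)) c x v v')
  - k / (4 * pi) * (\sum_(1 <= i < gen.+1)
     (wedge pairH (mc_left (A i)) (mc_left (B i)) c x v v' +
      wedge pairH (mc_right (BABV i)) (mc_right (B i)) c x v v'))
  + k / (2 * pi) * dform mus_w c x v v'
  + k / (4 * pi) *
      wedge pairH (mc_left (Kfun (n + 2 * gen))) (mc_right ginf) c x v v'
  + k / (4 * pi) *
      wedge pairH (fun c x v => (dfun mu c x v, dfun s c x v)) (mc_left ginf)
            c x v v'.

Definition potential : form1 EN N R^o := fun c x v =>
  mus_w c x v + Theta c x v
  + dpair (jpart (KVfun (n + 2 * gen) x))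
          (mc_right (fun y => Hfst (ginf y)) c x v)
  - dpair (Ads (Hfst (ginf x)) (Hsnd (ginf x)) - 2^-1 *: s x) (dfun mu c x v).

End TwoForm.

(* Main.v *)
(* For an H-valued X = (u, - Ad^*(u^-1) j) put Q_X = <dj ^ u^-1 du>.  The      *)
(* Maurer-Cartan equation d (du u^-1) = [du u^-1, du u^-1] gives the cocycle  *)
(* identity                                                                   *)
(*   <Y^-1 dY ^ dX X^-1> = Q_{YX} - Q_X - Q_Y - 2 d <j_Y, du_X u_X^-1>.       *)
(* By invariance of the pairing, the terms of Omega attached to a puncture,   *)
(* resp. to a handle, are combinations of left-hand sides of this identity    *)
(* (M_i g_i = g_i C_i^-1 for a puncture, [B, A^-1] = (B A^-1 B^-1) A for a    *)
(* handle), and they add up to - Q at the new value of K^-1 plus Q at the old *)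
(* one, plus an exact form.  The sum telescopes to - Q of K_{n+2g}^-1; as     *)
(* this is a conjugate of exp(- mu, - s), it cancels against the last two     *)
(* terms of Omega up to exact forms, the commutativity of the Cartan          *)
(* subalgebra giving d (e^mu) e^-mu = d mu and Ad^*(e^mu) s = s.              *)

Require Import Defs.
From HB Require Import structures.
From mathcomp Require Import all_boot all_order all_algebra.
From mathcomp Require Import all_classical all_reals all_analysis.
From mathcomp Require Import ring lra.
Import Order.TTheory GRing.Theory Num.Theory numFieldNormedType.Exports.
Local Open Scope classical_set_scope.
Local Open Scope ring_scope.
Set Implicit Arguments.
Unset Strict Implicit.
Unset Printing Implicit Defensive.


(** * Calculus *)

Section Calculus.
Context {R : realType}.
Implicit Types (E F P W : normedModType R).

(** A map X : N -> H is described by its group component u and its momentum j, where X = (u, - [Ads]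
    (u^-1) j). In these coordinates j_{YX} = j_X + [Ads] u_X j_Y, dX X^-1 = (du u^-1, - [Ads] (u^-1)
    dj) and X^-1 dX = (u^-1 du, - dj - [coad] (u^-1 du) j). Put Q_X = <dj ^ u^-1 du> ([Qform]).
    Expanding in these coordinates gives [cocycle]: <Y^-1 dY ^ dX X^-1> equals Q_{YX} - Q_X - Q_Y up
    to the exact form - 2 d<j_Y, du_X u_X^-1>. The bracket terms match because of the Maurer-Cartan
    equation, [mc_right_derive].

    Modulo exact forms such a wedge is therefore the coboundary of Q, and [Omega] is made of such
    wedges. The terms in consecutive K are brought to this shape by [wedge_inverse_products]. A
    puncture compares two factorisations of one map, M g = g C^-1 ([conjugate_form]); a handle
    combines five instances of the cocycle identity ([handle_identity]). Each of them contributes -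
    Q of the new partial product, plus Q of the old one, plus 2 d of its own summand of [Theta]. The
    sum telescopes from the empty product, where Q = 0, to the full product X = K_{n+2g}^-1.

    There X = k D k^-1 with k = g_infinity and D = exp (- mu, - s). The same comparison
    ([conjugate_form_end]) trades Q_X for Q_D and the last two wedges of [Omega]. Since the Cartan
    subalgebra is abelian, D^-1 dD = - (dmu, ds) and Q_D = - d<s, dmu>, which accounts for the term
    s/2 of the potential ([end_term]). [Omega_potential] adds everything up.

    The Lie theory is expressed through velocities of curves, [tangent1] and [rlog]. Its rules,
    [lie_calculus], hold for [G] by smoothness ([lie_group_calculus]) and for [H] by direct
    computation ([semidirect_calculus]). The Maurer-Cartan equation comes from the symmetry of
    second derivatives ([mixed_derivatives], [maurer_cartan]), and the facts about exponentials from
    the uniqueness of one-parameter subgroups ([morph_unique]). *)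

Lemma is_derive_unique E F (f : E -> F) p v l l' :
  is_derive p v f l -> is_derive p v f l' -> l = l'.
Proof. by move=> [_ <-] [_ <-]. Qed.

(** Turns directional derivatives into derivatives of curves at 0, the form in which nearly all
    later computations are made. *)
Lemma is_derive_lineP E F (f : E -> F) p v l :
  is_derive p v f l <-> is_derive (0 : R) (1 : R) (fun t => f (t *: v + p)) l.
Proof.
have eqD : 'D_v f p = 'D_(1 : R) (fun t : R => f (t *: v + p)) 0.
  rewrite /derive.
  have -> // : (fun h : R => h^-1 *: ((f \o shift p) (h *: v) - f p)) =
    (fun h : R => h^-1 *: (((fun t : R => f (t *: v + p)) \o shift 0) (h *: 1)
                           - f (0 *: v + p))).
  by apply/funext => h /=; rewrite addr0 scale0r add0r [_%:A]mulr1.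
split=> -[df <-].
  by split; [exact: (derivable1P f p v).1|rewrite eqD].
by split; [exact: (derivable1P f p v).2|rewrite eqD].
Qed.

Lemma diff_is_derive E F (f : E -> F) p v :
  differentiable f p -> is_derive p v f ('D_v f p).
Proof. by move=> df; apply/derivableP/diff_derivable. Qed.

(** For a function of one real variable derivability already is differentiability, so the chain rule
    for differentials applies to the inner curve. *)
Lemma is_derive_comp E F (c : R -> E) (f : E -> F) l : differentiable f (c 0) ->
  is_derive (0 : R) 1 c l -> is_derive (0 : R) 1 (f \o c) ('D_l f (c 0)).
Proof.
move=> df [dc <-]; have dc' : differentiable c 0 by apply/derivable1_diffP.
have dfc : differentiable (f \o c) 0 by exact: differentiable_comp.
split; first exact/derivable1_diffP.
by rewrite (deriveE _ dfc) (diff_comp dc' df) /= -(deriveE _ dc') -(deriveE _ df).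
Qed.

Lemma is_derive_continuous E (c : R -> E) l :
  is_derive (0 : R) 1 c l -> {for 0, continuous c}.
Proof.
by move=> [dc _]; apply/differentiable_continuous/derivable1_diffP.
Qed.

Lemma is_derive_linear E F W (L : {linear F -> W}) (f : E -> F) p v l :
  continuous L -> is_derive p v f l -> is_derive p v (L \o f) (L l).
Proof.
move=> Lc /is_derive_lineP df; apply/is_derive_lineP.
have := @is_derive_comp _ _ (fun t => f (t *: v + p)) L _ _ df.
have dL x : differentiable L x by exact: linear_differentiable.
by move=> /(_ (dL _)); rewrite deriveE // diff_lin.
Qed.

Lemma is_derive_pair E F W (f : E -> F) (g : E -> W) p v l l' :
  is_derive p v f l -> is_derive p v g l' ->
  is_derive p v (fun x => (f x, g x)) (l, l').
Proof.
move=> /is_derive_lineP df /is_derive_lineP dg; apply/is_derive_lineP.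
have [/derivable1_diffP df' <-] := df; have [/derivable1_diffP dg' <-] := dg.
have dfg := differentiable_pair df' dg'.
split; first exact/derivable1_diffP.
by rewrite (deriveE _ dfg) (diff_pair df' dg') (deriveE _ df') (deriveE _ dg').
Qed.

Lemma is_derive_mx m n E (M : E -> 'M[R]_(m, n)) p v (L : 'M[R]_(m, n)) :
  is_derive p v M L <-> forall i j, is_derive p v (fun x => M x i j) (L i j).
Proof.
split=> [[dM <-] i j|dM].
  by split; [exact: (derivable_mxP M p v).1|rewrite derive_mx // mxE].
have dM' : derivable M p v by apply/derivable_mxP => i j; have [] := dM i j.
by split=> //; rewrite derive_mx //; apply/matrixP => i j; rewrite mxE derive_val.
Qed.

Lemma is_derive_mulmx m n q E (M : E -> 'M[R]_(m, n)) (L : E -> 'M[R]_(n, q))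
    p v M' L' : is_derive p v M M' -> is_derive p v L L' ->
  is_derive p v (fun x => M x *m L x) (M' *m L p + M p *m L').
Proof.
move=> /is_derive_mx dM /is_derive_mx dL; apply/is_derive_mx => i j.
rewrite (_ : (fun x => _) = \sum_(h < n) (fun x => M x i h) * (fun x => L x h j)).
  apply: is_derive_eq.
  rewrite !mxE -big_split /=; apply: eq_bigr => h _.
  by rewrite addrC /GRing.scale /= mulrC; congr (_ + _); rewrite mulrC.
by apply/funext => x; rewrite mxE fct_sumE.
Qed.

Lemma is_derive_sum_seq E F (I : eqType) (r : seq I) (f : I -> E -> F) p v
    (f' : I -> F) : (forall i, i \in r -> is_derive p v (f i) (f' i)) ->
  is_derive p v (fun x => \sum_(i <- r) f i x) (\sum_(i <- r) f' i).
Proof.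
elim: r => [_|i r IH df].
  rewrite big_nil (_ : (fun _ => _) = cst 0); last first.
    by apply/funext => x; rewrite big_nil.
  exact: is_derive_cst.
rewrite big_cons (_ : (fun _ => _) = f i + (fun x => \sum_(i <- r) f i x)).
  apply: is_deriveD; first by apply: df; rewrite inE eqxx.
  by apply: IH => j rj; apply: df; rewrite inE rj orbT.
by apply/funext => x; rewrite big_cons.
Qed.

(** The mean value theorem settles t >= 0; negative t follow by applying that case to x |-> f (-
    x). *)
Lemma is_derive_zero_cst (f : R -> R) (r : R) :
  (forall t : R, `|t| < r -> is_derive t 1 f 0) ->
  forall t : R, `|t| < r -> f t = f 0.
Proof.
have half (g : R -> R) : (forall t : R, `|t| < r -> is_derive t 1 g 0) ->
    forall t : R, 0 <= t -> t < r -> g t = g 0.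
  move=> dg t t0 tr.
  have bnd x : x \in `[0, t]%R -> `|x| < r.
    rewrite in_itv /= => /andP[x0 xt]; rewrite ger0_norm //.
    exact: le_lt_trans tr.
  have [||c _ E] := @MVT_segment R g (fun _ => 0) 0 t t0.
  - move=> x xt; apply/dg/bnd; move: xt; rewrite !in_itv /= => /andP[? ?].
    by rewrite !ltW.
  - apply: derivable_within_continuous => x xt; have [] // := dg x.
    exact: bnd.
  - by apply/eqP; rewrite -subr_eq0 E mul0r.
move=> df t tr; have [t0|t0] := leP 0 t.
  by apply: half => //; rewrite -(ger0_norm t0).
have /half : forall t : R, `|t| < r -> is_derive t 1 (fun x => f (- x)) 0.
  move=> x xr; have dNx : is_derive (- x) 1 f 0 by apply: df; rewrite normrN.
  have [/derivable1_diffP d1 E] := dNx.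
  apply/is_derive_lineP.
  have -> : (fun t : R => f (- (t *: 1 + x))) = fun t => f (t *: (- 1) + - x).
    by apply/funext => s; rewrite scalerN opprD.
  apply/(is_derive_lineP f (- x) (- 1)).
  have <- : 'D_(- 1) f (- x) = 0.
    by rewrite (deriveE _ d1) linearN -(deriveE _ d1) E oppr0.
  exact: diff_is_derive.
move=> /(_ (- t)); rewrite opprK oppr0; apply; first by rewrite oppr_ge0 ltW.
by rewrite -(ltr0_norm t0).
Qed.

End Calculus.

(** * Smooth maps between open sets *)

Section Smooth.
Context {R : realType}.
Implicit Types (E F P W : normedModType R).

(** Finite dimension in the form needed by [Ck_comp]: a finite family [e] with continuous coordinate
    functionals [l]. The family need not be free. *)
Definition findim W := exists (I : finType) (l : I -> {linear W -> R^o})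
    (e : I -> W),
  (forall i, continuous (l i)) /\ forall w, w = \sum_i l i w *: e i.

Lemma findim_mx m n : findim 'M[R]_(m, n).
Proof.
have lin i j : linear (fun M : 'M[R]_(m, n) => M i j : R^o).
  by move=> a M M'; rewrite !mxE.
pose l (ij : 'I_m * 'I_n) : {linear 'M[R]_(m, n) -> R^o} :=
  HB.pack (fun M : 'M[R]_(m, n) => M ij.1 ij.2 : R^o)
    (GRing.isLinear.Build _ _ _ _ _ (lin ij.1 ij.2)).
exists ('I_m * 'I_n)%type, l, (fun ij => delta_mx ij.1 ij.2); split.
  by move=> [i j] M; exact: coord_continuous.
by move=> M; rewrite {1}(matrix_sum_delta M) pair_bigA.
Qed.

Lemma findim_prod W W' : findim W -> findim W' -> findim (W * W')%type.
Proof.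
move=> [I [l [e [lc le]]]] [I' [l' [e' [lc' le']]]].
have linl i : linear (fun w : W * W' => l i w.1).
  by move=> a u v /=; rewrite linearP.
have linr i : linear (fun w : W * W' => l' i w.2).
  by move=> a u v /=; rewrite linearP.
pose m (i : I + I') : {linear (W * W')%type -> R^o} :=
  match i with
  | inl i => HB.pack (fun w : W * W' => l i w.1 : R^o)
      (GRing.isLinear.Build _ _ _ _ _ (linl i))
  | inr i => HB.pack (fun w : W * W' => l' i w.2 : R^o)
      (GRing.isLinear.Build _ _ _ _ _ (linr i))
  end.
exists (I + I')%type, m,
  (fun i => match i with inl i => (e i, 0) | inr i => (0, e' i) end); split.
  move=> [i|i] w /=.
    by apply: (@continuous_comp _ _ _ fst (l i)); [exact: cvg_fst|exact: lc].
  by apply: (@continuous_comp _ _ _ snd (l' i)); [exact: cvg_snd|exact: lc'].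
move=> [w w']; rewrite big_sumType /=.
have sum1 (J : finType) (a : J -> R) (x : J -> W) :
    \sum_i a i *: (x i, 0 : W') = (\sum_i a i *: x i, 0).
  elim/big_ind2 : _ => // [x1 x2 y1 y2 -> ->|i _].
    by congr pair => /=; rewrite addr0.
  by congr pair => /=; rewrite scaler0.
have sum2 (J : finType) (a : J -> R) (x : J -> W') :
    \sum_i a i *: (0 : W, x i) = (0, \sum_i a i *: x i).
  elim/big_ind2 : _ => // [x1 x2 y1 y2 -> ->|i _].
    by congr pair => /=; rewrite addr0.
  by congr pair => /=; rewrite scaler0.
rewrite sum1 sum2 {1}(le w) {1}(le' w').
by congr pair => /=; rewrite ?addr0 ?add0r.
Qed.

Lemma findim_reg : findim R^o.
Proof.
exists 'I_1, (fun=> idfun : {linear R^o -> R^o}), (fun=> 1); split=> [_ x|w].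
  exact: cvg_id.
by rewrite big_ord1 /= [RHS]mulr1.
Qed.

Lemma continuous_near_eq (T T' : topologicalType) (f g : T -> T') x :
  (\near x, f x = g x) -> {for x, continuous f} -> {for x, continuous g}.
Proof.
move=> fg fc; rewrite /prop_for /continuous_at -(nbhs_singleton fg).
by apply: cvg_trans fc; exact: near_eq_cvg.
Qed.

(** The difference z = g - f vanishes near x, hence is a little o with differential 0, and g = f +
    z. *)
Lemma differentiable_near_eq E F (f g : E -> F) x :
  (\near x, f x = g x) -> differentiable f x -> differentiable g x.
Proof.
move=> fg df; pose z := g - f.
have z0 : \forall h \near (0 : E), z (h + x) = 0.
  move: fg; rewrite (near_shift 0) /=; apply: filterS => h /=.
  by rewrite subr0 => fgh; rewrite /z !fctE -fgh subrr.
have zx : z x = 0 by have := nbhs_singleton z0; rewrite add0r.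
have zo : z \o shift x = cst (z x) + (\0 : E -> F) +o_ 0 id.
  apply/eqaddoP => e e0; near=> h.
  have zh : z (h + x) = 0 by near: h.
  by rewrite !fctE /= zh zx !addr0 subr0 normr0 mulr_ge0 // ltW.
have dz0 : 'd z x = \0 :> (E -> F).
  apply: (@diff_unique _ _ _ z (\0 : {linear E -> F}) x) => //.
  exact: cst_continuous.
have dz : differentiable z x.
  by apply/diff_locallyP; rewrite dz0; split => //; exact: cst_continuous.
have -> : g = f + z by apply/funext => y; rewrite /z !fctE addrC subrK.
exact: differentiableD.
Unshelve. all: by end_near. Qed.

Lemma Ck_near_ext k E F (U : set E) (f g : E -> F) :
  (forall x, U x -> \near x, f x = g x) -> Ck k U f -> Ck k U g.
Proof.
elim: k F f g => [|k IH] F f g fg /=.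
  by move=> fc x Ux; apply: (continuous_near_eq (fg x Ux)); exact: fc.
move=> [df Df]; split=> [x Ux|v].
  by apply: (differentiable_near_eq (fg x Ux)); exact: df.
apply: IH (Df v) => x Ux; have := fg x Ux.
by move=> /near_join; apply: filterS => y; exact: near_eq_derive.
Qed.

Lemma Ck_ext k E F (U : set E) (f g : E -> F) : open U ->
  (forall x, U x -> f x = g x) -> Ck k U f -> Ck k U g.
Proof.
move=> oU fg; apply: Ck_near_ext => x Ux.
by apply: filterS fg _; exact: open_nbhs_nbhs.
Qed.

Lemma Ck_sub k E F (U V : set E) (f : E -> F) : V `<=` U -> Ck k U f -> Ck k V f.
Proof.
elim: k F f => [|k IH] F f VU /=; first by move=> fc x /VU; exact: fc.
by move=> [df Df]; split=> [x /VU|v]; [exact: df|apply: IH].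
Qed.

Lemma CkW k E F (U : set E) (f : E -> F) : Ck k.+1 U f -> Ck k U f.
Proof.
elim: k F f => [|k IH] F f [df Df].
  by move=> x Ux; exact/differentiable_continuous/df.
by split=> // v; exact: IH.
Qed.

Lemma Ck_cst k E F (U : set E) (a : F) : Ck k U (fun _ => a).
Proof.
elim: k F a => [|k IH] F a /=; first by move=> x _; exact: cst_continuous.
split=> [x _|v]; first exact: differentiable_cst.
have -> : 'D_v (fun _ : E => a) = fun=> 0 by apply/funext => x; exact: derive_cst.
exact: IH.
Qed.

Lemma CkD k E F (U : set E) (f g : E -> F) : open U ->
  Ck k U f -> Ck k U g -> Ck k U (fun x => f x + g x).
Proof.
move=> oU; elim: k F f g => [|k IH] F f g /=.
  by move=> fc gc x Ux; apply: continuousD; [exact: fc|exact: gc].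
move=> [df Df] [dg Dg]; split=> [x Ux|v].
  by apply: differentiableD; [exact: df|exact: dg].
apply: (Ck_ext oU) (IH _ _ _ (Df v) (Dg v)) => x Ux.
by rewrite deriveD //; apply: diff_derivable; [exact: df|exact: dg].
Qed.

Lemma Ck_sum k E F (U : set E) (I : Type) (r : seq I) (f : I -> E -> F) :
  open U -> (forall i, Ck k U (f i)) -> Ck k U (fun x => \sum_(i <- r) f i x).
Proof.
move=> oU fC; elim: r => [|i r IH].
  apply: (Ck_ext oU (f := fun=> 0)); last exact: Ck_cst.
  by move=> x _; rewrite big_nil.
apply: (Ck_ext oU (f := fun x => f i x + \sum_(i <- r) f i x)).
  by move=> x _; rewrite big_cons.
exact: CkD.
Qed.

Lemma Ck_linear k E F W (U : set E) (L : {linear F -> W}) (f : E -> F) :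
  open U -> continuous L -> Ck k U f -> Ck k U (fun x => L (f x)).
Proof.
move=> oU Lc; elim: k f => [|k IH] f /=.
  by move=> fc x Ux; apply: continuous_comp (fc x Ux) (Lc _).
move=> [df Df]; split=> [x Ux|v].
  by apply: (differentiable_comp (df x Ux)); exact: linear_differentiable.
apply: (Ck_ext oU) (IH _ (Df v)) => x Ux.
by have [_ ->] := is_derive_linear Lc (diff_is_derive v (df x Ux)).
Qed.

Lemma CkZ k E F (U : set E) (a : E -> R^o) (f : E -> F) : open U ->
  Ck k U a -> Ck k U f -> Ck k U (fun x => a x *: f x).
Proof.
move=> oU; elim: k a f => [|k IH] a f /=.
  by move=> ac fc x Ux; apply: continuousZ; [exact: ac|exact: fc].
move=> Ca Cf; have [[da Da] [df Df]] := (Ca, Cf).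
have isbil : bilinear_for (GRing.Scale.Law.clone _ _ *:%R _)
    (GRing.Scale.Law.clone _ _ *:%R _) (fun (a : R^o) (u : F) => a *: u).
  split=> [u'|u] b x y /=.
  - by rewrite scalerDl scalerA.
  - by rewrite scalerDr !scalerA mulrC.
pose sc : {bilinear R^o -> F -> F} := HB.pack (fun (a : R^o) (u : F) => a *: u)
  (bilinear_isBilinear.Build R R^o F F _ _ _ isbil).
have sc_cont : continuous (fun p : R^o * F => sc p.1 p.2).
  by move=> p; exact: scale_continuous.
have dpairx x : U x -> differentiable (fun y => (a y, f y)) x.
  by move=> Ux; apply: differentiable_pair; [exact: da|exact: df].
have dsc x : U x -> differentiable (fun p : R^o * F => sc p.1 p.2) (a x, f x).
  by move=> Ux; exact: differentiable_bilin.
have daf x : U x -> differentiable (fun x => a x *: f x) x.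
  by move=> Ux; apply: (differentiable_comp (dpairx x Ux) (dsc x Ux)).
split=> // v.
apply: (Ck_ext oU (f := fun x => a x *: 'D_v f x + 'D_v a x *: f x)).
  move=> x Ux; rewrite (deriveE _ (daf x Ux)).
  rewrite (diff_comp (dpairx x Ux) (dsc x Ux)) /= (diff_bilin _ sc_cont) /=.
  rewrite (diff_pair (da x Ux) (df x Ux)) /=.
  by rewrite -(deriveE _ (da x Ux)) -(deriveE _ (df x Ux)).
by apply: CkD => //; apply: IH => //; exact: CkW.
Qed.

(** [Ck] only differentiates in constant directions, whereas the chain rule produces the direction
    'D_v f x, which varies with x. Decomposing that direction along the frame of [W] gives a finite
    sum of products of [Ck] functions. *)
Lemma Ck_comp k P W F (U : set P) (V : set W) (f : P -> W) (g : W -> F) :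
  findim W -> open U -> (forall x, U x -> V (f x)) ->
  Ck k U f -> Ck k V g -> Ck k U (fun x => g (f x)).
Proof.
move=> [I [l [e [lc le]]]] oU UV; elim: k F f g UV => [|k IH] F f g UV /=.
  move=> fc gc x Ux; apply: continuous_comp; first exact: fc.
  by apply: gc; exact: UV.
move=> Cf [dg Dg]; have [df Df] := Cf; split=> [x Ux|v].
  by apply: differentiable_comp; [exact: df|apply: dg; exact: UV].
apply: (Ck_ext oU (f := fun x =>
    \sum_i (l i ('D_v f x) : R^o) *: 'D_(e i) g (f x))).
  move=> x Ux; have dfx := df x Ux; have dgx := dg _ (UV x Ux).
  rewrite (deriveE _ (differentiable_comp dfx dgx)) (diff_comp dfx dgx) /=.
  rewrite -(deriveE _ dfx) [in RHS](le ('D_v f x)) linear_sum.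
  by apply: eq_bigr => i _; rewrite linearZ /= -(deriveE _ dgx).
apply: Ck_sum => // i; apply: CkZ => //.
  by apply: (Ck_linear (f := fun x => 'D_v f x)).
by apply: (IH _ f (fun y => 'D_(e i) g y)) => //; exact: CkW.
Qed.

Lemma Ck_pair k E F W (U : set E) (f : E -> F) (g : E -> W) : open U ->
  Ck k U f -> Ck k U g -> Ck k U (fun x => (f x, g x)).
Proof.
move=> oU; elim: k f g => [|k IH] f g /=.
  by move=> fc gc x Ux; apply: cvg_pair; [exact: fc|exact: gc].
move=> [df Df] [dg Dg]; split=> [x Ux|v].
  by apply: differentiable_pair; [exact: df|exact: dg].
apply: (Ck_ext oU (f := fun x => ('D_v f x, 'D_v g x))); last exact: IH.
move=> x Ux.
by have [_ ->] := is_derive_pair (diff_is_derive v (df x Ux))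
                                 (diff_is_derive v (dg x Ux)).
Qed.

Lemma Ck_id k E (U : set E) : open U -> Ck k U (fun x => x).
Proof.
move=> oU; case: k => [|k] /=; first by move=> x _; exact: cvg_id.
split=> [x _|v]; first by apply: ex_diff.
by apply: (Ck_ext oU (f := fun=> v)); [move=> x _; rewrite derive_id|exact: Ck_cst].
Qed.

Lemma smooth_on_differentiable E F (U : set E) (f : E -> F) x :
  smooth_on U f -> U x -> differentiable f x.
Proof. by move=> /(_ 1%N)[df _]; exact: df. Qed.

Lemma smooth_on_derive E F (U : set E) (f : E -> F) v :
  smooth_on U f -> smooth_on U (fun x => 'D_v f x).
Proof. by move=> fC k; have [_] := fC k.+1; apply. Qed.

Lemma is_derive_line E F (f : E -> F) v q (s : R) :
  differentiable f (s *: v + q) ->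
  is_derive s 1 (fun t : R => f (t *: v + q)) ('D_v f (s *: v + q)).
Proof.
move=> df; apply/is_derive_lineP.
have -> : (fun t : R => f ((t *: 1 + s) *: v + q)) =
          (fun t => f (t *: v + (s *: v + q))).
  by apply/funext => t; rewrite [_%:A]mulr1 scalerDl addrA.
exact: ((is_derive_lineP f (s *: v + q) v _).1 (diff_is_derive v df)).
Qed.

(** The mean value theorem is used twice: for s |-> f (s v + h w + p) - f (s v + p), then for 'D_v f
    in the direction w. *)
Lemma second_difference E (f : E -> R) (U : set E) p v w (h : R) :
  smooth_on U (f : E -> R^o) -> 0 < h ->
  (forall s t : R, 0 <= s <= h -> 0 <= t <= h -> U (s *: v + (t *: w + p))) ->
  exists s t : R, [/\ 0 <= s <= h, 0 <= t <= h &
    (f (h *: v + (h *: w + p)) - f (h *: v + p)) - (f (h *: w + p) - f p) =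
    'D_w ('D_v (f : E -> R^o)) (s *: v + (t *: w + p)) * h * h].
Proof.
move=> fC h0 Uh; have hh : 0 <= h <= h by rewrite (ltW h0) lexx.
have h00 : (0 : R) <= 0 <= h by rewrite lexx (ltW h0).
have df x : U x -> differentiable (f : E -> R^o) x.
  exact: smooth_on_differentiable.
have dDf x : U x -> differentiable ('D_v (f : E -> R^o)) x.
  by move=> Ux; apply: smooth_on_differentiable Ux; exact: smooth_on_derive.
have Uv s : 0 <= s <= h -> U (s *: v + p).
  by move=> /Uh /(_ h00); rewrite scale0r add0r.
pose phi (s : R) := f (s *: v + (h *: w + p)) - f (s *: v + p).
pose dphi (s : R) : R :=
  'D_v (f : E -> R^o) (s *: v + (h *: w + p)) - 'D_v (f : E -> R^o) (s *: v + p).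
have Dphi s : 0 <= s <= h -> is_derive s 1 phi (dphi s).
  move=> sh; apply: is_deriveB; apply: is_derive_line; apply: df.
    exact: Uh.
  exact: Uv.
have [||s] := @MVT_segment R phi dphi 0 h (ltW h0).
- move=> s; rewrite in_itv /= => /andP[s0 sh]; apply: Dphi.
  by rewrite !ltW.
- apply: derivable_within_continuous => s; rewrite in_itv /= => /Dphi.
  by case.
rewrite in_itv /= subr0 => sh E1.
pose psi (t : R) : R := 'D_v (f : E -> R^o) (t *: w + (s *: v + p)).
pose dpsi (t : R) : R := 'D_w ('D_v (f : E -> R^o)) (t *: w + (s *: v + p)).
have Dpsi t : 0 <= t <= h -> is_derive t 1 psi (dpsi t).
  move=> th; apply: is_derive_line; apply: dDf.
  by rewrite addrCA; exact: Uh.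
have [||t] := @MVT_segment R psi dpsi 0 h (ltW h0).
- move=> t; rewrite in_itv /= => /andP[t0 th]; apply: Dpsi.
  by rewrite !ltW.
- apply: derivable_within_continuous => t; rewrite in_itv /= => /Dpsi.
  by case.
rewrite in_itv /= subr0 => th E2; exists s, t; split=> //.
move: E1; rewrite /phi !scale0r !add0r => ->.
move: E2; rewrite /psi /dpsi /dphi scale0r add0r (addrCA (h *: w)) => ->.
by rewrite (addrCA (t *: w)).
Qed.

(** If the two values at p were at distance |d| > 0, a small parallelogram at p would keep [F1] and
    [F2] within |d|/2 of their values at p, and the common value on it would force |d| < |d|. *)
Lemma eq_of_close_values E (F1 F2 : E -> R) (p v w : E) (U : set E) :
  nbhs p U -> {for p, continuous F1} -> {for p, continuous F2} ->
  (forall h : R, 0 < h ->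
    (forall s t : R, 0 <= s <= h -> 0 <= t <= h -> U (s *: v + (t *: w + p))) ->
    exists x y : R * R, [/\ 0 <= x.1 <= h, 0 <= x.2 <= h, 0 <= y.1 <= h,
      0 <= y.2 <= h &
      F1 (x.1 *: v + (x.2 *: w + p)) = F2 (y.1 *: v + (y.2 *: w + p))]) ->
  F1 p = F2 p.
Proof.
move=> nU ct1 ct2 H; apply/eqP; rewrite -subr_eq0; apply: contraT => D0.
set d := _ - _ in D0; pose e := `|d| / 2.
have e0 : 0 < e by rewrite divr_gt0 ?normr_gt0.
have /cvgrPdist_lt/(_ _ e0) c1 := ct1.
have /cvgrPdist_lt/(_ _ e0) c2 := ct2.
have /nbhs_normP[r /= r0 rP] : \forall x \near p, [/\ U x,
    `|F1 p - F1 x| < e & `|F2 p - F2 x| < e].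
  by apply: filterS3 nU c1 c2 => x Ux x1 x2; split.
(* This size keeps the whole parallelogram inside the ball of radius r; the summand 1 keeps the
   denominator positive when v = w = 0. *)
pose h := r / 2 / (`|v| + `|w| + 1).
have vw0 : 0 < `|v| + `|w| + 1 by rewrite ltr_wpDl // addr_ge0.
have h0 : 0 < h by rewrite !divr_gt0.
have close s t : 0 <= s <= h -> 0 <= t <= h ->
    ball_ Num.norm p r (s *: v + (t *: w + p)).
  move=> /andP[s0 sh] /andP[t0 th]; rewrite /ball_ /= distrC addrA addrK.
  apply: le_lt_trans (ler_normD _ _) _; rewrite !normrZ !ger0_norm //.
  apply: (@le_lt_trans _ _ (h * (`|v| + `|w| + 1))).
    rewrite !mulrDr mulr1 -[leLHS]addr0 lerD ?(ltW h0) //.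
    by rewrite lerD // ler_wpM2r.
  by rewrite /h divfK ?gt_eqF // ltr_pdivrMr // ltr_pMr // ltr1n.
have [|[s t] [[s' t'] /= [sh th sh' th' E3]]] := H h h0.
  by move=> s t sh th; have [] := rP _ (close s t sh th).
have [_ L1 _] := rP _ (close s t sh th).
have [_ _ L2] := rP _ (close s' t' sh' th').
have : `|d| < e + e.
  rewrite /d -(subrKA (F1 (s *: v + (t *: w + p)))).
  apply: le_lt_trans (ler_normD _ _) _; apply: ltrD => //.
  by rewrite E3 distrC.
by rewrite /e -splitr ltxx.
Qed.

(** The second difference is symmetric in v and w, so h^2 times a value of [F1] and h^2 times a
    value of [F2] on the same parallelogram coincide. *)
Lemma eq_of_second_difference E (f F1 F2 : E -> R) p v w (U : set E) :
  nbhs p U -> {for p, continuous F1} -> {for p, continuous F2} ->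
  (forall h : R, 0 < h ->
    (forall s t : R, 0 <= s <= h -> 0 <= t <= h -> U (s *: v + (t *: w + p))) ->
    exists s t : R, [/\ 0 <= s <= h, 0 <= t <= h &
    (f (h *: v + (h *: w + p)) - f (h *: v + p)) - (f (h *: w + p) - f p) =
    F1 (s *: v + (t *: w + p)) * h * h]) ->
  (forall h : R, 0 < h ->
    (forall s t : R, 0 <= s <= h -> 0 <= t <= h -> U (s *: w + (t *: v + p))) ->
    exists s t : R, [/\ 0 <= s <= h, 0 <= t <= h &
    (f (h *: w + (h *: v + p)) - f (h *: w + p)) - (f (h *: v + p) - f p) =
    F2 (s *: w + (t *: v + p)) * h * h]) ->
  F1 p = F2 p.
Proof.
move=> nU ct1 ct2 S1 S2.
apply: (eq_of_close_values (v := v) (w := w) nU ct1 ct2).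
move=> h h0 Uh; have [s [t [sh th E1]]] := S1 h h0 Uh.
have [|s' [t' [sh' th' E2]]] := S2 h h0.
  by move=> s' t' sh' th'; rewrite addrCA; exact: Uh.
(* [S2] lists the coordinate along w first, hence the exchange in the second pair. *)
exists (s, t), (t', s'); split=> //=.
apply: (@mulIf _ h); first by rewrite gt_eqF.
apply: (@mulIf _ h); first by rewrite gt_eqF.
rewrite (addrCA (t' *: v)) -E1 -E2 (addrCA (h *: w)).
move: (f _) (f _) (f _) (f _) => a b c d; lra.
Qed.

Lemma derive_derive_comm_real E (f : E -> R^o) (U : set E) p v w :
  open U -> U p -> smooth_on U f -> 'D_w ('D_v f) p = 'D_v ('D_w f) p.
Proof.
move=> oU Up fC.
have ct v1 v2 : {for p, continuous ('D_v1 ('D_v2 f))}.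
  apply/differentiable_continuous.
  by apply: smooth_on_differentiable Up; do 2!apply: smooth_on_derive.
have nU : nbhs p U by exact: open_nbhs_nbhs.
exact: (@eq_of_second_difference E f ('D_w ('D_v f)) ('D_v ('D_w f)) p v w U nU
  (ct w v) (ct v w) (fun h => @second_difference _ f U p v w h fC)
  (fun h => @second_difference _ f U p w v h fC)).
Qed.

(** Schwarz's theorem, entry by entry. It is used both for the Maurer-Cartan equation and for d
    (dmu) = 0. *)
Lemma derive_derive_comm E m n (f : E -> 'M[R]_(m, n)) (U : set E) p v w :
  open U -> U p -> smooth_on U f -> 'D_w ('D_v f) p = 'D_v ('D_w f) p.
Proof.
move=> oU Up fC.
have coordC i j : smooth_on U (fun x => f x i j : R^o).
  have lin : linear (fun M : 'M[R]_(m, n) => M i j : R^o).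
    by move=> a M M'; rewrite !mxE.
  pose L : {linear 'M[R]_(m, n) -> R^o} :=
    HB.pack (fun M : 'M[R]_(m, n) => M i j : R^o)
      (GRing.isLinear.Build _ _ _ _ _ lin).
  move=> k; apply: (Ck_linear (L := L)) (fC k) => //.
  by move=> M; exact: coord_continuous.
have D1 u x i j : U x -> ('D_u f x) i j = 'D_u (fun x => f x i j : R^o) x.
  move=> Ux; have df := diff_is_derive u (smooth_on_differentiable fC Ux).
  by have [_ ->] := (is_derive_mx f x u ('D_u f x)).1 df i j.
have D2 u u' i j :
    ('D_u ('D_u' f) p) i j = 'D_u ('D_u' (fun x => f x i j : R^o)) p.
  have dDf : differentiable ('D_u' f) p.
    by apply: smooth_on_differentiable Up; exact: smooth_on_derive.
  have [_ <-] := (is_derive_mx ('D_u' f) p u _).1 (diff_is_derive u dDf) i j.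
  apply: near_eq_derive; near=> x; apply: D1; near: x.
  exact: open_nbhs_nbhs.
apply/matrixP => i j; apply: (etrans (D2 w v i j)).
exact: (etrans (derive_derive_comm_real v w oU Up (coordC i j))
  (esym (D2 v w i j))).
Unshelve. all: by end_near. Qed.

End Smooth.

(** * Charts *)

Section Germs.
Context {R : realType}.
Implicit Types (E F P W : normedModType R).

Lemma open_smooth_preimage P W (U : set P) (V : set W) (f : P -> W) :
  open U -> smooth_on U f -> open V -> open (U `&` f @^-1` V).
Proof.
move=> oU fC; have /(continuous_inP _ oU) : {in U, continuous f}; last exact.
move=> x /[1!inE] Ux.
by apply/differentiable_continuous; exact: smooth_on_differentiable fC Ux.
Qed.

Lemma is_chart_continuous E (M : topologicalType) (c : chart E M) x :
  is_chart c -> cdom c x ->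
  {for x, continuous (cmap c)} /\ {for cmap c x, continuous (cinv c)}.
Proof.
move=> [od oi + + _] cx; rewrite !continuous_open_subspace //.
by move=> mc ic; split; [apply: mc|apply: ic]; rewrite inE //; exists x.
Qed.

Lemma open_chart_image E (M : topologicalType) (c : chart E M) (A : set M) :
  is_chart c -> open A -> open (cmap c @` (cdom c `&` A)).
Proof.
move=> [od oi mc ic ci] oA.
rewrite (_ : _ @` _ = (cmap c @` cdom c) `&` cinv c @^-1` A).
  rewrite continuous_open_subspace // in ic.
  by move/(continuous_inP _ oi) : ic; exact.
apply/seteqP; split=> [_ [x [cx Ax] <-]|_ [[x cx <-] /=]].
  by split=> /=; [exists x|rewrite ci].
by rewrite ci // => Ax; exists x.
Qed.

Lemma is_chart_prod E E' (M M' : topologicalType) (c : chart E M)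
    (c' : chart E' M') : is_chart c -> is_chart c' -> is_chart (prod_chart c c').
Proof.
move=> hc hc'; have [od oi _ _ ci] := hc; have [od' oi' _ _ ci'] := hc'.
have oX (T T' : topologicalType) (A : set T) (B : set T') :
    open A -> open B -> open (A `*` B).
  move=> oA oB; rewrite openE => -[a b] [/= Aa Bb].
  by exists (A, B) => //; split; exact: open_nbhs_nbhs.
have Eimg : cmap (prod_chart c c') @` cdom (prod_chart c c') =
    (cmap c @` cdom c) `*` (cmap c' @` cdom c').
  apply/seteqP; split=> [_ [[x x'] [/= cx cx'] <-]|[_ _] [/= [x cx <-] [x' cx' <-]]].
    by split=> /=; [exists x|exists x'].
  by exists (x, x').
split.
- exact: oX.
- by rewrite Eimg; exact: oX.
- rewrite continuous_open_subspace; last exact: oX.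
  move=> [x x']; rewrite inE => -[/= cx cx'].
  have [mx _] := is_chart_continuous hc cx.
  have [mx' _] := is_chart_continuous hc' cx'.
  apply: cvg_pair.
    by apply: (@continuous_comp _ _ _ fst (cmap c) (x, x')) => //; exact: cvg_fst.
  by apply: (@continuous_comp _ _ _ snd (cmap c') (x, x')) => //; exact: cvg_snd.
- rewrite continuous_open_subspace; last by rewrite Eimg; exact: oX.
  move=> z; rewrite inE => -[[x x'] [/= cx cx'] <-].
  have [_ mx] := is_chart_continuous hc cx.
  have [_ mx'] := is_chart_continuous hc' cx'.
  apply: cvg_pair.
    apply: (@continuous_comp _ _ _ fst (cinv c) (cmap c x, cmap c' x')) => //.
    exact: cvg_fst.
  apply: (@continuous_comp _ _ _ snd (cinv c') (cmap c x, cmap c' x')) => //.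
  exact: cvg_snd.
- by move=> [x x'] [/= cx cx']; rewrite ci // ci'.
Qed.

(** Smoothness near p of a map from a normed space, seen in a single chart of the target. The domain
    needs no atlas, so lines, planes and chart images of [N] can all serve. *)
Definition smooth_at P E (M : topologicalType) (atl : set (chart E M)) (p : P)
    (f : P -> M) := exists c U,
  [/\ atl c, open U, U p, forall z, U z -> cdom c (f z) &
      smooth_on U (fun z => cmap c (f z))].

(** The chart of the target is prescribed instead of chosen, which allows maps with value 1 to be
    read in [gchart1]. *)
Lemma smooth_at_comp_chart P E E' (M M' : topologicalType)
    (atl : set (chart E M)) (atl' : set (chart E' M')) p (f : P -> M)
    (Psi : M -> M') c' : findim E -> (forall c, atl c -> is_chart c) ->
  (forall c, atl' c -> is_chart c) ->
  smooth_map atl atl' Psi -> smooth_at atl p f -> atl' c' ->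
  cdom c' (Psi (f p)) ->
  exists U, [/\ open U, U p, forall z, U z -> cdom c' (Psi (f z)) &
                smooth_on U (fun z => cmap c' (Psi (f z)))].
Proof.
move=> fE hatl hatl' [Pc Ps] [c [U [ac oU Up Uc fC]]] ac' cp.
have hc := hatl _ ac; have [_ _ _ _ ci] := hc; have [od' _ _ _ _] := hatl' _ ac'.
pose V := cmap c @` (cdom c `&` Psi @^-1` cdom c').
have oV : open V.
  by apply: open_chart_image => //; apply: open_comp => // x _; exact: Pc.
have oUV : open (U `&` (fun z => cmap c (f z)) @^-1` V).
  exact: open_smooth_preimage.
exists (U `&` (fun z => cmap c (f z)) @^-1` V); split => //.
- by split => //=; exists (f p) => //; split => //; exact: Uc.
- move=> z [Uz [x [cx cPx] E1]].
  by rewrite -(ci _ (Uc _ Uz)) -E1 ci.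
- move=> k; apply: (Ck_ext oUV (f := fun z => cmap c' (Psi (cinv c (cmap c (f z)))))).
    by move=> z [Uz _]; rewrite ci //; exact: Uc.
  apply: (Ck_comp (V := V) (f := fun z => cmap c (f z))
                  (g := fun z => cmap c' (Psi (cinv c z)))) => //.
  + by move=> z [].
  + by apply: Ck_sub (fC k) => z [].
  + exact: Ps.
Qed.

Lemma smooth_at_comp P E E' (M M' : topologicalType)
    (atl : set (chart E M)) (atl' : set (chart E' M')) p (f : P -> M)
    (Psi : M -> M') : findim E -> (forall c, atl c -> is_chart c) ->
  (forall c, atl' c -> is_chart c) -> (forall x, exists2 c, atl' c & cdom c x) ->
  smooth_map atl atl' Psi -> smooth_at atl p f -> smooth_at atl' p (Psi \o f).
Proof.
move=> fE hatl hatl' cov hPsi fC; have [c' ac' cp] := cov (Psi (f p)).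
have [U [oU Up Uc UC]] :=
  smooth_at_comp_chart fE hatl hatl' hPsi fC ac' cp.
by exists c', U.
Qed.

Lemma smooth_at_pair P E E' (M M' : topologicalType)
    (atl : set (chart E M)) (atl' : set (chart E' M')) p (f : P -> M)
    (g : P -> M') : smooth_at atl p f -> smooth_at atl' p g ->
  smooth_at (prod_atlas atl atl') p (fun z => (f z, g z)).
Proof.
move=> [c [U [ac oU Up Uc fC]]] [c' [U' [ac' oU' Up' Uc' gC]]].
have oUU := openI oU oU'.
exists (prod_chart c c'), (U `&` U'); split => //.
- by exists c, c'.
- by move=> z [Uz Uz']; split; [exact: Uc|exact: Uc'].
move=> k; apply: Ck_pair => //.
  by apply: Ck_sub (fC k) => z [].
by apply: Ck_sub (gC k) => z [].
Qed.

Lemma smooth_at_precomp P P' E (M : topologicalType) (atl : set (chart E M))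
    p p' (f : P -> M) (h : P' -> P) (V : set P') : findim P ->
  open V -> V p' -> smooth_on V h -> h p' = p -> smooth_at atl p f ->
  smooth_at atl p' (fun z => f (h z)).
Proof.
move=> fP oV Vp hC hp [c [U [ac oU Up Uc fC]]].
have oVU := open_smooth_preimage oV hC oU.
exists c, (V `&` h @^-1` U); split => //.
- by split => //=; rewrite hp.
- by move=> z [_ Uz]; exact: Uc.
- move=> k; apply: (Ck_comp (V := U) (f := h) (g := fun z => cmap c (f z))) => //.
  + by move=> z [].
  + by apply: Ck_sub (hC k) => z [].
Qed.

Lemma smooth_at_cst P E (M : topologicalType) (atl : set (chart E M)) (p : P) x :
  (forall y, exists2 c, atl c & cdom c y) -> smooth_at atl p (fun _ => x).
Proof.
move=> cov; have [c ac cx] := cov x.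
exists c, setT; split => //; first exact: openT.
by move=> k; exact: Ck_cst.
Qed.

Lemma smooth_at_cinv E (M : topologicalType) (atl : set (chart E M)) c x :
  is_chart c -> atl c -> cdom c x -> smooth_at atl (cmap c x) (cinv c).
Proof.
move=> [od oi mc ic ci] ac cx; exists c, (cmap c @` cdom c); split => //.
- by move=> _ [y cy <-]; rewrite ci.
- move=> k; apply: (Ck_ext oi (f := id)); last exact: Ck_id.
  by move=> _ [y cy <-]; rewrite ci.
Qed.

Lemma smooth_at_continuous P E (M : topologicalType) (atl : set (chart E M)) p
    (f : P -> M) : (forall c, atl c -> is_chart c) ->
  smooth_at atl p f -> {for p, continuous f}.
Proof.
move=> hatl [c [U [ac oU Up Uc fC]]].
have hc := hatl c ac; have [_ _ _ _ ci] := hc.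
apply: (continuous_near_eq (f := fun z => cinv c (cmap c (f z)))).
  have nU : nbhs p U by exact: open_nbhs_nbhs.
  by apply: filterS nU => z /Uc cz; rewrite ci.
apply: continuous_comp.
  exact/differentiable_continuous/(smooth_on_differentiable fC).
by have [] := is_chart_continuous hc (Uc _ Up).
Qed.

Lemma near_chart_cancel E (M : topologicalType) (c : chart E M) x : is_chart c ->
  cdom c x -> \forall z \near cmap c x, cmap c (cinv c z) = z.
Proof.
move=> [od oi _ _ ci] cx; have : nbhs (cmap c x) (cmap c @` cdom c).
  by apply: open_nbhs_nbhs; split => //; exists x.
by apply: filterS => _ [y cy <-]; rewrite ci.
Qed.

End Germs.

(** * Logarithmic derivatives of curves *)

Section LieCalculus.
Context {R : realType} {E : normedModType R} (G : lie_data E).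

(** Continuity is a separate clause: [cmap] is arbitrary outside [cdom], so a derivative of the
    chart expression does not by itself keep c (t) close to 1. *)
Definition tangent1 (c : R -> G) (xi : E) :=
  [/\ c 0 = gone G, {for 0, continuous c} &
      is_derive (0 : R) (1 : R) (fun t => cmap (gchart1 G) (c t)) xi].

(* The part of the theory of Lie groups which only involves velocities at 1;  *)
(* it holds for semidirect G without having to make it a smooth manifold.     *)
Record lie_calculus : Prop := {
  lc_mulA : associative (@gmul R E G);
  lc_mul1g : left_id (gone G) (@gmul R E G);
  lc_mulVg : left_inverse (gone G) (@ginv R E G) (@gmul R E G);
  lc_tangentM : forall c c' xi xi', tangent1 c xi -> tangent1 c' xi' ->
    tangent1 (fun t => gmul (c t) (c' t)) (xi + xi');
  lc_tangentV : forall c xi, tangent1 c xi ->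
    tangent1 (fun t => ginv (c t)) (- xi);
  lc_tangentJ : forall g c xi, tangent1 c xi ->
    tangent1 (fun t => gmul (gmul g (c t)) (ginv g)) (Ad g xi);
  lc_tangent_ex : forall xi, exists c, tangent1 c xi }.

Lemma tangent1_unique c xi xi' : tangent1 c xi -> tangent1 c xi' -> xi = xi'.
Proof. by move=> [_ _ d] [_ _ d']; exact: is_derive_unique d d'. Qed.

Lemma tangent1_near c c' xi : (\forall t \near (0 : R), c t = c' t) ->
  tangent1 c xi -> tangent1 c' xi.
Proof.
move=> cc' [c0 cc dc]; split.
- by rewrite -(nbhs_singleton cc').
- exact: continuous_near_eq cc' cc.
- apply: near_eq_is_derive dc.
  by apply: filterS cc' => t ->.
Qed.

Lemma tangent1_eq c c' xi : c =1 c' -> tangent1 c xi -> tangent1 c' xi.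
Proof. by move=> cc'; have -> : c = c' by apply/funext. Qed.

Lemma tangent1_cst : tangent1 (fun _ => gone G) 0.
Proof. by split => //; [exact: cvg_cst|exact: is_derive_cst]. Qed.

(** The right logarithmic derivative h' (0) h (0)^-1, as a relation, so that asserting it includes
    that the derivative exists. *)
Definition rlog (h : R -> G) (r : E) :=
  tangent1 (fun t => gmul (h t) (ginv (h 0))) r.

Lemma rlog_unique h r r' : rlog h r -> rlog h r' -> r = r'.
Proof. exact: tangent1_unique. Qed.

Lemma rlog_eq h h' r : h =1 h' -> rlog h r -> rlog h' r.
Proof. by move=> hh'; apply: tangent1_eq => t; rewrite !hh'. Qed.

(** Stated from the bare one-sided axioms because it also serves in the proof that [G] satisfies
    [lie_calculus]. *)
Lemma group_mulgV : associative (@gmul R E G) -> left_id (gone G) (@gmul R E G) ->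
  left_inverse (gone G) (@ginv R E G) (@gmul R E G) ->
  right_inverse (gone G) (@ginv R E G) (@gmul R E G).
Proof.
move=> mulA mul1g mulVg x; rewrite -[LHS]mul1g -{1}(mulVg (ginv x)) -mulA.
by rewrite (mulA (ginv x)) mulVg mul1g mulVg.
Qed.

Lemma group_mulg1 : associative (@gmul R E G) -> left_id (gone G) (@gmul R E G) ->
  left_inverse (gone G) (@ginv R E G) (@gmul R E G) ->
  right_id (gone G) (@gmul R E G).
Proof.
move=> mulA mul1g mulVg x; rewrite -(mulVg x) mulA.
by rewrite (group_mulgV mulA mul1g mulVg) mul1g.
Qed.

Section Consequences.
Hypothesis hG : lie_calculus.
Let mulA := lc_mulA hG.
Let mul1g := lc_mul1g hG.
Let mulVg := lc_mulVg hG.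

Lemma lc_mulgV : right_inverse (gone G) (@ginv R E G) (@gmul R E G).
Proof. exact: group_mulgV. Qed.

Lemma lc_mulg1 : right_id (gone G) (@gmul R E G).
Proof. exact: group_mulg1. Qed.

Lemma lc_mulKg (x y : G) : gmul (ginv x) (gmul x y) = y.
Proof. by rewrite mulA mulVg mul1g. Qed.

Lemma lc_mulgK (x y : G) : gmul (gmul y x) (ginv x) = y.
Proof. by rewrite -mulA lc_mulgV lc_mulg1. Qed.

Lemma lc_mulgVK (x y : G) : gmul (gmul y (ginv x)) x = y.
Proof. by rewrite -mulA mulVg lc_mulg1. Qed.

Lemma lc_inv_uniq (x y : G) : gmul x y = gone G -> y = ginv x.
Proof. by move=> xy; rewrite -(lc_mulKg x y) xy lc_mulg1. Qed.

Lemma lc_invgK (x : G) : ginv (ginv x) = x.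
Proof. by apply/esym/lc_inv_uniq; rewrite mulVg. Qed.

Lemma lc_invMg (x y : G) : ginv (gmul x y) = gmul (ginv y) (ginv x).
Proof.
by apply/esym/lc_inv_uniq; rewrite mulA lc_mulgK lc_mulgV.
Qed.

Lemma lc_inv1g : ginv (gone G) = gone G.
Proof. by apply/esym/lc_inv_uniq; rewrite mul1g. Qed.

(** [Ad g xi] is the velocity of a conjugated curve and velocities are unique, so the laws of [Ad]
    are inherited from those of conjugation. *)
Lemma AdM (g h : G) xi : Ad (gmul g h) xi = Ad g (Ad h xi).
Proof.
have [c hc] := lc_tangent_ex hG xi.
apply: (tangent1_unique (lc_tangentJ hG (gmul g h) hc)).
apply: tangent1_eq (lc_tangentJ hG g (lc_tangentJ hG h hc)) => t.
by rewrite lc_invMg !mulA.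
Qed.

Lemma AdD (g : G) xi eta : Ad g (xi + eta) = Ad g xi + Ad g eta.
Proof.
have [c hc] := lc_tangent_ex hG xi; have [c' hc'] := lc_tangent_ex hG eta.
apply: (tangent1_unique (lc_tangentJ hG g (lc_tangentM hG hc hc'))).
have := lc_tangentM hG (lc_tangentJ hG g hc) (lc_tangentJ hG g hc').
by apply: tangent1_eq => t; rewrite !mulA lc_mulgVK.
Qed.

Lemma Ad1 xi : Ad (gone G) xi = xi.
Proof.
have [c hc] := lc_tangent_ex hG xi.
apply: (tangent1_unique (lc_tangentJ hG (gone G) hc)).
by apply: tangent1_eq hc => t; rewrite mul1g lc_inv1g lc_mulg1.
Qed.

Lemma Ad_0 (g : G) : Ad g 0 = 0.
Proof.
by apply: (addIr (Ad g 0)); rewrite -AdD !addr0 add0r.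
Qed.

Lemma AdN (g : G) xi : Ad g (- xi) = - Ad g xi.
Proof. by apply/eqP; rewrite -addr_eq0 -AdD addNr Ad_0. Qed.

Lemma AdB (g : G) xi eta : Ad g (xi - eta) = Ad g xi - Ad g eta.
Proof. by rewrite AdD AdN. Qed.

Lemma AdK (g : G) xi : Ad (ginv g) (Ad g xi) = xi.
Proof. by rewrite -AdM mulVg Ad1. Qed.

Lemma AdVK (g : G) xi : Ad g (Ad (ginv g) xi) = xi.
Proof. by rewrite -AdM lc_mulgV Ad1. Qed.

(** The curve (h h') (t) (h h') (0)^-1 is h (t) h (0)^-1 times the conjugate by h (0) of h' (t) h'
    (0)^-1. *)
Lemma rlogM h h' r r' : rlog h r -> rlog h' r' ->
  rlog (fun t => gmul (h t) (h' t)) (r + Ad (h 0) r').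
Proof.
move=> hr hr'; have := lc_tangentM hG hr (lc_tangentJ hG (h 0) hr').
by apply: tangent1_eq => t; rewrite lc_invMg !mulA lc_mulgVK.
Qed.

Lemma rlogV h r : rlog h r -> rlog (fun t => ginv (h t)) (- Ad (ginv (h 0)) r).
Proof.
move=> hr; have := lc_tangentJ hG (ginv (h 0)) (lc_tangentV hG hr).
rewrite AdN; apply: tangent1_eq => t.
by rewrite lc_invMg !lc_invgK mulA mulVg mul1g.
Qed.

Lemma rlog_cst (g : G) : rlog (fun _ => g) 0.
Proof. by apply: tangent1_eq tangent1_cst => t; rewrite lc_mulgV. Qed.

Lemma rlogMr h r g : rlog h r -> rlog (fun t => gmul (h t) g) r.
Proof. by move=> hr; have := rlogM hr (rlog_cst g); rewrite Ad_0 addr0. Qed.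

Lemma llogP h r : rlog h r ->
  tangent1 (fun t => gmul (ginv (h 0)) (h t)) (Ad (ginv (h 0)) r).
Proof.
move=> /(lc_tangentJ hG (ginv (h 0))); apply: tangent1_eq => t.
by rewrite lc_invgK mulA lc_mulgVK.
Qed.

Context {EN : normedModType R} {N : topologicalType}.
Variables (ch : chart EN N) (x : N).
Hypotheses (cinvx : cinv ch (cmap ch x) = x).
Variables (h : N -> G) (v : EN) (r : E).
Hypothesis hr : rlog (fun t => h (cinv ch (t *: v + cmap ch x))) r.

(** The value of the form on v is the logarithmic velocity of [h] along the coordinate line through
    x; identities between forms thereby become identities between curves. *)
Lemma mc_rightE : mc_right h ch x v = r.
Proof.
have [_ _] := hr; rewrite scale0r add0r cinvx => d.
by case: ((is_derive_lineP (fun z =>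
  cmap (gchart1 G) (gmul (h (cinv ch z)) (ginv (h x)))) (cmap ch x) v r).2 d).
Qed.

Lemma mc_leftE : mc_left h ch x v = Ad (ginv (h x)) r.
Proof.
have [_ _] := llogP hr; rewrite scale0r add0r cinvx => d.
by case: ((is_derive_lineP (fun z =>
  cmap (gchart1 G) (gmul (ginv (h x)) (h (cinv ch z)))) (cmap ch x) v
  (Ad (ginv (h x)) r)).2 d).
Qed.

End Consequences.
End LieCalculus.

(** * Velocities in a Lie group *)

Section LieGroup.
Context {R : realType} {d : nat} {G : lie_data 'rV[R]_d}.
Hypothesis hG : lie_group G.

Local Notation g := 'rV[R]_d.
Local Notation kap := (cmap (gchart1 G)).
Local Notation kinv := (cinv (gchart1 G)).
Local Notation e0 := (kap (gone G)).
Local Notation smoothG := (smooth_at (gatlas G)).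

Lemma gatlas_chart c : gatlas G c -> is_chart c.
Proof. by have [_ _ + _ _] := lie_manifold hG; apply. Qed.

Lemma gatlas_cover (x : G) : exists2 c, gatlas G c & cdom c x.
Proof. by have [_ _ _ + _] := lie_manifold hG; apply. Qed.

Lemma gatlas_id : smooth_map (gatlas G) (gatlas G) (fun x : G => x).
Proof. by have [_ _ _ _ +] := lie_manifold hG; apply. Qed.

Lemma gmul_continuous : continuous (fun p : (G * G)%type => gmul p.1 p.2).
Proof. by have [] := lie_smooth_mul hG. Qed.

Lemma findim_g : findim g. Proof. exact: findim_mx. Qed.

Section Smooth.
Context {P : normedModType R}.
Implicit Types (p : P) (f h : P -> G).

Lemma smoothG_cst p (x : G) : smoothG p (fun _ => x).
Proof. exact/smooth_at_cst/gatlas_cover. Qed.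

Lemma smoothGM p f h : smoothG p f -> smoothG p h ->
  smoothG p (fun z => gmul (f z) (h z)).
Proof.
move=> fC hC; have := smooth_at_pair fC hC.
apply: (smooth_at_comp _ _ gatlas_chart gatlas_cover (lie_smooth_mul hG)).
  by apply: findim_prod; exact: findim_g.
by move=> _ [c [c' [ac ac' ->]]]; apply: is_chart_prod; exact: gatlas_chart.
Qed.

Lemma smoothGV p f : smoothG p f -> smoothG p (fun z => ginv (f z)).
Proof.
exact: (smooth_at_comp findim_g gatlas_chart gatlas_chart gatlas_cover
  (lie_smooth_inv hG)).
Qed.

Lemma smoothG_chart p f c : smoothG p f -> gatlas G c -> cdom c (f p) ->
  exists U, [/\ open U, U p, forall z, U z -> cdom c (f z) &
                smooth_on U (fun z => cmap c (f z))].
Proof.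
exact: (smooth_at_comp_chart findim_g gatlas_chart gatlas_chart gatlas_id).
Qed.

Lemma smoothG_continuous p f : smoothG p f -> {for p, continuous f}.
Proof. exact/smooth_at_continuous/gatlas_chart. Qed.

Lemma smoothG_differentiable p f : smoothG p f -> f p = gone G ->
  differentiable (fun z => kap (f z)) p.
Proof.
move=> fC fp; have [|U [oU Up _ UC]] := smoothG_chart fC (lie_chart1_atlas hG).
  by rewrite fp; exact: lie_chart1_dom.
exact: smooth_on_differentiable UC Up.
Qed.

Lemma tangent1_line p f v : smoothG p f -> f p = gone G ->
  tangent1 (fun t : R => f (t *: v + p)) ('D_v (fun z => kap (f z)) p).
Proof.
move=> fC fp; have df := smoothG_differentiable fC fp.
split; first by rewrite scale0r add0r.
  have lc : {for (0 : R), continuous (fun t : R => t *: v + p)}.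
    have L := is_derive_line (f := id) (v := v) (q := p) (s := 0).
    apply: is_derive_continuous (L _); exact: ex_diff.
  apply: (continuous_comp lc); rewrite scale0r add0r.
  exact: smoothG_continuous.
exact: ((is_derive_lineP _ p v _).1 (diff_is_derive v df)).
Qed.

End Smooth.

Lemma chart1_chart : is_chart (gchart1 G).
Proof. exact/gatlas_chart/(lie_chart1_atlas hG). Qed.

Lemma kinv1 : kinv e0 = gone G.
Proof. by have [_ _ _ _] := chart1_chart; apply; exact: lie_chart1_dom. Qed.

Lemma smoothG_kinv : smoothG e0 kinv.
Proof.
apply: smooth_at_cinv chart1_chart _ _; first exact: lie_chart1_atlas.
exact: lie_chart1_dom.
Qed.

Lemma near_kap1 : \forall x \near gone G, kinv (kap x) = x.
Proof.
have [od _ _ _ ci] := chart1_chart.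
have : nbhs (gone G) (cdom (gchart1 G)).
  by apply: open_nbhs_nbhs; split => //; exact: lie_chart1_dom.
by apply: filterS => x; exact: ci.
Qed.

Lemma tangent1_kap (c : R -> G) xi : tangent1 c xi ->
  \forall t \near (0 : R), kinv (kap (c t)) = c t.
Proof.
move=> [c0 cc _]; move: cc; rewrite /prop_for /continuous_at c0 => cc.
exact: cc near_kap1.
Qed.

Lemma tangent1_comp (W : normedModType R) (F : g -> W) (c : R -> G) xi :
  differentiable F e0 -> tangent1 c xi ->
  is_derive (0 : R) 1 (fun t => F (kap (c t))) ('D_xi F e0).
Proof.
move=> dF [c0 _ dc]; have := is_derive_comp (c := fun t => kap (c t)) (f := F).
by rewrite c0; apply.
Qed.

(** The chain rule at 1. For a conjugation [Psi] the derivative obtained is literally the definition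
    of [Ad]. *)
Lemma tangent1_map (Psi : G -> G) (c : R -> G) xi :
  smoothG e0 (fun z => Psi (kinv z)) -> Psi (gone G) = gone G ->
  tangent1 c xi ->
  tangent1 (fun t => Psi (c t)) ('D_xi (fun z => kap (Psi (kinv z))) e0).
Proof.
move=> PC P1 hc; have [c0 cc dc] := hc.
apply: (tangent1_near (c := fun t => Psi (kinv (kap (c t))))).
  by apply: filterS (tangent1_kap hc) => t ->.
have Pe : Psi (kinv e0) = gone G by rewrite kinv1.
split; first by rewrite c0 Pe.
- have PCc := smoothG_continuous PC; rewrite -c0 in PCc.
  exact: (continuous_comp (is_derive_continuous dc) PCc).
- exact: tangent1_comp (smoothG_differentiable PC Pe) hc.
Qed.

Lemma smoothG_precomp (P P' : normedModType R) (p : P) (p' : P') (f : P -> G)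
    (h : P' -> P) : findim P -> smooth_on setT h -> h p' = p ->
  smoothG p f -> smoothG p' (fun z => f (h z)).
Proof.
by move=> fP hC hp fC; apply: (smooth_at_precomp fP openT _ hC hp fC).
Qed.

Lemma smooth_fst (P P' : normedModType R) : smooth_on setT (@fst P P').
Proof.
by move=> k; apply: (Ck_linear (L := fst) (f := id) openT);
  [move=> p; exact: cvg_fst|exact: Ck_id openT].
Qed.

Lemma smooth_snd (P P' : normedModType R) : smooth_on setT (@snd P P').
Proof.
by move=> k; apply: (Ck_linear (L := snd) (f := id) openT);
  [move=> p; exact: cvg_snd|exact: Ck_id openT].
Qed.

Lemma smoothG_kinv1 : smoothG (e0, e0) (fun z : g * g => kinv z.1).
Proof. exact: (smoothG_precomp findim_g (@smooth_fst _ _) _ smoothG_kinv). Qed.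

Lemma smoothG_kinv2 : smoothG (e0, e0) (fun z : g * g => kinv z.2).
Proof. exact: (smoothG_precomp findim_g (@smooth_snd _ _) _ smoothG_kinv). Qed.

Lemma near_kinv : \forall z \near e0, kap (kinv z) = z.
Proof. by apply: near_chart_cancel chart1_chart _; exact: lie_chart1_dom. Qed.

Lemma near_kinv_line xi : \forall t \near (0 : R),
  kap (kinv (t *: xi + e0)) = t *: xi + e0.
Proof.
have lc : {for (0 : R), continuous (fun t : R => t *: xi + e0)}.
  have L := is_derive_line (f := id) (v := xi) (q := e0) (s := 0).
  apply: is_derive_continuous (L _); exact: ex_diff.
move: lc; rewrite /prop_for /continuous_at scale0r add0r => lc.
exact: lc near_kinv.
Qed.

Lemma is_derive_affine (W : normedModType R) (v q : W) :
  is_derive (0 : R) (1 : R) (fun t : R => t *: v + q) v.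
Proof.
exact: ((is_derive_lineP id q v v).1 (is_derive_id q v)).
Qed.

Let mulA := lie_mulA hG.
Let mul1g := lie_mul1g hG.
Let mulVg := lie_mulVg hG.
Let mulg1 := group_mulg1 mulA mul1g mulVg.
Let mulgV := group_mulgV mulA mul1g mulVg.

Lemma tangent1_comp2 (W : normedModType R) (F : g * g -> W) (c c' : R -> G)
    xi xi' : differentiable F (e0, e0) -> tangent1 c xi -> tangent1 c' xi' ->
  is_derive (0 : R) 1 (fun t => F (kap (c t), kap (c' t)))
    ('D_(xi, xi') F (e0, e0)).
Proof.
move=> dF [c0 _ dc] [c0' _ dc'].
have := is_derive_comp (c := fun t => (kap (c t), kap (c' t))) (f := F) _
  (is_derive_pair dc dc').
by rewrite c0 c0'; apply.
Qed.

(** The differential of the multiplication at (1, 1) is addition: it is linear, and on each axis the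
    multiplication by 1 is the identity ([D1] and [D2]). *)
Lemma tangent1M (c c' : R -> G) xi xi' : tangent1 c xi -> tangent1 c' xi' ->
  tangent1 (fun t => gmul (c t) (c' t)) (xi + xi').
Proof.
move=> hc hc'; have [c0 cc dc] := hc; have [c0' cc' dc'] := hc'.
pose F (z : g * g) := kap (gmul (kinv z.1) (kinv z.2)).
have FC := smoothGM smoothG_kinv1 smoothG_kinv2.
have dF : differentiable F (e0, e0).
  by apply: (smoothG_differentiable FC); rewrite /= kinv1 mul1g.
split; first by rewrite c0 c0' mul1g.
  exact: (continuous_comp (f := fun t => (c t, c' t)) (cvg_pair cc cc')
    (@gmul_continuous (c 0, c' 0))).
have D1 : 'D_(xi, 0) F (e0, e0) = xi.
  have H := (is_derive_lineP F (e0, e0) (xi, 0) _).1 (diff_is_derive (xi, 0) dF).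
  apply: (is_derive_unique H); apply: near_eq_is_derive (is_derive_affine xi e0).
  apply: filterS (near_kinv_line xi) => t /= {1}<-.
  by rewrite /F /= scaler0 add0r kinv1 mulg1.
have D2 : 'D_(0, xi') F (e0, e0) = xi'.
  have H := (is_derive_lineP F (e0, e0) (0, xi') _).1 (diff_is_derive (0, xi') dF).
  apply: (is_derive_unique H); apply: near_eq_is_derive (is_derive_affine xi' e0).
  apply: filterS (near_kinv_line xi') => t /= {1}<-.
  by rewrite /F /= scaler0 add0r kinv1 mul1g.
have <- : 'D_(xi, xi') F (e0, e0) = xi + xi'.
  rewrite -{2}D1 -{2}D2 !(deriveE _ dF) -linearD.
  by congr ('d F _ _); congr pair => /=; rewrite ?addr0 ?add0r.
apply: near_eq_is_derive (tangent1_comp2 dF hc hc').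
by apply: filterS2 (tangent1_kap hc) (tangent1_kap hc') => t /= E1 E2; rewrite /F /= E1 E2.
Qed.

(** Smoothness of the inverse provides some velocity eta. The product of the two curves is constant,
    so xi + eta = 0. *)
Lemma tangent1V (c : R -> G) xi : tangent1 c xi ->
  tangent1 (fun t => ginv (c t)) (- xi).
Proof.
move=> hc; have := tangent1_map (Psi := @ginv _ _ G) (smoothGV smoothG_kinv) _ hc.
have i1 : ginv (gone G) = gone G by rewrite -[LHS]mulg1 mulVg.
move=> /(_ i1); set eta := 'D_xi _ _ => hV.
have E0 : xi + eta = 0.
  apply: (fun H => tangent1_unique H (tangent1_cst G)).
  apply: tangent1_eq (tangent1M hc hV).
  by move=> t; rewrite mulgV.
by have <- : eta = - xi by apply/eqP; rewrite -addr_eq0 addrC E0.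
Qed.

Lemma smoothG_conj (h : G) : smoothG e0 (fun z => gmul (gmul h (kinv z)) (ginv h)).
Proof.
apply: smoothGM (smoothG_cst _ _); apply: smoothGM smoothG_kinv.
exact: smoothG_cst.
Qed.

Lemma conj1 (h : G) : gmul (gmul h (gone G)) (ginv h) = gone G.
Proof. by rewrite mulg1 mulgV. Qed.

Lemma tangent1_kinv xi : tangent1 (fun t : R => kinv (t *: xi + e0)) xi.
Proof.
have := tangent1_line xi smoothG_kinv kinv1.
rewrite (@near_eq_derive _ _ _ _ id); last exact: near_kinv.
by rewrite derive_id.
Qed.

Lemma lie_group_calculus : lie_calculus G.
Proof.
split.
- exact: mulA.
- exact: mul1g.
- exact: mulVg.
- exact: tangent1M.
- exact: tangent1V.
- move=> h c xi hc.
  exact: (tangent1_map (Psi := fun x => gmul (gmul h x) (ginv h))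
           (smoothG_conj h) (conj1 h) hc).
- by move=> xi; exists (fun t => kinv (t *: xi + e0)); exact: tangent1_kinv.
Qed.

Lemma Ad_differentiable (h : G) :
  differentiable (fun z => kap (gmul (gmul h (kinv z)) (ginv h))) e0.
Proof.
by apply: (smoothG_differentiable (smoothG_conj h)); rewrite kinv1 conj1.
Qed.

Lemma Ad_is_linear (h : G) : linear (@Ad _ _ G h).
Proof.
move=> a xi eta; have dA := Ad_differentiable h.
by rewrite /Ad !(deriveE _ dA) linearP.
Qed.

(** [Ad (kinv z) eta] is the partial derivative at (z, e0), in the second variable, of a function
    smooth in both variables: the chart expression of (z, y) |-> kinv z * kinv y * (kinv z)^-1. *)
Lemma Ad_kinv_differentiable eta : differentiable (fun z => Ad (kinv z) eta) e0.
Proof.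
pose f (z : g * g) := gmul (gmul (kinv z.1) (kinv z.2)) (ginv (kinv z.1)).
pose F (z : g * g) := kap (f z).
have fC : smoothG (e0, e0) f.
  apply: smoothGM; last exact: smoothGV smoothG_kinv1.
  exact: smoothGM smoothG_kinv1 smoothG_kinv2.
have f1 : f (e0, e0) = gone G by rewrite /f /= kinv1 conj1.
have [|U [oU Up _ UC]] := smoothG_chart fC (lie_chart1_atlas hG).
  by rewrite f1; exact: lie_chart1_dom.
have dDF : differentiable ('D_(0, eta) F) (e0, e0).
  by apply: smooth_on_differentiable Up; exact: smooth_on_derive UC.
have dp : differentiable (fun z : g => (z, e0)) e0.
  exact: differentiable_pair.
apply: differentiable_near_eq (differentiable_comp dp dDF).
have : \forall z \near e0, U (z, e0).
  have cp := differentiable_continuous dp.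
  by apply: cp; exact: open_nbhs_nbhs.
apply: filterS => z Uz /=; apply/esym.
have dF : differentiable F (z, e0) by exact: smooth_on_differentiable UC Uz.
have H := (is_derive_lineP F (z, e0) (0, eta) _).1 (diff_is_derive (0, eta) dF).
have [_ <-] // : is_derive e0 eta
  (fun y => kap (gmul (gmul (kinv z) (kinv y)) (ginv (kinv z))))
  ('D_(0, eta) F (z, e0)).
apply/is_derive_lineP; move: H; congr is_derive; apply/funext => t.
by rewrite /F /f /= scaler0 add0r.
Qed.

Lemma is_derive_Ad (c : R -> G) xi eta : tangent1 c xi ->
  is_derive (0 : R) 1 (fun t => Ad (c t) eta) (lie_bracket G xi eta).
Proof.
move=> hc; apply: near_eq_is_derive
  (tangent1_comp (Ad_kinv_differentiable eta) hc).
by apply: filterS (tangent1_kap hc) => t ->.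
Qed.

End LieGroup.

(** * The Maurer-Cartan equation *)

(* Otherwise unification tries to match distinct derivatives by unfolding limits. *)
#[local] Opaque derive Ad lie_bracket.

Section MaurerCartan.
Context {R : realType} {d : nat} {G : lie_data 'rV[R]_d}.
Hypothesis hG : lie_group G.

Local Notation g := 'rV[R]_d.
Local Notation kap := (cmap (gchart1 G)).
Local Notation kinv := (cinv (gchart1 G)).
Local Notation e0 := (kap (gone G)).
Local Notation smoothG := (smooth_at (gatlas G)).
Local Notation br := (lie_bracket G).

Let hL := lie_group_calculus hG.

Lemma mul_rV_lin1_linear m n (f : 'rV[R]_m -> 'rV[R]_n) u :
  linear f -> u *m lin1_mx f = f u.
Proof.
move=> lf; pose L : {linear 'rV[R]_m -> 'rV[R]_n} :=
  HB.pack f (GRing.isLinear.Build _ _ _ _ f lf).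
by rewrite -[f]/(L : _ -> _) mul_rV_lin1.
Qed.

Lemma mul_lin1_Ad (h : G) xi : xi *m lin1_mx (Ad h) = Ad h xi.
Proof. by apply: mul_rV_lin1_linear; exact: Ad_is_linear. Qed.

Lemma lie_bracket_is_linear xi : linear (lie_bracket G xi).
Proof.
move=> a eta eta'; have [c hc] := lc_tangent_ex hL xi.
apply: is_derive_unique (is_derive_Ad hG (a *: eta + eta') hc) _.
have := is_deriveD (is_deriveZ a (is_derive_Ad hG eta hc)) (is_derive_Ad hG eta' hc).
congr is_derive; apply/funext => t.
by rewrite !fctE (Ad_is_linear hG).
Qed.

Lemma mul_lin1_bracket xi eta : eta *m lin1_mx (lie_bracket G xi) = br xi eta.
Proof. by apply: mul_rV_lin1_linear; exact: lie_bracket_is_linear. Qed.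

Lemma is_derive_lin1_Ad (c : R -> G) xi : tangent1 c xi ->
  is_derive (0 : R) 1 (fun t => lin1_mx (Ad (c t))) (lin1_mx (lie_bracket G xi)).
Proof.
move=> hc; apply/is_derive_mx => i j.
have := (is_derive_mx _ _ _ _).1 (is_derive_Ad hG (delta_mx 0 i) hc) 0 j.
rewrite mxE; congr is_derive; apply/funext => t.
by rewrite mxE.
Qed.

Lemma is_derive_Ad_app (c : R -> G) xi (w : R -> g) w' : tangent1 c xi ->
  is_derive (0 : R) 1 w w' ->
  is_derive (0 : R) 1 (fun t => Ad (c t) (w t)) (br xi (w 0) + w').
Proof.
move=> hc dw; have [c0 _ _] := hc.
have := is_derive_mulmx dw (is_derive_lin1_Ad hc).
rewrite (mul_lin1_bracket xi) c0 (mul_lin1_Ad (gone G)) (Ad1 hL) addrC.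
by congr is_derive; apply/funext => t; rewrite mul_lin1_Ad.
Qed.

Local Notation P := (R^o * R^o)%type.
Local Notation v1 := ((1, 0) : P).
Local Notation v2 := ((0, 1) : P).

Let line1 (s t : R) : s *: v1 + (0, t) = (s, t) :> P.
Proof. by congr pair; rewrite /= ?[_%:A]mulr1 ?scaler0 ?addr0 ?add0r. Qed.

Let line2 (s t : R) : t *: v2 + (s, 0) = (s, t) :> P.
Proof. by congr pair; rewrite /= ?[_%:A]mulr1 ?scaler0 ?addr0 ?add0r. Qed.

Lemma findim_plane : findim P.
Proof. by apply: findim_prod; exact: findim_reg. Qed.

Let is_derive_axis1 (W : normedModType R) (F : P -> W) :
  differentiable F (0, 0) ->
  is_derive (0 : R) 1 (fun s : R => F (s, 0)) ('D_v1 F (0, 0)).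
Proof.
move=> dF; have := (is_derive_lineP F (0, 0) v1 _).1 (diff_is_derive v1 dF).
by congr is_derive; apply/funext => s; rewrite line1.
Qed.

Let is_derive_axis2 (W : normedModType R) (F : P -> W) :
  differentiable F (0, 0) ->
  is_derive (0 : R) 1 (fun t : R => F (0, t)) ('D_v2 F (0, 0)).
Proof.
move=> dF; have := (is_derive_lineP F (0, 0) v2 _).1 (diff_is_derive v2 dF).
by congr is_derive; apply/funext => s; rewrite line2.
Qed.

(** As c = 1 on both axes, each curve c (s, .) and c (., t) starts at 1, so its velocity is a
    genuine partial derivative of the one function [C]. Symmetry of second derivatives then gives
    the common derivative m. *)
Lemma mixed_derivatives (c : P -> G) : smoothG ((0, 0) : P) c ->
  (forall s : R, c (s, 0) = gone G) -> (forall t : R, c (0, t) = gone G) ->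
  exists (D1 D2 : R -> g) (m : g),
  [/\ \forall s \near (0 : R), tangent1 (fun t : R => c (s, t)) (D2 s),
      \forall t \near (0 : R), tangent1 (fun s : R => c (s, t)) (D1 t),
      D1 0 = 0 /\ D2 0 = 0 &
      is_derive (0 : R) 1 D1 m /\ is_derive (0 : R) 1 D2 m].
Proof.
move=> cC c1 c2.
have [|U [oU U00 Uc UC]] := smoothG_chart hG cC (lie_chart1_atlas hG).
  by rewrite c1; exact: lie_chart1_dom.
pose C (z : P) := kap (c z).
have cCU z : U z -> smoothG z c.
  by move=> Uz; exists (gchart1 G), U; split => //; exact: lie_chart1_atlas.
have tc2 (s : R) : U (s, 0) ->
    tangent1 (fun t : R => c (s, t)) ('D_v2 C (s, 0)).
  move=> Us; apply: tangent1_eq (tangent1_line hG v2 (cCU _ Us) (c1 s)) => t.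
  by rewrite line2.
have tc1 (t : R) : U (0, t) ->
    tangent1 (fun s : R => c (s, t)) ('D_v1 C (0, t)).
  move=> Ut; apply: tangent1_eq (tangent1_line hG v1 (cCU _ Ut) (c2 t)) => s.
  by rewrite line1.
have nU1 : \forall s \near (0 : R), U (s, 0).
  have L := is_derive_continuous (is_derive_affine v1 ((0, 0) : P)).
  have nU : nbhs ((0 : R) *: v1 + (0, 0)) U.
    by rewrite line1; exact: open_nbhs_nbhs.
  have UL : \forall s \near (0 : R), U (s *: v1 + (0, 0)) by exact: L nU.
  by apply: filterS UL => s; rewrite line1.
have nU2 : \forall t \near (0 : R), U (0, t).
  have L := is_derive_continuous (is_derive_affine v2 ((0, 0) : P)).
  have nU : nbhs ((0 : R) *: v2 + (0, 0)) U.
    by rewrite line2; exact: open_nbhs_nbhs.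
  have UL : \forall s \near (0 : R), U (s *: v2 + (0, 0)) by exact: L nU.
  by apply: filterS UL => s; rewrite line2.
have dD v : differentiable ('D_v C) (0, 0).
  by apply: smooth_on_differentiable U00; exact: smooth_on_derive.
exists (fun t => 'D_v1 C (0, t)), (fun s => 'D_v2 C (s, 0)),
  ('D_v2 ('D_v1 C) (0, 0)); split.
- by apply: filterS nU1 => s; exact: tc2.
- by apply: filterS nU2 => t; exact: tc1.
- split.
    apply: (tangent1_unique (tc1 0 U00)).
    by apply: tangent1_eq (tangent1_cst G) => s; rewrite c1.
  apply: (tangent1_unique (tc2 0 U00)).
  by apply: tangent1_eq (tangent1_cst G) => s; rewrite c2.
- split; first exact: is_derive_axis2 (dD v1).
  rewrite -(derive_derive_comm v2 v1 oU U00 UC).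
  exact: is_derive_axis1 (dD v2).
Qed.

(* f (s, t) = a s * c (s, t) * b t with c = 1 on both axes, so that only the  *)
(* factor Ad (a s) distinguishes the two mixed derivatives.                   *)
Lemma maurer_cartan (f : P -> G) : smoothG ((0, 0) : P) f ->
  exists (r1 r2 : R -> g) (m : g),
  [/\ \forall s \near (0 : R), rlog (fun t : R => f (s, t)) (r2 s),
      \forall t \near (0 : R), rlog (fun s : R => f (s, t)) (r1 t),
      is_derive (0 : R) 1 r2 (br (r1 0) (r2 0) + m) &
      is_derive (0 : R) 1 r1 m].
Proof.
move=> fC.
have mulA := lc_mulA hL; have mul1g := lc_mul1g hL; have mulVg := lc_mulVg hL.
(* Right translation by a constant does not affect [rlog], so f may be normalised to take the value
   1 at the origin. *)
have [F [FC F0 FK]] : exists F : P -> G, [/\ smoothG ((0, 0) : P) F,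
    F (0, 0) = gone G & forall z, gmul (F z) (f (0, 0)) = f z].
  exists (fun z => gmul (f z) (ginv (f (0, 0)))); split.
  - by apply: (smoothGM hG) => //; exact: smoothG_cst.
  - by rewrite (lc_mulgV hL).
  - by move=> z; rewrite (lc_mulgVK hL).
have hC1 : smooth_on setT (fun z : P => (z.1, 0) : P).
  by move=> k; apply: Ck_pair openT _ _; [exact: smooth_fst|exact: Ck_cst].
have hC2 : smooth_on setT (fun z : P => (0, z.2) : P).
  by move=> k; apply: Ck_pair openT _ _; [exact: Ck_cst|exact: smooth_snd].
have aC : smoothG ((0, 0) : P) (fun z : P => F (z.1, 0)).
  exact: (smoothG_precomp findim_plane hC1 _ FC).
have bC : smoothG ((0, 0) : P) (fun z : P => F (0, z.2)).
  exact: (smoothG_precomp findim_plane hC2 _ FC).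
pose c (z : P) := gmul (gmul (ginv (F (z.1, 0))) (F z)) (ginv (F (0, z.2))).
have cC : smoothG ((0, 0) : P) c.
  apply: (smoothGM hG); last exact: (smoothGV hG).
  by apply: (smoothGM hG) => //; exact: (smoothGV hG).
have [||D1 [D2 [m [tc2 tc1 [D10 D20] [dD1 dD2]]]]] := mixed_derivatives cC.
- by move=> s; rewrite /c /= mulVg mul1g F0 (lc_inv1g hL).
- by move=> t; rewrite /c /= F0 (lc_inv1g hL) mul1g (lc_mulgV hL).
pose a' := 'D_v1 (fun z => kap (F z)) (0, 0).
pose b' := 'D_v2 (fun z => kap (F z)) (0, 0).
have ta : tangent1 (fun s : R => F (s, 0)) a'.
  by apply: tangent1_eq (tangent1_line hG v1 FC F0) => s; rewrite line1.
have tb : tangent1 (fun t : R => F (0, t)) b'.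
  by apply: tangent1_eq (tangent1_line hG v2 FC F0) => t; rewrite line2.
move: a' b' ta tb => a' b' ta tb.
have Fc (s t : R) : F (s, t) = gmul (gmul (F (s, 0)) (c (s, t))) (F (0, t)).
  by rewrite /c /= !mulA (lc_mulgVK hL) (lc_mulgV hL) mul1g.
have toF h r : rlog (fun x : R => F (h x)) r -> rlog (fun x : R => f (h x)) r.
  by move=> H; apply: rlog_eq (rlogMr hL (f (0, 0)) H) => x; rewrite FK.
(* From the factorisation, f (s, t) f (0, t)^-1 = a (s) c (s, t), while f (s, t) f (s, 0)^-1 is the
   conjugate by a (s) of c (s, t) b (t). *)
exists (fun t => a' + D1 t), (fun s => Ad (F (s, 0)) (D2 s + b')), m; split.
- apply: filterS tc2 => s ts; apply: toF.
  have := lc_tangentJ hL (F (s, 0)) (lc_tangentM hL ts tb).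
  by apply: tangent1_eq => t; rewrite (Fc s t) !mulA.
- apply: filterS tc1 => t tt; apply: toF; have := lc_tangentM hL ta tt.
  by apply: tangent1_eq => s; rewrite (Fc s t) (lc_mulgK hL).
- have := is_derive_Ad_app ta (is_deriveD dD2 (is_derive_cst b' (0 : R) 1)).
  by rewrite !fctE /cst D10 D20 F0 (Ad1 hL) !addr0 add0r.
- have := is_deriveD (is_derive_cst a' (0 : R) 1) dD1.
  by rewrite add0r.
Qed.

(** The Maurer-Cartan equation is applied to a surface through 1 with velocities xi and eta, and to
    the same surface with its parameters exchanged. Both involve the same two velocity functions,
    and adding the equations leaves [xi, eta] + [eta, xi] = 0. *)
Lemma lie_bracket_anti xi eta : br xi eta = - br eta xi.
Proof.
pose f (z : P) := kinv (z.1 *: xi + (z.2 *: eta + e0)).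
have hC : smooth_on setT (fun z : P => z.1 *: xi + (z.2 *: eta + e0)).
  move=> k; apply: CkD openT _ (CkD openT _ _).
  - by apply: CkZ openT _ _; [exact: smooth_fst|exact: Ck_cst].
  - by apply: CkZ openT _ _; [exact: smooth_snd|exact: Ck_cst].
  - exact: Ck_cst.
have fC : smoothG ((0, 0) : P) f.
  apply: (smoothG_precomp _ hC _ (smoothG_kinv hG)); first exact: findim_g.
  by rewrite /= !scale0r !add0r.
have swC : smooth_on setT (fun z : P => (z.2, z.1) : P).
  by move=> k; apply: Ck_pair openT _ _; [exact: smooth_snd|exact: smooth_fst].
have fC' : smoothG ((0, 0) : P) (fun z : P => f (z.2, z.1)).
  exact: (smoothG_precomp findim_plane swC _ fC).
have [r1 [r2 [m [h2 h1 d2 d1]]]] := maurer_cartan fC.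
have [q1 [q2 [m' [k2 k1 e2 e1]]]] := maurer_cartan fC'.
have nrq : \forall s \near (0 : R), r2 s = q1 s.
  by apply: filterS2 h2 k1 => s; exact: rlog_unique.
have nqr : \forall s \near (0 : R), r1 s = q2 s.
  by apply: filterS2 h1 k2 => s; exact: rlog_unique.
have E1 : br (r1 0) (r2 0) + m = m'.
  exact: is_derive_unique (near_eq_is_derive nrq d2) e1.
have E2 : m = br (q1 0) (q2 0) + m'.
  exact: is_derive_unique (near_eq_is_derive nqr d1) e2.
have t1 : tangent1 (fun s : R => f (s, 0)) xi.
  apply: tangent1_eq (tangent1_kinv hG xi) => s.
  by rewrite /f /= scale0r add0r.
have t2 : tangent1 (fun t : R => f (0, t)) eta.
  apply: tangent1_eq (tangent1_kinv hG eta) => s.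
  by rewrite /f /= scale0r add0r.
have f0 : f (0, 0) = gone G by rewrite /f /= !scale0r !add0r kinv1.
have r10 : r1 0 = xi.
  apply: rlog_unique (nbhs_singleton h1) _; apply: tangent1_eq t1 => s.
  by rewrite f0 (lc_inv1g hL) (lc_mulg1 hL).
have r20 : r2 0 = eta.
  apply: rlog_unique (nbhs_singleton h2) _; apply: tangent1_eq t2 => s.
  by rewrite f0 (lc_inv1g hL) (lc_mulg1 hL).
move: E1; rewrite {}E2 -(nbhs_singleton nrq) -(nbhs_singleton nqr) r10 r20 addrA.
by move/eqP; rewrite -subr_eq0 addrK addr_eq0 => /eqP.
Qed.

End MaurerCartan.

(** * The semidirect product *)

Section SemidirectCalculus.
Context {R : realType} {d : nat} {G : lie_data 'rV[R]_d}.
Hypothesis hG : lie_group G.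

Local Notation gs := 'cV[R]_d.
Local Notation dpair := Defs.dpair.
Local Notation h := ('rV[R]_d * 'cV[R]_d)%type.
Local Notation H := (semidirect G).
Local Notation kap := (cmap (gchart1 G)).
Local Notation br := (lie_bracket G).

Let hL := lie_group_calculus hG.

Lemma AdsM (u v : G) (j : gs) : Ads (gmul u v) j = Ads v (Ads u j).
Proof.
rewrite /Ads mulmxA; congr (_ *m _); apply/row_matrixP => i.
rewrite !rowE mulmxA !(mul_lin1_Ad hG); exact: (AdM hL).
Qed.

Lemma Ads1 (j : gs) : Ads (gone G) j = j.
Proof.
rewrite /Ads (_ : lin1_mx _ = 1%:M) ?mul1mx //; apply/row_matrixP => i.
by rewrite !rowE mulmx1 (mul_lin1_Ad hG) (Ad1 hL).
Qed.

Lemma AdsK (u : G) (j : gs) : Ads (ginv u) (Ads u j) = j.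
Proof. by rewrite -AdsM (lc_mulgV hL) Ads1. Qed.

Lemma AdsVK (u : G) (j : gs) : Ads u (Ads (ginv u) j) = j.
Proof. by rewrite -AdsM (lc_mulVg hL) Ads1. Qed.

Lemma AdsD (u : G) (j j' : gs) : Ads u (j + j') = Ads u j + Ads u j'.
Proof. exact: mulmxDr. Qed.

Lemma AdsN (u : G) (j : gs) : Ads u (- j) = - Ads u j.
Proof. exact: mulmxN. Qed.

Lemma Ads0 (u : G) : Ads u 0 = 0 :> gs. Proof. exact: mulmx0. Qed.

Lemma dpairDl (j j' : gs) xi : dpair (j + j') xi = dpair j xi + dpair j' xi.
Proof. by rewrite /Defs.dpair mulmxDr mxE. Qed.

Lemma dpairDr (j : gs) xi xi' : dpair j (xi + xi') = dpair j xi + dpair j xi'.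
Proof. by rewrite /Defs.dpair mulmxDl mxE. Qed.

Lemma dpairNl (j : gs) xi : dpair (- j) xi = - dpair j xi.
Proof. by rewrite /Defs.dpair mulmxN mxE. Qed.

Lemma dpairNr (j : gs) xi : dpair j (- xi) = - dpair j xi.
Proof. by rewrite /Defs.dpair mulNmx mxE. Qed.

Lemma dpairZl (j : gs) a xi : dpair (a *: j) xi = a * dpair j xi.
Proof. by rewrite /Defs.dpair -scalemxAr mxE. Qed.

Lemma dpair0l xi : dpair (0 : gs) xi = 0.
Proof. by rewrite /Defs.dpair mulmx0 mxE. Qed.

Lemma dpair0r (j : gs) : dpair j 0 = 0.
Proof. by rewrite /Defs.dpair mul0mx mxE. Qed.

Lemma dpair_Ads (u : G) (j : gs) xi : dpair (Ads u j) xi = dpair j (Ad u xi).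
Proof. by rewrite /Defs.dpair /Ads mulmxA (mul_lin1_Ad hG). Qed.

Lemma dpair_coad xi (j : gs) eta :
  dpair (@coad _ _ G xi j) eta = - dpair j (br xi eta).
Proof. by rewrite /coad dpairNl /Defs.dpair mulmxA (mul_lin1_bracket hG). Qed.

Lemma coadNr xi (j : gs) : @coad _ _ G xi (- j) = - @coad _ _ G xi j.
Proof. by rewrite /coad mulmxN. Qed.

Lemma coad0r xi : @coad _ _ G xi 0 = 0.
Proof. by rewrite /coad mulmx0 oppr0. Qed.

Lemma lie_bracketNl xi eta : br (- xi) eta = - br xi eta.
Proof.
rewrite (lie_bracket_anti hG) (lie_bracket_anti hG xi).
by rewrite -!(mul_lin1_bracket hG) mulNmx.
Qed.

Lemma coadNl xi (j : gs) : @coad _ _ G (- xi) j = - @coad _ _ G xi j.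
Proof.
have E : lin1_mx (br (- xi)) = - lin1_mx (br xi).
  apply/row_matrixP => i; rewrite !rowE mulmxN.
  rewrite [LHS](mul_lin1_bracket hG (- xi)) lie_bracketNl; congr (- _).
  exact: esym (mul_lin1_bracket hG xi _).
exact: etrans (congr1 (fun M => - (M *m j)) E) (congr1 -%R (mulNmx _ _)).
Qed.

Lemma is_derive_Ads (c : R -> G) xi (j : R -> gs) j' : tangent1 c xi ->
  is_derive (0 : R) 1 j j' ->
  is_derive (0 : R) 1 (fun t => Ads (c t) (j t)) (j' - @coad _ _ G xi (j 0)).
Proof.
move=> hc dj; have [c0 _ _] := hc.
have := is_derive_mulmx (is_derive_lin1_Ad hG hc) dj.
rewrite c0 -[X in _ + X]/(Ads (gone G) j') Ads1 addrC.
by rewrite /coad opprK.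
Qed.

Lemma is_derive_AdsV (c : R -> G) xi (j : R -> gs) j' : tangent1 c xi ->
  is_derive (0 : R) 1 j j' ->
  is_derive (0 : R) 1 (fun t => Ads (ginv (c t)) (j t))
    (j' + @coad _ _ G xi (j 0)).
Proof.
move=> /(lc_tangentV hL) hc /(is_derive_Ads hc).
by rewrite coadNl opprK.
Qed.

Lemma is_derive_Ads_cst (u : G) (j : R -> gs) j' :
  is_derive (0 : R) 1 j j' ->
  is_derive (0 : R) 1 (fun t => Ads u (j t)) (Ads u j').
Proof.
move=> dj; have := is_derive_mulmx (is_derive_cst (lin1_mx (Ad u)) (0 : R) 1) dj.
by rewrite mul0mx add0r.
Qed.

(** The chart of [H] at 1 is a product, so a curve in [H] amounts to a curve in [G] and a curve in a
    vector space. All the calculus on [H] rests on this. *)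
Lemma tangent1_semiP (c : R -> H) (z : h) : tangent1 c z <->
  [/\ tangent1 (fun t => Hfst (c t)) z.1, Hsnd (c 0) = 0 &
      is_derive (0 : R) 1 (fun t => Hsnd (c t)) z.2].
Proof.
split=> [[c0 cc dc]|[[c0 cc dc] c0' dc']].
  split; last 1 first.
  - have := is_derive_linear (L := snd) _ dc.
    by apply; move=> p; exact: cvg_snd.
  - split; first by rewrite c0.
    + by apply: (continuous_comp cc); exact: cvg_fst.
    + have := is_derive_linear (L := fst) _ dc.
      by apply; move=> p; exact: cvg_fst.
  - by rewrite c0.
split.
- by rewrite [LHS]surjective_pairing; congr pair.
- have cE : (fun t => (Hfst (c t), Hsnd (c t))) = c.
    by apply/funext => t; rewrite /Hfst /Hsnd; case: (c t).
  have := @cvg_pair _ _ _ (nbhs (0 : R)) _ _ _ _ _ _ _ cc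
    (is_derive_continuous dc').
  rewrite cE => cv; rewrite /prop_for /continuous_at -[c 0](congr1 (@^~ 0) cE).
  exact: cv.
- by rewrite [z]surjective_pairing; exact: is_derive_pair dc dc'.
Qed.

Lemma tangent1_line_semi (z : h) :
  tangent1 (fun t => cinv (gchart1 H) (t *: z + cmap (gchart1 H) (gone H))) z.
Proof.
apply/tangent1_semiP; split.
- exact: tangent1_kinv.
- by rewrite /Hsnd /= scale0r addr0.
- exact: is_derive_affine.
Qed.

(** The closed form of [Ad] on [H], found by differentiating the components of X c (t) X^-1; [AdHE]
    makes the identification. *)
Definition AdH (X : H) (z : h) : h :=
  (Ad (Hfst X) z.1,
   Ads (ginv (Hfst X)) (z.2 - @coad _ _ G z.1 (Ads (Hfst X) (Hsnd X)))).

Lemma tangent1_conj_semi (X : H) (c : R -> H) z : tangent1 c z ->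
  tangent1 (fun t => gmul (gmul X (c t)) (ginv X)) (AdH X z).
Proof.
move=> /tangent1_semiP[hc c0 dc]; apply/tangent1_semiP.
have E t : Hsnd (gmul (gmul X (c t)) (ginv X)) = Hsnd X +
    Ads (ginv (Hfst X)) (Hsnd (c t) +
      Ads (ginv (Hfst (c t))) (- Ads (Hfst X) (Hsnd X))).
  rewrite /Hsnd /Hfst /= /semi_mul /= -addrA; congr (_ + _).
  by rewrite (lc_invMg hL) AdsM AdsD.
split.
- exact: lc_tangentJ hL _ _ _ hc.
- have [c00 _ _] := hc.
  rewrite E c0 c00 (lc_inv1g hL) Ads1 add0r AdsN AdsK subrr //.
- have -> : (fun t => Hsnd (gmul (gmul X (c t)) (ginv X))) =
     (fun t => Hsnd X + Ads (ginv (Hfst X)) (Hsnd (c t) +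
      Ads (ginv (Hfst (c t))) (- Ads (Hfst X) (Hsnd X)))).
    by apply/funext.
  have := is_derive_AdsV hc
    (is_derive_cst (- Ads (Hfst X) (Hsnd X)) (0 : R) 1).
  rewrite add0r coadNr => /(is_deriveD dc) /(is_derive_Ads_cst (ginv (Hfst X))).
  by move=> /(is_deriveD (is_derive_cst (Hsnd X) (0 : R) 1)); rewrite add0r.
Qed.

Lemma AdHE (X : H) (z : h) : Ad X z = AdH X z.
Proof.
have [_ _ dc] := tangent1_conj_semi X (tangent1_line_semi z).
by case: ((is_derive_lineP (fun y =>
  cmap (gchart1 H) (gmul (gmul X (cinv (gchart1 H) y)) (ginv X)))
  (cmap (gchart1 H) (gone H)) z _).2 dc).
Qed.

(** Each rule is checked on the two components. In those for products and inverses no coadjoint term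
    survives, because the vector component vanishes at t = 0. *)
Lemma semidirect_calculus : lie_calculus H.
Proof.
split.
- move=> [u a] [v b] [w c]; rewrite /gmul /= /semi_mul /=.
  by rewrite (lc_mulA hL) (lc_invMg hL) AdsM AdsD addrA.
- move=> [u a]; rewrite /gmul /= /semi_mul /=.
  by rewrite (lc_mul1g hL) (lc_inv1g hL) Ads1 add0r.
- move=> [u a]; rewrite /gmul /ginv /= /semi_mul /semi_inv /=.
  by rewrite (lc_mulVg hL) (lc_invgK hL) addNr.
- move=> c c' z z' /tangent1_semiP[hc c0 dc] /tangent1_semiP[hc' c0' dc'].
  apply/tangent1_semiP; split.
  + exact: lc_tangentM hL _ _ _ _ hc hc'.
  + by rewrite /Hsnd /= [(c 0).2]c0 [(c' 0).2]c0' Ads0 addr0.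
  + have := is_deriveD dc (is_derive_AdsV hc dc').
    by rewrite c0' coad0r addr0.
- move=> c z /tangent1_semiP[hc c0 dc]; apply/tangent1_semiP; split.
  + exact: lc_tangentV hL _ _ hc.
  + by rewrite /Hsnd /= [(c 0).2]c0 Ads0 oppr0.
  + have := is_deriveN (is_derive_Ads hc dc).
    by rewrite c0 coad0r subr0.
- by move=> X c z hc; rewrite AdHE; exact: tangent1_conj_semi.
- move=> z; eexists; exact: tangent1_line_semi.
Qed.

Lemma dpair_coad_Ad (u : G) (b k : gs) eta eta' :
  dpair (Ads (ginv u) (k - @coad _ _ G eta b)) (Ad u eta') =
  dpair k eta' + dpair b (br eta eta').
Proof.
apply: etrans (dpair_Ads _ _ _) _.
apply: etrans (congr1 (dpair _) (AdK hL u eta')) _.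
apply: etrans (dpairDl _ _ _) _; congr (_ + _).
apply: etrans (dpairNl _ _) _.
by apply: etrans (congr1 -%R (dpair_coad _ _ _)) (opprK _).
Qed.

(** With b = [Ads] u a for X = (u, a), the coadjoint shifts contribute <b, [eta, eta'] +
    [eta', eta]>, which vanishes by antisymmetry of the bracket. *)
Lemma pairH_Ad (X : H) (z z' : h) : pairH (Ad X z) (Ad X z') = pairH z z'.
Proof.
apply: etrans (congr2 pairH (AdHE X z) (AdHE X z')) _.
apply: etrans (congr2 +%R (dpair_coad_Ad _ _ _ _ _) (dpair_coad_Ad _ _ _ _ _)) _.
rewrite /pairH addrACA -dpairDr.
rewrite (lie_bracket_anti hG z.1 z'.1) addNr.
by rewrite [X in _ + X]dpair0r addr0.
Qed.

Lemma pairHC (z z' : h) : pairH z z' = pairH z' z.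
Proof. by rewrite /pairH addrC. Qed.

Lemma pairHDl (z1 z2 z : h) : pairH (z1 + z2) z = pairH z1 z + pairH z2 z.
Proof. by rewrite /pairH /= dpairDl dpairDr addrACA. Qed.

Lemma pairHNl (z z' : h) : pairH (- z) z' = - pairH z z'.
Proof. by rewrite /pairH /= dpairNl dpairNr opprD. Qed.

(* The j with X = (u, - Ads (u^-1) j). *)
Definition momentum (X : H) : gs := - Ads (Hfst X) (Hsnd X).

Lemma momentumK (X : H) : - Ads (ginv (Hfst X)) (momentum X) = Hsnd X.
Proof. by rewrite /momentum AdsN AdsK opprK. Qed.

(** The j describing X exists and is unique, so the default value 0 of [xget] is never taken. *)
Lemma jpartE (X : H) : jpart X = momentum X.
Proof.
rewrite /jpart; apply: xget_unique => [|j ->].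
  by rewrite /= momentumK /Hpair /Hfst /Hsnd; case: X.
by rewrite /momentum /Hpair /Hfst /Hsnd /= AdsN AdsVK opprK.
Qed.

(** This twisted additivity is what makes the forms attached to a product computable from those of
    its factors. *)
Lemma momentumM (Y X : H) :
  momentum (gmul Y X) = momentum X + Ads (Hfst X) (momentum Y).
Proof.
rewrite /momentum /Hfst /Hsnd /= AdsM AdsD AdsVK !AdsD !AdsN opprD addrC.
by congr (_ - _).
Qed.

Lemma momentumV (X : H) : momentum (ginv X) = - Ads (ginv (Hfst X)) (momentum X).
Proof. by rewrite /momentum /Hfst /Hsnd /= !AdsN. Qed.

Lemma Hsnd_mulV (Y X : H) : Hsnd (gmul Y (ginv X)) =
  - Ads (ginv (gmul (Hfst Y) (ginv (Hfst X))))
      (Ads (ginv (Hfst X)) (momentum Y) - Ads (ginv (Hfst X)) (momentum X)).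
Proof.
have E j : Ads (ginv (gmul (Hfst Y) (ginv (Hfst X)))) (Ads (ginv (Hfst X)) j) =
    Ads (ginv (Hfst Y)) j.
  by rewrite -AdsM (lc_invMg hL) (lc_invgK hL) (lc_mulKg hL).
by rewrite [in RHS]AdsD AdsN !E opprB addrC -[X in X + _ = _](momentumK Y).
Qed.

Lemma Hsnd_Vmul (X Y : H) : Hsnd (gmul (ginv X) Y) =
  momentum X - Ads (ginv (gmul (ginv (Hfst X)) (Hfst Y))) (momentum Y).
Proof.
rewrite (lc_invMg hL) AdsM -AdsN momentumK (lc_invgK hL).
by rewrite /Hsnd /= (lc_invgK hL).
Qed.

(** The coadjoint term drops out because the difference of momenta in [Hsnd_mulV] is zero at t =
    0. *)
Lemma rlog_semi (c : R -> H) r j' : rlog (fun t => Hfst (c t)) r ->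
  is_derive (0 : R) 1 (fun t => momentum (c t)) j' ->
  rlog c (r, - Ads (ginv (Hfst (c 0))) j').
Proof.
move=> hr dj; apply/tangent1_semiP; split=> //.
- by rewrite (lc_mulgV semidirect_calculus).
- have dj0 := is_deriveB (is_derive_Ads_cst (ginv (Hfst (c 0))) dj)
    (is_derive_cst (Ads (ginv (Hfst (c 0))) (momentum (c 0))) (0 : R) 1).
  have := is_deriveN (is_derive_AdsV hr dj0).
  rewrite !fctE subrr coad0r addr0 subr0; congr is_derive; apply/funext => t.
  by rewrite Hsnd_mulV.
Qed.

(** On the left side the moving group element acts on the momentum itself and not on a difference
    ([Hsnd_Vmul]), so a coadjoint term remains. *)
Lemma llog_semi (c : R -> H) r j' : rlog (fun t => Hfst (c t)) r ->
  is_derive (0 : R) 1 (fun t => momentum (c t)) j' ->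
  Ad (ginv (c 0)) (r, - Ads (ginv (Hfst (c 0))) j') =
  (Ad (ginv (Hfst (c 0))) r,
   - j' - @coad _ _ G (Ad (ginv (Hfst (c 0))) r) (momentum (c 0))).
Proof.
move=> hr dj.
apply: tangent1_unique (llogP semidirect_calculus (rlog_semi hr dj)) _.
apply/tangent1_semiP; split.
- exact (llogP hL hr).
- by rewrite (lc_mulVg semidirect_calculus).
- have := is_deriveN (is_derive_AdsV (llogP hL hr) dj).
  rewrite opprD => /(is_deriveD (is_derive_cst (momentum (c 0)) (0 : R) 1)).
  rewrite add0r; congr is_derive; apply/funext => t.
  by rewrite Hsnd_Vmul.
Qed.

End SemidirectCalculus.

(** * Exponentials of commuting elements *)

Section Exponential.
Context {R : realType} {d : nat} {G : lie_data 'rV[R]_d}.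
Hypothesis hG : lie_group G.

Local Notation g := 'rV[R]_d.
Local Notation kap := (cmap (gchart1 G)).
Local Notation kinv := (cinv (gchart1 G)).
Local Notation e0 := (kap (gone G)).
Local Notation br := (lie_bracket G).

Let hL := lie_group_calculus hG.

Lemma vect_chart_chart (E : normedModType R) : is_chart (vect_chart E).
Proof.
rewrite /is_chart /= image_id; split => //.
- exact: openT.
- exact: openT.
- by rewrite continuous_open_subspace; [move=> x _; exact: cvg_id|exact: openT].
- by rewrite continuous_open_subspace; [move=> x _; exact: cvg_id|exact: openT].
Qed.

Lemma smooth_at_id (E : normedModType R) (p : E) :
  smooth_at (vect_atlas E) p (fun z => z).
Proof.
exists (vect_chart E), setT; split => //; first exact: openT.
by move=> k; exact: Ck_id openT.
Qed.

Definition morph (c : R -> G) := forall s t, c (s + t) = gmul (c s) (c t).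

Lemma morph0 c : morph c -> c 0 = gone G.
Proof.
by move=> cM; rewrite -[LHS](lc_mulKg hL (c 0)) -cM addr0 (lc_mulVg hL).
Qed.

Lemma morphN c t : morph c -> c (- t) = ginv (c t).
Proof.
move=> cM; apply: (lc_inv_uniq hL).
by rewrite -cM subrr morph0.
Qed.

Lemma morph_rlog c xi t : morph c -> tangent1 c xi ->
  rlog (fun h => c (h + t)) xi.
Proof.
move=> cM hc; apply: tangent1_eq hc => h.
by rewrite add0r cM (lc_mulgK hL).
Qed.

Lemma morph_Ad c xi t : morph c -> tangent1 c xi -> Ad (c t) xi = xi.
Proof.
move=> cM hc; apply: tangent1_unique (lc_tangentJ hL (c t) hc) _.
by apply: tangent1_eq hc => s; rewrite -cM addrC cM (lc_mulgK hL).
Qed.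

(** While F (h) = c (h) c (0)^-1 stays in the chart domain, F (h + k) is c (h + k) c (h)^-1 followed
    by the smooth right translation by F (h). Its chart expression therefore has derivative 0 at
    every such h. *)
Lemma rlog0_locally_cst (c : R -> G) : (forall t, rlog (fun h => c (h + t)) 0) ->
  \forall h \near (0 : R), c h = c 0.
Proof.
move=> c0; have [F0 Fc _] := c0 0.
pose F (h : R) := gmul (c h) (ginv (c 0)).
have FE h : gmul (c (h + 0)) (ginv (c (0 + 0))) = F h by rewrite !addr0.
have : \forall h \near (0 : R), cdom (gchart1 G) (F h).
  have nd : nbhs (F 0) (cdom (gchart1 G)).
    apply: open_nbhs_nbhs; split; first by have [] := chart1_chart hG.
    by rewrite /F (lc_mulgV hL); exact: lie_chart1_dom.
  have FE' : (fun h => gmul (c (h + 0)) (ginv (c (0 + 0)))) = F.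
    by apply/funext.
  by rewrite FE' in Fc; exact: Fc nd.
move=> /nbhs_ballP[r /= r0 rF].
have dF (h : R) : `|h| < r -> is_derive h 1 (fun x => kap (F x)) 0.
  move=> hr; have Fh : cdom (gchart1 G) (F h).
    by apply: rF; rewrite -ball_normE /= sub0r normrN.
  have sC : smooth_at (gatlas G) e0 (fun z => gmul (kinv z) (F h)).
    by apply: (smoothGM hG); [exact: smoothG_kinv|exact: smoothG_cst].
  have [|U [_ Ue _ UC]] := smoothG_chart hG sC (lie_chart1_atlas hG).
    by rewrite /= (kinv1 hG) (lc_mul1g hL).
  have dk := smooth_on_differentiable UC Ue.
  have := tangent1_comp dk (c0 h); rewrite derive0 => d1.
  apply/is_derive_lineP; apply: near_eq_is_derive d1.
  apply: filterS (tangent1_kap hG (c0 h)) => k -> /=.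
  by rewrite [_%:A]mulr1 add0r /F (lc_mulA hL) (lc_mulgVK hL).
have Fcst (h : R) : `|h| < r -> kap (F h) = kap (F 0).
  move=> hr; apply/matrixP => i j.
  apply: (is_derive_zero_cst (f := fun x => kap (F x) i j) (r := r)) => // t tr.
  by have := (is_derive_mx _ _ _ _).1 (dF t tr) i j; rewrite mxE.
apply/nbhs_ballP; exists r => //= h hr; have Fh := rF _ hr.
have [_ _ _ _ ci] := chart1_chart hG.
have : F h = gone G.
  rewrite -(ci _ Fh) Fcst; last by move: hr; rewrite -ball_normE /= sub0r normrN.
  by rewrite /F (lc_mulgV hL) (kinv1 hG).
by rewrite /F => E; rewrite -[LHS](lc_mulgVK hL (c 0)) E (lc_mul1g hL).
Qed.

(** The logarithmic derivative of c c'^-1 is xi - xi = 0 everywhere, so the two morphisms agree near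
    0. Any t is a multiple of some number close to 0, and the morphism property propagates the
    equality. *)
Lemma morph_unique c c' xi t : morph c -> morph c' ->
  tangent1 c xi -> tangent1 c' xi -> c t = c' t.
Proof.
move=> cM cM' hc hc'.
have : \forall h \near (0 : R), gmul (c h) (ginv (c' h)) = gmul (c 0) (ginv (c' 0)).
  apply: (rlog0_locally_cst (c := fun h => gmul (c h) (ginv (c' h)))) => s.
  have := rlogM hL (morph_rlog s cM hc) (rlogV hL (morph_rlog s cM' hc')).
  rewrite !add0r -(morphN _ cM') (morph_Ad _ cM' hc') (AdN hL).
  by rewrite (morph_Ad _ cM hc) subrr.
move=> /nbhs_ballP[r /= r0 rE].
have near0 h : `|h| < r -> c h = c' h.
  move=> hr; have : gmul (c h) (ginv (c' h)) = gone G.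
    rewrite rE; first by rewrite !morph0 // (lc_mulgV hL).
    by rewrite -ball_normE /= sub0r normrN.
  by move=> E; rewrite -[LHS](lc_mulgVK hL (c' h)) E (lc_mul1g hL).
have iter h k : `|h| < r -> c (h *+ k) = c' (h *+ k).
  move=> hr; elim: k => [|k IH]; first by rewrite mulr0n !morph0.
  by rewrite mulrS cM cM' IH near0.
have [k kP] : exists k : nat, `|t| / r < k.+1%:R.
  by exists (Num.truncn (`|t| / r)); rewrite truncnS_gt.
have -> : t = (t / k.+1%:R) *+ k.+1.
  by rewrite -mulr_natr divfK // pnatr_eq0.
apply: iter; rewrite normrM normfV [`|k.+1%:R|]ger0_norm ?ler0n //.
by rewrite ltr_pdivrMr ?ltr0n // mulrC -ltr_pdivrMr.
Qed.

Lemma tangent1_reparam (c : R -> G) xi (a : R -> R) a' : tangent1 c xi ->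
  a 0 = 0 -> is_derive (0 : R) 1 a a' -> tangent1 (fun t => c (a t)) (a' *: xi).
Proof.
move=> [c0 cc dc] a0 da; split; first by rewrite a0.
- have ca := is_derive_continuous da; rewrite -a0 in cc.
  exact: (continuous_comp ca cc).
- have [ddc E] := dc; have ddc' : differentiable (fun t => kap (c t)) (a 0).
    by rewrite a0; apply/derivable1_diffP.
  have := is_derive_comp ddc' da; rewrite (deriveE _ ddc').
  have -> : a' = a' *: (1 : R) :> R by rewrite /GRing.scale /= mulr1.
  by rewrite linearZ -(deriveE _ ddc') a0 E /GRing.scale /= mulr1.
Qed.

Context (e : g -> G).
Hypothesis he : exponential_map e.

Lemma exp_morph xi : morph (fun t : R => e (t *: xi)).
Proof. by move=> s t; have [_ + _] := he xi; apply. Qed.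

Lemma exp_tangent1 xi : tangent1 (fun t : R => e (t *: xi)) xi.
Proof.
have [sC _ D] := he xi.
have eC : smooth_at (gatlas G) (0 : R^o) (fun t : R^o => e (t *: xi)).
  apply: (smooth_at_comp _ _ (gatlas_chart hG) (gatlas_cover hG) sC).
  - exact: findim_reg.
  - by move=> _ ->; exact: vect_chart_chart.
  - exact: smooth_at_id.
have := tangent1_line hG (1 : R^o) eC (morph0 (exp_morph xi)).
by rewrite D; apply: tangent1_eq => t; rewrite [_%:A]mulr1 addr0.
Qed.

Lemma exp0 : e 0 = gone G.
Proof. by have := morph0 (exp_morph 0); rewrite scaler0. Qed.

Lemma expN xi : e (- xi) = ginv (e xi).
Proof. by have := morphN 1 (exp_morph xi); rewrite scaleN1r scale1r. Qed.

Lemma is_derive_zero_mx m n (f : R -> 'M[R]_(m, n)) t :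
  (forall t : R, is_derive t 1 f 0) -> f t = f 0.
Proof.
move=> df; apply/matrixP => i j.
apply: (is_derive_zero_cst (f := fun x => f x i j) (r := `|t| + 1)).
  by move=> s _; have := (is_derive_mx _ _ _ _).1 (df s) i j; rewrite mxE.
by rewrite ltrDl.
Qed.

(** The curve t |-> [Ad (e (t xi)) eta] has derivative [xi, eta] = 0 at t = 0, and the one-parameter
    property transports this to every t. *)
Lemma Ad_exp xi eta t : br xi eta = 0 -> Ad (e (t *: xi)) eta = eta.
Proof.
move=> br0; pose f (t : R) := Ad (e (t *: xi)) eta.
have df s : is_derive (s : R) 1 f 0.
  apply/is_derive_lineP.
  have := is_derive_mulmx (is_derive_Ad hG eta (exp_tangent1 xi))
    (is_derive_cst (lin1_mx (Ad (e (s *: xi)))) (0 : R) 1).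
  rewrite br0 mul0mx mulmx0 addr0; congr is_derive; apply/funext => h.
  rewrite /cst (mul_lin1_Ad hG) -(AdM hL) /f [h *: 1]mulr1 addrC.
  exact: esym (congr1 (fun u => Ad u eta) (exp_morph xi s h)).
apply: etrans (is_derive_zero_mx t df) _.
by rewrite /f scale0r exp0 (Ad1 hL).
Qed.

Lemma Ads_exp xi (j : 'cV[R]_d) : @coad _ _ G xi j = 0 -> Ads (e xi) j = j.
Proof.
move=> co0; pose f (t : R) := Ads (e (t *: xi)) j.
have df s : is_derive (s : R) 1 f 0.
  apply/is_derive_lineP.
  have := is_derive_Ads_cst (e (s *: xi))
    (is_derive_Ads hG (exp_tangent1 xi) (is_derive_cst j (0 : R) 1)).
  rewrite /cst co0 subr0 Ads0; congr is_derive; apply/funext => h.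
  rewrite -(AdsM hG) /f [h *: 1]mulr1.
  exact: esym (congr1 (fun u => Ads u j) (exp_morph xi h s)).
have := is_derive_zero_mx 1 df.
by rewrite /f scale0r scale1r exp0 (Ads1 hG).
Qed.

(** Conjugating t |-> e (t eta) by e (xi) gives a one-parameter subgroup with velocity
    [Ad (e xi) eta] = eta, hence the same one. *)
Lemma exp_commute xi eta : br xi eta = 0 ->
  gmul (e xi) (e eta) = gmul (e eta) (e xi).
Proof.
move=> br0; pose c (t : R) := gmul (gmul (e xi) (e (t *: eta))) (ginv (e xi)).
have cM : morph c.
  move=> s t; rewrite /c exp_morph !(lc_mulA hL).
  by rewrite (lc_mulgVK hL).
have hc : tangent1 c eta.
  have := lc_tangentJ hL (e xi) (exp_tangent1 eta).
  by have := Ad_exp 1 br0; rewrite scale1r => ->.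
have := morph_unique 1 cM (exp_morph eta) hc (exp_tangent1 eta).
by rewrite /c scale1r => {2}<-; rewrite (lc_mulgVK hL).
Qed.

(** By commutation, t |-> e (t xi) e (t eta) is a one-parameter subgroup; its velocity is xi +
    eta. *)
Lemma expD xi eta : br xi eta = 0 -> e (xi + eta) = gmul (e xi) (e eta).
Proof.
move=> br0; have brZ s t : br (s *: xi) (t *: eta) = 0.
  rewrite -(mul_lin1_bracket hG) -scalemxAl (mul_lin1_bracket hG).
  rewrite (lie_bracket_anti hG) -(mul_lin1_bracket hG) -scalemxAl.
  by rewrite (mul_lin1_bracket hG) (lie_bracket_anti hG) br0 !oppr0 !scaler0 oppr0 scaler0.
have := morph_unique (c := fun t => gmul (e (t *: xi)) (e (t *: eta))) 1 _
  (exp_morph (xi + eta)) (lc_tangentM hL (exp_tangent1 xi) (exp_tangent1 eta))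
  (exp_tangent1 (xi + eta)).
rewrite !scale1r => <- // s t.
rewrite !exp_morph !(lc_mulA hL); congr gmul.
by rewrite -!(lc_mulA hL) (exp_commute (brZ t s)).
Qed.

(** [exponential_map] gives smoothness of [e] along lines only. In a basis of the abelian
    subalgebra, however, e (y t) is a product of reparametrised one-parameter subgroups, whose
    velocities add up to y'. *)
Lemma exp_curve (c0 : {vspace g}) (y : R -> g) y' :
  (forall xi eta, xi \in c0 -> eta \in c0 -> br xi eta = 0) ->
  (forall t, y t \in c0) -> y 0 = 0 -> is_derive (0 : R) 1 y y' ->
  tangent1 (fun t => e (y t)) y'.
Proof.
move=> ab yc y0 dy; pose b := vbasis c0.
have bc i : b`_i \in c0.
  have [ib|ib] := ltnP i (size b); last by rewrite nth_default // mem0v.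
  by apply: vbasis_mem; exact: mem_nth.
have [a' da] : exists a' : 'I_(\dim c0) -> R, forall i,
    is_derive (0 : R) 1 (fun t => coord b i (y t)) (a' i).
  (* A coordinate functional written as multiplication by a constant matrix, so that the product
     rule gives its derivative along y. *)
  pose A i := lin1_mx (fun xi : g => (coord b i xi)%:M : 'rV[R]_1).
  have AE i xi : coord b i xi = (xi *m A i) 0 0.
    rewrite mul_rV_lin1_linear ?mxE ?eqxx // => k u v.
    by rewrite linearP /= raddfD /= scale_scalar_mx.
  exists (fun i => (y' *m A i) 0 0) => i.
  have := is_derive_mulmx dy (is_derive_cst (A i) (0 : R) 1).
  rewrite mulmx0 addr0 => /is_derive_mx/(_ 0 0).
  by congr is_derive; apply/funext => t; rewrite AE.
have a0 i : coord b i (y 0) = 0 by rewrite y0 linear0.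
have key (r : seq 'I_(\dim c0)) :
    tangent1 (fun t => e (\sum_(i <- r) coord b i (y t) *: b`_i))
             (\sum_(i <- r) a' i *: b`_i).
  elim: r => [|i r IH].
    rewrite big_nil; apply: tangent1_eq (tangent1_cst G) => t.
    by rewrite big_nil exp0.
  rewrite big_cons.
  have := lc_tangentM hL (tangent1_reparam (exp_tangent1 b`_i) (a0 i) (da i)) IH.
  apply: tangent1_eq => t; rewrite big_cons expD // ab //.
    by rewrite memvZ.
  by apply: memv_suml => k _; rewrite memvZ.
have yE t : y t = \sum_(i <- index_enum _) coord b i (y t) *: b`_i.
  exact: coord_vbasis.
have dyE : y' = \sum_(i <- index_enum _) a' i *: b`_i.
  apply: (is_derive_unique dy).
  have : is_derive (0 : R) 1
      (fun t => \sum_(i <- index_enum _) coord b i (y t) *: b`_i)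
      (\sum_(i <- index_enum _) a' i *: b`_i).
    apply: is_derive_sum_seq => i _.
    have [ddi <-] := da i; have ddi' : differentiable (fun t => coord b i (y t) : R) (0 : R).
      by apply/derivable1_diffP.
    split; first by apply/derivable1_diffP; exact: differentiableZl.
    rewrite (deriveE _ (differentiableZl _ ddi')) (diffZl _ ddi') /=.
    by rewrite -(deriveE _ ddi').
  by congr is_derive; apply/funext => t; rewrite -yE.
by rewrite dyE; apply: tangent1_eq (key _) => t; rewrite -yE.
Qed.

End Exponential.

(** * Maurer-Cartan forms on a manifold *)

Section LogarithmicForms.
Context {R : realType} {E : normedModType R} {G : lie_data E}.
Hypothesis hG : lie_calculus G.
Context {EN : normedModType R} {N : topologicalType}.
Variables (ch : chart EN N) (x : N).
Hypothesis (cinvx : cinv ch (cmap ch x) = x).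
Implicit Types (u w : N -> G) (y : EN).

(** [mc_right] is a derivative that obeys the product rule only where it exists; this is the
    required existence, in all directions at x. *)
Definition has_rlog u := forall y,
  exists r, rlog (fun t : R => u (cinv ch (t *: y + cmap ch x))) r.

Lemma has_rlogP u y : has_rlog u ->
  rlog (fun t : R => u (cinv ch (t *: y + cmap ch x))) (mc_right u ch x y).
Proof. by move=> /(_ y)[r hr]; rewrite (mc_rightE cinvx hr). Qed.

Lemma line0 y : cinv ch ((0 : R) *: y + cmap ch x) = x.
Proof. by rewrite scale0r add0r. Qed.

Let rM u w y : has_rlog u -> has_rlog w ->
  rlog (fun t : R => gmul (u (cinv ch (t *: y + cmap ch x)))
                          (w (cinv ch (t *: y + cmap ch x))))
       (mc_right u ch x y + Ad (u x) (mc_right w ch x y)).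
Proof.
move=> /(@has_rlogP _ y) hu /(@has_rlogP _ y) hw.
by have := rlogM hG hu hw; rewrite line0.
Qed.

Let rV u y : has_rlog u ->
  rlog (fun t : R => ginv (u (cinv ch (t *: y + cmap ch x))))
       (- Ad (ginv (u x)) (mc_right u ch x y)).
Proof.
by move=> /(@has_rlogP _ y) hu; have := rlogV hG hu; rewrite line0.
Qed.

Lemma has_rlogM u w : has_rlog u -> has_rlog w ->
  has_rlog (fun a => gmul (u a) (w a)).
Proof. by move=> hu hw y; eexists; exact: rM y hu hw. Qed.

Lemma has_rlogV u : has_rlog u -> has_rlog (fun a => ginv (u a)).
Proof. by move=> hu y; eexists; exact: rV y hu. Qed.

Lemma has_rlog_cst (a : G) : has_rlog (fun=> a).
Proof. by move=> y; exists 0; exact: rlog_cst. Qed.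

Lemma mc_rightM u w y : has_rlog u -> has_rlog w ->
  mc_right (fun a => gmul (u a) (w a)) ch x y =
  mc_right u ch x y + Ad (u x) (mc_right w ch x y).
Proof. by move=> hu hw; exact: (mc_rightE (h := fun a => gmul (u a) (w a)) cinvx (rM y hu hw)). Qed.

Lemma mc_rightV u y : has_rlog u ->
  mc_right (fun a => ginv (u a)) ch x y = - Ad (ginv (u x)) (mc_right u ch x y).
Proof. by move=> hu; exact: (mc_rightE (h := fun a => ginv (u a)) cinvx (rV y hu)). Qed.

Lemma mc_right_cst (a : G) y : mc_right (fun=> a) ch x y = 0.
Proof. exact: (mc_rightE (h := fun=> a) cinvx (rlog_cst hG a)). Qed.

Lemma mc_left_right u y : has_rlog u ->
  mc_left u ch x y = Ad (ginv (u x)) (mc_right u ch x y).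
Proof. by move=> hu; exact: (mc_leftE (h := u) hG cinvx (has_rlogP y hu)). Qed.

Lemma mc_rightVE u y : has_rlog u ->
  mc_right (fun a => ginv (u a)) ch x y = - mc_left u ch x y.
Proof. by move=> hu; rewrite mc_rightV // mc_left_right. Qed.

Lemma mc_leftVE u y : has_rlog u ->
  mc_left (fun a => ginv (u a)) ch x y = - mc_right u ch x y.
Proof.
move=> hu; rewrite mc_left_right; last exact: has_rlogV.
rewrite mc_rightV // (AdN hG); congr (- _).
by rewrite (lc_invgK hG) (AdVK hG).
Qed.

Lemma Ad_mc_left u y : has_rlog u ->
  Ad (u x) (mc_left u ch x y) = mc_right u ch x y.
Proof. by move=> hu; rewrite mc_left_right // (AdVK hG). Qed.

Lemma mc_leftM u w y : has_rlog u -> has_rlog w ->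
  mc_left (fun a => gmul (u a) (w a)) ch x y =
  Ad (ginv (w x)) (mc_left u ch x y) + mc_left w ch x y.
Proof.
move=> hu hw; rewrite mc_left_right; last exact: has_rlogM.
rewrite mc_rightM // (lc_invMg hG) (AdD hG) (AdM hG) (AdM hG).
rewrite -(mc_left_right _ hu); congr (_ + _).
by rewrite (AdK hG) -mc_left_right.
Qed.

End LogarithmicForms.

(** * Exterior derivatives in a fixed chart and the cocycle identity *)

Section Forms.
Context {R : realType} {d : nat} {G : lie_data 'rV[R]_d}.
Hypothesis hG : lie_group G.
Context {m : nat} {N : topologicalType} {atlN : set (chart 'rV[R]_m N)}.
Hypothesis hN : smooth_manifold atlN.
Variable ch : chart 'rV[R]_m N.
Hypothesis hch : atlN ch.

Local Notation g := 'rV[R]_d.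
Local Notation gs := 'cV[R]_d.
Local Notation dpair := Defs.dpair.
Local Notation wedge := Defs.wedge.
Local Notation h := ('rV[R]_d * 'cV[R]_d)%type.
Local Notation H := (semidirect G).
Local Notation br := (lie_bracket G).
Local Notation coad := (@coad _ _ G).

Let hL := lie_group_calculus hG.
Let hLH := semidirect_calculus hG.

Lemma atlas_chart (c : chart 'rV[R]_m N) : atlN c -> is_chart c.
Proof. by have [_ _ + _ _] := hN; apply. Qed.

Lemma ch_cinv x : cdom ch x -> cinv ch (cmap ch x) = x.
Proof. by have [_ _ _ _] := atlas_chart hch; apply. Qed.

Lemma near_ch x : cdom ch x ->
  \forall z \near cmap ch x, cdom ch (cinv ch z) /\ cmap ch (cinv ch z) = z.
Proof.
move=> cx; have [od oi _ _ ci] := atlas_chart hch.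
have : nbhs (cmap ch x) (cmap ch @` cdom ch).
  by apply: open_nbhs_nbhs; split => //; exists x.
by apply: filterS => _ [y cy <-]; rewrite ci.
Qed.

Definition smoothN (u : N -> G) := forall x, cdom ch x ->
  smooth_at (gatlas G) (cmap ch x) (fun z => u (cinv ch z)).

Lemma smoothNM u w : smoothN u -> smoothN w -> smoothN (fun x => gmul (u x) (w x)).
Proof. by move=> hu hw x cx; apply: (smoothGM hG); [exact: hu|exact: hw]. Qed.

Lemma smoothNV u : smoothN u -> smoothN (fun x => ginv (u x)).
Proof. by move=> hu x cx; apply: (smoothGV hG); exact: hu. Qed.

Lemma smoothN_cst (a : G) : smoothN (fun=> a).
Proof. by move=> x cx; exact: smoothG_cst. Qed.

Lemma smoothN_rlog u x : smoothN u -> cdom ch x -> has_rlog ch x u.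
Proof.
move=> hu cx y; have fC := smoothGM hG (hu x cx) (smoothG_cst hG _ (ginv (u x))).
have f0 : gmul (u (cinv ch (cmap ch x))) (ginv (u x)) = gone G.
  by rewrite ch_cinv // (lc_mulgV hL).
exists ('D_y (fun z => cmap (gchart1 G) (gmul (u (cinv ch z)) (ginv (u x))))
             (cmap ch x)).
apply: tangent1_eq (tangent1_line hG y fC f0) => t.
by rewrite scale0r add0r ch_cinv.
Qed.

(** [maurer_cartan] for the surface (s, t) |-> u at the point with coordinates z0 + s v + t v'. The
    functions r1 and r2 are the values of the form along its two axes. *)
Lemma mc_right_derive u x v v' : smoothN u -> cdom ch x ->
  exists m1 m2,
  [/\ is_derive (cmap ch x) v (fun z => mc_right u ch (cinv ch z) v') m2,
      is_derive (cmap ch x) v' (fun z => mc_right u ch (cinv ch z) v) m1 &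
      m2 - m1 = br (mc_right u ch x v) (mc_right u ch x v')].
Proof.
move=> hu cx; set z0 := cmap ch x.
pose hh (st : R^o * R^o) : 'rV[R]_m := st.1 *: v + (st.2 *: v' + z0).
have hC : smooth_on setT hh.
  move=> k; apply: CkD openT _ (CkD openT _ _).
  - by apply: CkZ openT _ _; [exact: smooth_fst|exact: Ck_cst].
  - by apply: CkZ openT _ _; [exact: smooth_snd|exact: Ck_cst].
  - exact: Ck_cst.
pose f (st : R^o * R^o) := u (cinv ch (hh st)).
have fC : smooth_at (gatlas G) ((0, 0) : R^o * R^o) f.
  apply: (smoothG_precomp (findim_mx _ _) hC _ (hu x cx)).
  by rewrite /hh /= !scale0r !add0r.
have [r1 [r2 [M [h2 h1 d2 d1]]]] := maurer_cartan hG fC.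
have line_ch w : \forall t \near (0 : R),
    cdom ch (cinv ch (t *: w + z0)) /\
    cmap ch (cinv ch (t *: w + z0)) = t *: w + z0.
  have L := is_derive_continuous (is_derive_affine w z0).
  have nz : nbhs ((0 : R) *: w + z0)
      (fun z => cdom ch (cinv ch z) /\ cmap ch (cinv ch z) = z).
    by rewrite scale0r add0r; exact: near_ch.
  exact: L nz.
have E2 : \forall s \near (0 : R), r2 s = mc_right u ch (cinv ch (s *: v + z0)) v'.
  apply: filterS2 h2 (line_ch v) => s hs [cs ms].
  apply/esym/mc_rightE; first by rewrite ms.
  by apply: rlog_eq hs => t; rewrite /f /hh /= ms addrCA.
have E1 : \forall t \near (0 : R), r1 t = mc_right u ch (cinv ch (t *: v' + z0)) v.
  apply: filterS2 h1 (line_ch v') => t ht [ct mt].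
  apply/esym/mc_rightE; first by rewrite mt.
  by apply: rlog_eq ht => s; rewrite /f /hh /= mt.
have c0 w : cinv ch ((0 : R) *: w + z0) = x by rewrite scale0r add0r ch_cinv.
have r10 : r1 0 = mc_right u ch x v.
  exact: etrans (nbhs_singleton E1) (congr1 (fun a => mc_right u ch a v) (c0 v')).
have r20 : r2 0 = mc_right u ch x v'.
  exact: etrans (nbhs_singleton E2) (congr1 (fun a => mc_right u ch a v') (c0 v)).
exists M, (br (r1 0) (r2 0) + M); split.
- by apply/is_derive_lineP; exact: near_eq_is_derive E2 d2.
- by apply/is_derive_lineP; exact: near_eq_is_derive E1 d1.
- by rewrite addrK r10 r20.
Qed.

(** The regularity of [H]-valued maps kept from here on, stable under products and inverses. The
    momentum of such a map is differentiated only once. *)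
Definition goodH (X : N -> H) := smoothN (fun x => Hfst (X x)) /\
  forall x y, cdom ch x ->
    derivable (fun z => momentum (X (cinv ch z))) (cmap ch x) y.

Definition dmom (X : N -> H) x y : gs :=
  'D_y (fun z => momentum (X (cinv ch z))) (cmap ch x).

Lemma goodH_line X x y : goodH X -> cdom ch x ->
  is_derive (0 : R) 1 (fun t : R => momentum (X (cinv ch (t *: y + cmap ch x))))
    (dmom X x y).
Proof.
move=> [_ /(_ x y) hX] /hX dX.
exact: ((is_derive_lineP _ _ _ _).1 (derivableP dX)).
Qed.

Lemma momentumM_derive (Y X : N -> H) x y : goodH Y -> goodH X -> cdom ch x ->
  is_derive (cmap ch x) y
    (fun z => momentum (gmul (Y (cinv ch z)) (X (cinv ch z))))
    (dmom X x y + Ads (Hfst (X x)) (dmom Y x y -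
      coad (mc_right (fun a => Hfst (X a)) ch x y) (momentum (Y x)))).
Proof.
move=> hY hX cx; apply/is_derive_lineP.
have hr := has_rlogP (ch_cinv cx) y (smoothN_rlog hX.1 cx).
have := is_deriveD (goodH_line y hX cx) (is_derive_Ads_cst (Hfst (X x))
  (is_derive_Ads hG hr (goodH_line y hY cx))).
rewrite !(line0 (ch_cinv cx)); congr is_derive; apply/funext => t.
by rewrite fctE (momentumM hG) -(AdsM hG) (lc_mulgVK hL).
Qed.

Lemma goodHM Y X : goodH Y -> goodH X -> goodH (fun x => gmul (Y x) (X x)).
Proof.
move=> hY hX; split.
  exact: smoothNM hY.1 hX.1.
by move=> x y cx; have [] := momentumM_derive y hY hX cx.
Qed.

Lemma dmomM Y X x y : goodH Y -> goodH X -> cdom ch x ->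
  dmom (fun x => gmul (Y x) (X x)) x y =
  dmom X x y + Ads (Hfst (X x)) (dmom Y x y -
    coad (mc_right (fun a => Hfst (X a)) ch x y) (momentum (Y x))).
Proof. by move=> hY hX cx; case: (momentumM_derive y hY hX cx). Qed.

Lemma goodHV X : goodH X -> goodH (fun x => ginv (X x)).
Proof.
move=> hX; split; first exact: smoothNV hX.1.
move=> x y cx.
have hr := has_rlogP (ch_cinv cx) y (smoothN_rlog hX.1 cx).
have D := is_deriveN (is_derive_AdsV hG hr
  (is_derive_Ads_cst (ginv (Hfst (X x))) (goodH_line y hX cx))).
move: D; set F := (X in is_derive _ _ X _) => -[D _].
apply/derivable1P.
have <- // : F = fun t : R => momentum (ginv (X (cinv ch (t *: y + cmap ch x)))).
apply/funext => t.
rewrite /F fctE momentumV (line0 (ch_cinv cx)) (lc_invMg hL) (lc_invgK hL).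
by rewrite -(AdsM hG) (lc_mulKg hL).
Qed.

Lemma goodH_cst (a : H) : goodH (fun=> a).
Proof.
split; first exact: smoothN_cst.
by move=> x y cx; exact: derivable_cst.
Qed.

Lemma goodH_semi X x y : goodH X -> cdom ch x ->
  rlog (fun t : R => X (cinv ch (t *: y + cmap ch x)))
    (mc_right (fun a => Hfst (X a)) ch x y, - Ads (ginv (Hfst (X x))) (dmom X x y)).
Proof.
move=> hX cx.
have hr := has_rlogP (ch_cinv cx) y (smoothN_rlog hX.1 cx).
by have := rlog_semi hG hr (goodH_line y hX cx); rewrite (line0 (ch_cinv cx)).
Qed.

Lemma goodH_rlog X x : goodH X -> cdom ch x -> has_rlog ch x X.
Proof. by move=> hX cx y; eexists; exact: goodH_semi y hX cx. Qed.

Lemma mc_right_semi X x y : goodH X -> cdom ch x ->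
  mc_right X ch x y =
  (mc_right (fun a => Hfst (X a)) ch x y, - Ads (ginv (Hfst (X x))) (dmom X x y)).
Proof.
by move=> hX cx; exact: (mc_rightE (h := X) (ch_cinv cx) (goodH_semi y hX cx)).
Qed.

Lemma mc_left_semi X x y : goodH X -> cdom ch x ->
  mc_left X ch x y =
  (mc_left (fun a => Hfst (X a)) ch x y,
   - dmom X x y - coad (mc_left (fun a => Hfst (X a)) ch x y) (momentum (X x))).
Proof.
move=> hX cx; have cx' := ch_cinv cx.
have hr := has_rlogP cx' y (smoothN_rlog hX.1 cx).
have := llog_semi hG hr (goodH_line y hX cx).
rewrite (line0 cx') -(mc_left_right hL cx' y (smoothN_rlog hX.1 cx)) => <-.
exact: (mc_leftE (h := X) hLH cx' (goodH_semi y hX cx)).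
Qed.

Definition pot (X : N -> H) (u : N -> G) : form1 'rV[R]_m N R^o :=
  fun c x y => dpair (momentum (X x)) (mc_right u c x y).

(** [dform] is additive only on forms whose coefficients have the derivatives it takes; this
    condition accompanies every one-form below. *)
Definition form_good (al : form1 'rV[R]_m N R^o) :=
  forall x v v', cdom ch x ->
    derivable (fun z => al ch (cinv ch z) v') (cmap ch x) v.

Lemma is_derive_dpair (j : 'rV[R]_m -> gs) (xi : 'rV[R]_m -> g) p v j' xi' :
  is_derive p v j j' -> is_derive p v xi xi' ->
  is_derive p v (fun z => dpair (j z) (xi z) : R^o)
    (dpair j' (xi p) + dpair (j p) xi').
Proof.
move=> dj dxi; have := (is_derive_mx _ _ _ _).1 (is_derive_mulmx dxi dj) 0 0.
by rewrite mxE [X in is_derive _ _ _ X]addrC.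
Qed.

Lemma pot_derive X u x v v' : goodH X -> smoothN u -> cdom ch x ->
  form_good (pot X u) /\ dform (pot X u) ch x v v' =
    dpair (dmom X x v) (mc_right u ch x v') -
    dpair (dmom X x v') (mc_right u ch x v) +
    dpair (momentum (X x)) (br (mc_right u ch x v) (mc_right u ch x v')).
Proof.
move=> hX hu cx; split.
  move=> a y y' ca; have [m1 [m2 [d2 _ _]]] := mc_right_derive y y' hu ca.
  by have [] := is_derive_dpair (derivableP (hX.2 a y ca)) d2.
have [m1 [m2 [d2 d1 <-]]] := mc_right_derive v v' hu cx.
have [_ E2] := is_derive_dpair (derivableP (hX.2 x v cx)) d2.
have [_ E1] := is_derive_dpair (derivableP (hX.2 x v' cx)) d1.
rewrite /dform [X in X - _]E2 [X in _ - X]E1 (ch_cinv cx) dpairDr dpairNr.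
rewrite opprD addrACA; congr (_ + _).
Qed.

Definition Qform (X : N -> H) x v v' : R :=
  dpair (dmom X x v) (mc_left (fun a => Hfst (X a)) ch x v') -
  dpair (dmom X x v') (mc_left (fun a => Hfst (X a)) ch x v).

(** The product of d j_{YX} (v) with (YX)^-1 d (YX) (v') on group components, before
    antisymmetrisation: a and b stand for dj_X (v) and dj_Y (v), j for j_Y, r and r' for du_X u_X^-1
    on v and v', and l' for u_Y^-1 du_Y on v'. *)
Lemma cocycle_half1 (u : G) (a b j : gs) r r' l' :
  dpair (a + Ads u (b - coad r j)) (Ad (ginv u) l' + Ad (ginv u) r') =
  dpair a (Ad (ginv u) l') + dpair a (Ad (ginv u) r') + dpair b l' +
  dpair b r' + dpair j (br r l') + dpair j (br r r') :> R.
Proof.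
have E t : dpair (Ads u (b - coad r j)) (Ad (ginv u) t) =
    dpair b t + dpair j (br r t).
  apply: etrans (dpair_Ads hG _ _ _) _.
  apply: etrans (congr1 (dpair _) (AdVK hL u t)) _.
  apply: etrans (dpairDl _ _ _) _; congr (_ + _).
  apply: etrans (dpairNl _ _) _.
  by apply: etrans (congr1 -%R (dpair_coad hG _ _ _)) (opprK _).
have alg (A B C D M M' : R) : A + B + (C + D + (M + M')) = A + B + C + M + D + M'.
  by lra.
rewrite dpairDl dpairDr (dpairDr (Ads u _)).
apply: etrans (congr2 +%R (erefl _) (congr2 +%R (E l') (E r'))) _.
exact: alg.
Qed.

Lemma cocycle_half2 (u : G) (a' b j : gs) l r' :
  pairH (l, - b - coad l j) (r', - Ads (ginv u) a') =
  - dpair b r' + dpair j (br l r') - dpair a' (Ad (ginv u) l) :> R.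
Proof.
rewrite /pairH /=; apply: congr2.
  apply: etrans (dpairDl _ _ _) _; apply: congr2; first exact: dpairNl.
  apply: etrans (dpairNl _ _) _.
  by apply: etrans (congr1 -%R (dpair_coad hG _ _ _)) (opprK _).
by apply: etrans (dpairNl _ _) _; apply: congr1; exact: dpair_Ads.
Qed.

(** The letters A, B, J are the terms of [cocycle_half1] on (v, v'), the primed ones those on (v',
    v), and L1, L2 the bracket terms of the wedge. Since J2' = - J2, the term J2 occurs twice, which
    explains the factor 2 before the exact form. *)
Lemma cocycle_arith (W Q1 Q2 Q3 D A1 A2 B1 B2 J1 J2 A1' A2' B1' B2' J1' J2'
    L1 L2 : R) :
  W = (- B2 + L1 - A1') - (- B2' + L2 - A1) ->
  Q1 = (A1 + A2 + B1 + B2 + J1 + J2) - (A1' + A2' + B1' + B2' + J1' + J2') ->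
  Q2 = A2 - A2' -> Q3 = B1 - B1' -> D = B2 - B2' + J2 ->
  L1 = - J1' -> L2 = - J1 -> J2' = - J2 -> W = Q1 - Q2 - Q3 - 2 * D.
Proof. by move=> -> -> -> -> -> -> -> ->; ring. Qed.

Lemma dpair_bracket_anti (j : gs) xi eta :
  dpair j (br xi eta) = - dpair j (br eta xi) :> R.
Proof.
by apply: etrans (congr1 (dpair j) (lie_bracket_anti hG xi eta)) (dpairNr _ _).
Qed.

(** Both sides are expanded in terms of u and j. The bracket of du_X u_X^-1 with itself, present in
    Q_{YX} but not in the wedge, is absorbed by the Maurer-Cartan term of d<j_Y, du_X u_X^-1>. *)
Lemma cocycle Y X x v v' : goodH Y -> goodH X -> cdom ch x ->
  wedge pairH (mc_left Y) (mc_right X) ch x v v' =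
  Qform (fun a => gmul (Y a) (X a)) x v v' - Qform X x v v' - Qform Y x v v'
  - 2 * dform (pot Y (fun a => Hfst (X a))) ch x v v'.
Proof.
move=> hY hX cx; have cx' := ch_cinv cx.
have hu := smoothN_rlog hY.1 cx; have hw := smoothN_rlog hX.1 cx.
have [_ ED] := pot_derive v v' hY hX.1 cx.
pose rX y := mc_right (fun a => Hfst (X a)) ch x y.
pose lY y := mc_left (fun a => Hfst (Y a)) ch x y.
have Wy y y' : pairH (mc_left Y ch x y) (mc_right X ch x y') =
    - dpair (dmom Y x y) (rX y') + dpair (momentum (Y x)) (br (lY y) (rX y'))
    - dpair (dmom X x y') (Ad (ginv (Hfst (X x))) (lY y)).
  apply: etrans (congr2 pairH (mc_left_semi _ hY cx) (mc_right_semi _ hX cx)) _.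
  exact: cocycle_half2.
have lX y : mc_left (fun a => Hfst (X a)) ch x y = Ad (ginv (Hfst (X x))) (rX y).
  exact (mc_left_right hL cx' y hw).
have LM y : mc_left (fun a => Hfst (gmul (Y a) (X a))) ch x y =
    Ad (ginv (Hfst (X x))) (lY y) + Ad (ginv (Hfst (X x))) (rX y).
  exact: etrans (mc_leftM hL cx' y hu hw) (congr1 (fun z => _ + z) (lX y)).
have Qy y y' : dpair (dmom (fun a => gmul (Y a) (X a)) x y)
    (mc_left (fun a => Hfst (gmul (Y a) (X a))) ch x y') = _ :=
  etrans (congr2 (fun j z => dpair j z) (dmomM y hY hX cx) (LM y'))
         (cocycle_half1 _ _ _ _ _ _ _).
apply: (cocycle_arith (congr2 (fun a b => a - b) (Wy v v') (Wy v' v))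
  (congr2 (fun a b => a - b) (Qy v v') (Qy v' v)) _ (erefl _) ED).
- exact (congr2 (fun a b : R => a - b) (congr1 (dpair (dmom X x v)) (lX v'))
    (congr1 (dpair (dmom X x v')) (lX v))).
- exact: dpair_bracket_anti.
- exact: dpair_bracket_anti.
- exact: dpair_bracket_anti.
Qed.

End Forms.

(** * Smooth maps into the semidirect product *)

#[local] Opaque Ads mc_right.

Section SmoothMaps.
Context {R : realType} {d : nat} {G : lie_data 'rV[R]_d}.
Hypothesis hG : lie_group G.
Context {m : nat} {N : topologicalType} {atlN : set (chart 'rV[R]_m N)}.
Hypothesis hN : smooth_manifold atlN.
Variable ch : chart 'rV[R]_m N.
Hypothesis hch : atlN ch.

Local Notation g := 'rV[R]_d.
Local Notation gs := 'cV[R]_d.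
Local Notation dpair := Defs.dpair.
Local Notation H := (semidirect G).

Let hL := lie_group_calculus hG.

Lemma semidirect_chart c : gatlas H c -> is_chart c.
Proof.
move=> [c1 [c2 [h1 -> ->]]].
by apply: is_chart_prod; [exact: gatlas_chart h1|exact: vect_chart_chart].
Qed.

Lemma semidirect_cover (X : H) : exists2 c, gatlas H c & cdom c X.
Proof.
have [c hc cX] := gatlas_cover hG (Hfst X).
exists (prod_chart c (vect_chart gs)); last by split.
by exists c, (vect_chart gs).
Qed.

Lemma smooth_map_semi (X : N -> H) x : smooth_map atlN (gatlas H) X -> cdom ch x ->
  smooth_at (gatlas G) (cmap ch x) (fun z => Hfst (X (cinv ch z))) /\
  exists U, [/\ open U, U (cmap ch x) &
                smooth_on U (fun z => Hsnd (X (cinv ch z)))].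
Proof.
move=> hX cx.
have [c [U [[c1 [c2 [h1 -> ->]]] oU Ux Uc fC]]] :=
  smooth_at_comp (findim_mx _ _) (atlas_chart hN) semidirect_chart semidirect_cover
    hX (smooth_at_cinv (atlas_chart hN hch) hch cx).
split.
  exists c1, U; split => //; first by move=> z /Uc[].
  by move=> k; exact: Ck_linear oU (fun p => cvg_fst) (fC k).
exists U; split => // k.
exact: (Ck_linear (L := snd) oU (fun p => cvg_snd) (fC k)).
Qed.

Lemma derivable_Ads (u : N -> G) (j : 'rV[R]_m -> gs) x y :
  smoothN ch u -> cdom ch x -> derivable j (cmap ch x) y ->
  derivable (fun z => Ads (u (cinv ch z)) (j z)) (cmap ch x) y.
Proof.
move=> hu cx /derivableP/is_derive_lineP dj.
have hr := has_rlogP (ch_cinv hN hch cx) y (smoothN_rlog hG hN hch hu cx).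
have := is_derive_Ads_cst (u x) (is_derive_Ads hG hr dj).
set l := (X in is_derive _ _ _ X) => D.
suff [] : is_derive (cmap ch x) y (fun z => Ads (u (cinv ch z)) (j z)) l by [].
apply/is_derive_lineP; move: D; congr is_derive; apply/funext => t.
apply: etrans (esym (AdsM hG _ _ _)) _; apply: (congr1 (Ads ^~ (j _))).
rewrite (line0 (ch_cinv hN hch cx)); exact: lc_mulgVK.
Qed.

Lemma smooth_map_good (X : N -> H) : smooth_map atlN (gatlas H) X -> goodH ch X.
Proof.
move=> hX; have hu : smoothN ch (fun a => Hfst (X a)).
  by move=> x cx; have [] := smooth_map_semi hX cx.
split=> // x y cx; have [_ [U [oU Ux fC]]] := smooth_map_semi hX cx.
exact (derivableN (derivable_Ads hu cx
  (diff_derivable (smooth_on_differentiable fC Ux)))).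
Qed.

(** Expressed with the vector component rather than the momentum, since [mus_w_good] differentiates
    once more and the smoothness of the vector component is immediate. *)
Lemma mc_left_Hsnd (X : N -> H) x y : smooth_map atlN (gatlas H) X -> cdom ch x ->
  mc_left X ch x y = (mc_left (fun a => Hfst (X a)) ch x y,
    Ads (Hfst (X x)) ('D_y (fun z => Hsnd (X (cinv ch z))) (cmap ch x))).
Proof.
move=> hX cx; have [hu [U [oU Ux fC]]] := smooth_map_semi hX cx.
have da := diff_is_derive y (smooth_on_differentiable fC Ux).
have d1 : derivable (fun z => cmap (gchart1 G)
    (gmul (ginv (Hfst (X x))) (Hfst (X (cinv ch z))))) (cmap ch x) y.
  apply/diff_derivable/(smoothG_differentiable hG).
    exact: smoothGM (smoothG_cst hG _ _) hu.
  by rewrite (ch_cinv hN hch cx) (lc_mulVg hL).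
have d2 : is_derive (cmap ch x) y
    (fun z => - Ads (Hfst (X x)) (Hsnd (X x)) +
      Ads (ginv (ginv (Hfst (X x)))) (Hsnd (X (cinv ch z))))
    (Ads (Hfst (X x)) ('D_y (fun z => Hsnd (X (cinv ch z))) (cmap ch x))).
  rewrite (lc_invgK hL) -[X in is_derive _ _ _ X]add0r; apply: is_deriveD.
  have := is_derive_mulmx (is_derive_cst (lin1_mx (Ad (Hfst (X x)))) (cmap ch x) y) da.
  by rewrite mul0mx add0r.
by have [_ E] := is_derive_pair (derivableP d1) d2.
Qed.

Section MuS.
Variables (mu : N -> g) (s : N -> gs).
Hypothesis hmus : smooth_map atlN (vect_atlas (g * gs)%type) (fun x => (mu x, s x)).

Lemma smooth_map_pair x : cdom ch x -> exists U, [/\ open U, U (cmap ch x),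
  smooth_on U (fun z => mu (cinv ch z)) & smooth_on U (fun z => s (cinv ch z))].
Proof.
move=> cx; have [||c [U [-> oU Ux _ fC]]] := smooth_at_comp (findim_mx _ _)
    (atlas_chart hN) _ _ hmus (smooth_at_cinv (atlas_chart hN hch) hch cx).
- by move=> _ ->; exact: vect_chart_chart.
- by move=> z; exists (vect_chart (g * gs)%type).
exists U; split => // k.
  exact: Ck_linear oU (fun p => cvg_fst) (fC k).
exact: Ck_linear oU (fun p => cvg_snd) (fC k).
Qed.

(** The term <s, u^-1 du> is rewritten as <[Ads] (u^-1) s, du u^-1>, because derivability is known
    for [mc_right]. *)
Lemma mus_w_good (w : N -> H) : smooth_map atlN (gatlas H) w ->
  form_good ch (mus_w w mu s).
Proof.
move=> hw x v v' cx; have [U [oU Ux muC sC]] := smooth_map_pair cx.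
have [_ [V [oV Vx aC]]] := smooth_map_semi hw cx.
have hu := (smooth_map_good hw).1; have hu' := smoothNV hG hu.
have dmu := diff_is_derive v (smooth_on_differentiable muC Ux).
have ds := diff_derivable (smooth_on_differentiable sC Ux).
have dda : derivable (fun z => 'D_v' (fun z => Hsnd (w (cinv ch z))) z) (cmap ch x) v.
  exact: (diff_derivable (smooth_on_differentiable (smooth_on_derive v' aC) Vx)).
have [m1 [m2 [dr _ _]]] := mc_right_derive hG hN hch v v' hu cx.
have D1 := is_derive_dpair (derivableP (derivable_Ads hu' cx (ds v))) dr.
have D2 := is_derive_dpair (derivableP (derivable_Ads hu cx dda)) dmu.
have := is_deriveD D1 D2; set l := (X in is_derive _ _ _ X) => D.
suff [] : is_derive (cmap ch x) v (fun z => mus_w w mu s ch (cinv ch z) v' : R^o) l by [].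
apply: near_eq_is_derive D.
apply: filterS (near_ch hN hch cx) => z [cz mz].
rewrite fctE /mus_w.
apply: etrans _ (congr1 (pairH _) (esym (mc_left_Hsnd v' hw cz))).
apply: congr2 => /=; last by rewrite mz.
apply: etrans (dpair_Ads hG _ _ _) _; apply: (congr1 (dpair _)).
exact (esym (mc_left_right hL (ch_cinv hN hch cz) v' (smoothN_rlog hG hN hch hu cz))).
Qed.

End MuS.
End SmoothMaps.

(** * Two-forms built from products and conjugates *)

#[local] Opaque mc_left.

Section Arithmetic.
Context {R : realType}.

Lemma sub_of_add (V : zmodType) (p q r s : V) : p = q + r -> p = s -> q = s - r.
Proof. by move=> -> <-; rewrite addrK. Qed.

Lemma conjugate_arith (q qk qX dX qD dk : R) :
  (q - qk - qX - 2 * dX) - (q - qD - qk - 2 * dk) = - qX + qD - 2 * dX + 2 * dk.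
Proof. ring. Qed.

Lemma conjugate_end_arith (w wl wr wr' qX qD dX dk : R) :
  w + wl - wr = - qX + qD - 2 * dX + 2 * dk -> wr = - wr' ->
  - qX - (wr' + w) = wl - qD + 2 * dX - 2 * dk.
Proof. by move=> E E'; lra. Qed.

End Arithmetic.

Section TwoForms.
Context {R : realType} {d : nat} {G : lie_data 'rV[R]_d}.
Hypothesis hG : lie_group G.
Context {m : nat} {N : topologicalType} {atlN : set (chart 'rV[R]_m N)}.
Hypothesis hN : smooth_manifold atlN.
Variable ch : chart 'rV[R]_m N.
Hypothesis hch : atlN ch.

Local Notation dpair := Defs.dpair.
Local Notation h := ('rV[R]_d * 'cV[R]_d)%type.
Local Notation H := (semidirect G).
Local Notation br := (lie_bracket G).
Local Notation coad := (@coad _ _ G).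
Local Notation good := (goodH ch).
Local Notation Q := (Qform ch).

Let hL := lie_group_calculus hG.
Let hLH := semidirect_calculus hG.

Implicit Types X Y : N -> H.

Section Values.
Variables v v' : 'rV[R]_m.

(** The wedge with the point and both tangent vectors fixed, so that constant group elements can act
    on its arguments. *)
Definition wedge_at (a b : 'rV[R]_m -> h) : R :=
  pairH (a v) (b v') - pairH (a v') (b v).

Lemma wedge_at_ext a a' b b' : a =1 a' -> b =1 b' ->
  wedge_at a b = wedge_at a' b'.
Proof. by move=> /funext -> /funext ->. Qed.

Lemma wedge_atC a b : wedge_at a b = - wedge_at b a.
Proof. by rewrite /wedge_at opprB !(pairHC (a _)). Qed.

Lemma wedge_atDl (a a' b : 'rV[R]_m -> h) :
  wedge_at (fun y => a y + a' y) b = wedge_at a b + wedge_at a' b.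
Proof. by rewrite /wedge_at !pairHDl opprD addrACA. Qed.

Lemma wedge_atNl (a b : 'rV[R]_m -> h) : wedge_at (fun y => - a y) b = - wedge_at a b.
Proof. by rewrite /wedge_at !pairHNl opprK opprB addrC. Qed.

Lemma wedge_atNr (a b : 'rV[R]_m -> h) : wedge_at a (fun y => - b y) = - wedge_at a b.
Proof. by rewrite wedge_atC wedge_atNl -wedge_atC. Qed.

Lemma wedge_at_self a : wedge_at a a = 0.
Proof. by rewrite /wedge_at (pairHC (a v')) subrr. Qed.

Lemma wedge_at0r a b : (forall y, b y = 0) -> wedge_at a b = 0.
Proof.
move=> b0; have -> : b = fun=> 0 by apply/funext.
by rewrite /wedge_at /pairH /= !dpair0l !dpair0r addr0 subrr.
Qed.

Lemma wedge_at_Ad (X : H) a b :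
  wedge_at (fun y => Ad X (a y)) (fun y => Ad X (b y)) = wedge_at a b.
Proof.
by apply: (congr2 (fun p q : R => p - q)); exact: pairH_Ad.
Qed.

Lemma wedge_at_Adl (X : H) a b :
  wedge_at (fun y => Ad X (a y)) b = wedge_at a (fun y => Ad (ginv X) (b y)).
Proof.
rewrite -(wedge_at_Ad X a); apply: wedge_at_ext => // y.
by rewrite (AdVK hLH).
Qed.

Section Point.
Variable x : N.
Hypothesis cx : cdom ch x.

Let cx' := ch_cinv hN hch cx.
Let rl X : good X -> has_rlog ch x X.
Proof. by move=> hX; exact: (goodH_rlog hG hN hch hX cx). Qed.

Lemma Qform_cst (a : H) : Q (fun=> a) x v v' = 0.
Proof.
rewrite /Qform /dmom !derive_cst.
by apply: etrans (congr2 (fun p q : R => p - q) (dpair0l _) (dpair0l _)) (subrr _).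
Qed.

Lemma dform_pot_cst X (a : G) : good X ->
  dform (pot X (fun=> a)) ch x v v' = 0.
Proof.
move=> hX; have [_ E] := pot_derive hG hN hch v v' hX (smoothN_cst hG a) cx.
have R0 y : mc_right (fun=> a) ch x y = 0 by exact (mc_right_cst hL cx' a y).
apply: etrans E _; apply: etrans (congr2 (fun p q =>
  dpair (dmom ch X x v) q - dpair (dmom ch X x v') p +
  dpair (momentum (X x)) (br p q)) (R0 v) (R0 v')) _.
have -> : br 0 0 = 0 by rewrite -(mul_lin1_bracket hG) mul0mx.
by rewrite !dpair0r subrr addr0.
Qed.

Lemma cocycle_at Y X : good Y -> good X ->
  wedge_at (mc_left Y ch x) (mc_right X ch x) =
  Q (fun a => gmul (Y a) (X a)) x v v' - Q X x v v' - Q Y x v v'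
  - 2 * dform (pot Y (fun a => Hfst (X a))) ch x v v'.
Proof. by move=> hY hX; exact: (cocycle hG hN hch v v' hY hX cx). Qed.

Lemma R_inv X : good X ->
  mc_right (fun a => ginv (X a)) ch x = fun y => - mc_left X ch x y.
Proof. by move=> hX; apply/funext => y; exact (mc_rightVE hLH cx' y (rl hX)). Qed.

Lemma L_inv X : good X ->
  mc_left (fun a => ginv (X a)) ch x = fun y => - mc_right X ch x y.
Proof. by move=> hX; apply/funext => y; exact (mc_leftVE hLH cx' y (rl hX)). Qed.

Lemma R_mul Y X : good Y -> good X ->
  mc_right (fun a => gmul (Y a) (X a)) ch x =
  fun y => mc_right Y ch x y + Ad (Y x) (mc_right X ch x y).
Proof.
by move=> hY hX; apply/funext => y; exact (mc_rightM hLH cx' y (rl hY) (rl hX)).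
Qed.

Lemma L_mul Y X : good Y -> good X ->
  mc_left (fun a => gmul (Y a) (X a)) ch x =
  fun y => Ad (ginv (X x)) (mc_left Y ch x y) + mc_left X ch x y.
Proof.
by move=> hY hX; apply/funext => y; exact (mc_leftM hLH cx' y (rl hY) (rl hX)).
Qed.

Lemma Ad_L X : good X ->
  (fun y => Ad (X x) (mc_left X ch x y)) = mc_right X ch x.
Proof. by move=> hX; apply/funext => y; exact (Ad_mc_left hLH cx' y (rl hX)). Qed.

Lemma L_R X : good X ->
  mc_left X ch x = fun y => Ad (ginv (X x)) (mc_right X ch x y).
Proof. by move=> hX; apply/funext => y; exact (mc_left_right hLH cx' y (rl hX)). Qed.

(** Right forms of inverses are minus left forms, and (YX)^-1 d (YX) = Ad (X^-1) (Y^-1 dY) + X^-1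
    dX. The second summand wedges to 0 with itself, and invariance moves X^-1 across. This applies
    to consecutive K, as K_i^-1 is some Y times K_{i-1}^-1. *)
Lemma wedge_inverse_products Y X : good Y -> good X ->
  wedge_at (mc_right (fun a => ginv (gmul (Y a) (X a))) ch x)
           (mc_right (fun a => ginv (X a)) ch x) =
  wedge_at (mc_left Y ch x) (mc_right X ch x).
Proof.
move=> hY hX; have hYX := goodHM hG hN hch hY hX.
apply: etrans (congr2 wedge_at (R_inv hYX) (R_inv hX)) _.
apply: etrans (wedge_atNl _ _) (etrans (congr1 -%R (wedge_atNr _ _)) _).
apply: etrans (opprK _) (etrans (congr2 wedge_at (L_mul hY hX) (erefl _)) _).
apply: etrans (wedge_atDl _ _ _) _.
apply: etrans (congr2 +%R (wedge_at_Adl _ _ _) (wedge_at_self _)) _.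
apply: etrans (addr0 _) (congr1 (wedge_at _) _).
apply: etrans (Ad_L hX); apply/funext => y.
exact (congr1 (fun Z => Ad Z (mc_left X ch x y)) (lc_invgK hLH (X x))).
Qed.

Section Conjugate.
Variables (k D : N -> H).
Hypotheses (hk : good k) (hD : good D).
Let X a := gmul (gmul (k a) (D a)) (ginv (k a)).
Let hkD := goodHM hG hN hch hk hD.
Let hX : good X := goodHM hG hN hch hkD (goodHV hG hN hch hk).

Let Xk : (fun a => gmul (X a) (k a)) = (fun a => gmul (k a) (D a)).
Proof. by apply/funext => a; exact: lc_mulgVK. Qed.

Let R_conj : mc_right X ch x = fun y =>
  mc_right k ch x y + Ad (k x) (mc_right D ch x y)
  - Ad (X x) (mc_right k ch x y).
Proof.
apply/funext => y.
have E := congr1 (@^~ y) (R_mul hX hk); have E' := congr1 (@^~ y) (R_mul hk hD).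
have Ek := congr1 (fun F => mc_right F ch x y) Xk.
exact (sub_of_add (etrans (esym Ek) E) E').
Qed.

(** Here X^-1 k = k D^-1, and the common factor [Ad] (k x) is removed by invariance. *)
Let twist_inv (a : 'rV[R]_m -> h) : wedge_at
    (fun y => Ad (ginv (X x)) (Ad (k x) (a y))) (fun y => Ad (k x) (a y)) =
  wedge_at (fun y => Ad (ginv (D x)) (a y)) a.
Proof.
apply: etrans _ (wedge_at_Ad (k x) _ _); apply: (congr1 (wedge_at ^~ _)).
apply/funext => y; apply: etrans (esym (AdM hLH _ _ _)) _.
apply: etrans _ (AdM hLH _ _ _); apply: (congr1 (fun Z => Ad Z (a y))).
rewrite /X !(lc_invMg hLH) (lc_invgK hLH) -!(lc_mulA hLH) (lc_mulVg hLH).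
by rewrite (lc_mulg1 hLH).
Qed.

Let R_k : mc_right k ch x = fun y => Ad (k x) (mc_left k ch x y).
Proof. exact: esym (Ad_L hk). Qed.

Let Ad_k (a : 'rV[R]_m -> h) :
  wedge_at (fun y => Ad (k x) (a y)) (mc_right k ch x) =
  wedge_at a (mc_left k ch x).
Proof.
apply: etrans (congr1 (wedge_at _) R_k) _.
exact: wedge_at_Ad.
Qed.

Let wedge_LX : wedge_at (mc_left X ch x) (mc_right k ch x) =
  wedge_at (fun y => Ad (ginv (D x)) (mc_left k ch x y)) (mc_left k ch x) +
  wedge_at (mc_left D ch x) (mc_left k ch x).
Proof.
have LX : mc_left X ch x = fun y =>
    Ad (ginv (X x)) (mc_right k ch x y) + (Ad (k x) (mc_left D ch x y)
    - mc_right k ch x y).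
  apply: etrans (L_R hX) _; apply/funext => y.
  apply: etrans (congr1 (fun F => Ad (ginv (X x)) (F y)) R_conj) _.
  apply: etrans (AdB hLH _ _ _) _; rewrite (AdD hLH) -addrA.
  apply: congr2; first by [].
  apply: congr2; last exact (congr1 -%R (AdK hLH _ _)).
  apply: etrans (esym (AdM hLH _ _ _)) _.
  apply: etrans _ (congr1 (Ad (k x)) (congr1 (@^~ y) (esym (L_R hD)))).
  apply: etrans _ (AdM hLH _ _ _).
  apply: (congr1 (fun Z => Ad Z (mc_right D ch x y))).
  rewrite /X !(lc_invMg hLH) (lc_invgK hLH) -!(lc_mulA hLH) (lc_mulVg hLH).
  by rewrite (lc_mulg1 hLH).
apply: etrans (congr1 (wedge_at ^~ _) LX) _.
apply: etrans (wedge_atDl _ _ _) _.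
apply: congr2.
  apply: etrans _ (twist_inv (mc_left k ch x)).
  by apply: congr2; [apply/funext => y|exact: R_k];
  exact (congr1 (fun F => Ad (ginv (X x)) (F y)) R_k).
apply: etrans (wedge_atDl _ _ _) _.
have Z : wedge_at (fun y => - mc_right k ch x y) (mc_right k ch x) = 0.
  by rewrite wedge_atNl wedge_at_self oppr0.
exact (etrans (congr2 (fun p q : R => p + q) (Ad_k (mc_left D ch x)) Z) (addr0 _)).
Qed.

Let wedge_RX : wedge_at (mc_right X ch x) (mc_right k ch x) =
  wedge_at (mc_right D ch x) (mc_left k ch x) +
  wedge_at (fun y => Ad (ginv (D x)) (mc_left k ch x y)) (mc_left k ch x).
Proof.
apply: etrans (congr1 (wedge_at ^~ _) R_conj) _.
apply: etrans (wedge_atDl _ _ _) _; apply: congr2.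
  apply: etrans (wedge_atDl _ _ _) _.
  exact (etrans (congr2 (fun p q : R => p + q) (wedge_at_self _)
    (Ad_k (mc_right D ch x))) (add0r _)).
apply: etrans (wedge_atNl _ _) _.
apply: etrans (congr1 -%R (wedge_at_Adl _ _ _)) _.
apply: etrans (esym (wedge_atC _ _)) _.
apply: etrans _ (twist_inv (mc_left k ch x)).
by apply: congr2; [apply/funext => y|exact: R_k];
  exact (congr1 (fun F => Ad (ginv (X x)) (F y)) R_k).
Qed.

(** X k and k D are the same map, so subtracting the cocycle identity of (k, D) from that of (X, k)
    cancels Q_{kD} and Q_k. *)
Lemma conjugate_form :
  wedge_at (fun y => Ad (ginv (D x)) (mc_left k ch x y)) (mc_left k ch x) +
  wedge_at (mc_left D ch x) (mc_left k ch x) -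
  wedge_at (mc_left k ch x) (mc_right D ch x) =
  - Q X x v v' + Q D x v v' -
  2 * dform (pot X (fun a => Hfst (k a))) ch x v v' +
  2 * dform (pot k (fun a => Hfst (D a))) ch x v v'.
Proof.
have E1 := etrans (esym wedge_LX) (cocycle_at hX hk).
have E2 := cocycle_at hk hD.
have E3 : Q (fun a => gmul (X a) (k a)) x v v' = Q (fun a => gmul (k a) (D a)) x v v'.
  exact (congr1 (fun F => Q F x v v') Xk).
apply: etrans (congr2 (fun p q : R => p - q) E1 E2) _.
apply: etrans (congr1 (fun p : R => p - _ - _ - _ - _) E3) _.
exact: conjugate_arith.
Qed.

(** The previous identity with the wedge twisted by D^-1 eliminated through [wedge_RX], as that
    wedge does not occur in the last terms of [Omega]. *)
Lemma conjugate_form_end :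
  - Q X x v v' - wedge_at (mc_right X ch x) (mc_right k ch x) =
  wedge_at (fun y => mc_left D ch x y) (mc_left k ch x) - Q D x v v' +
  2 * dform (pot X (fun a => Hfst (k a))) ch x v v' -
  2 * dform (pot k (fun a => Hfst (D a))) ch x v v'.
Proof.
have E := conjugate_form; have E' := wedge_atC (mc_left k ch x) (mc_right D ch x).
apply: etrans (congr1 (fun p : R => _ - p) wedge_RX) _.
exact: (conjugate_end_arith E E').
Qed.

End Conjugate.

End Point.
End Values.
End TwoForms.

(** * Linearity of the exterior derivative and the contribution of one handle *)

Section Handles.
Context {R : realType} {d : nat} {G : lie_data 'rV[R]_d}.
Hypothesis hG : lie_group G.
Context {m : nat} {N : topologicalType} {atlN : set (chart 'rV[R]_m N)}.
Hypothesis hN : smooth_manifold atlN.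
Variable ch : chart 'rV[R]_m N.
Hypothesis hch : atlN ch.

Local Notation gs := 'cV[R]_d.
Local Notation dpair := Defs.dpair.
Local Notation H := (semidirect G).
Local Notation good := (goodH ch).
Local Notation Q := (Qform ch).
Local Notation form := (form1 'rV[R]_m N R^o).

Let hL := lie_group_calculus hG.
Let hLH := semidirect_calculus hG.

Variables v v' : 'rV[R]_m.

Section PointForms.
Variable x : N.
Hypothesis cx : cdom ch x.

Lemma dform_ext (al be : form) :
  (forall a y, cdom ch a -> al ch a y = be ch a y) ->
  dform al ch x v v' = dform be ch x v v'.
Proof.
move=> E; apply: (congr2 (fun p q : R => p - q)); apply: near_eq_derive;
  by apply: filterS (near_ch hN hch cx) => z [cz _]; exact: E.
Qed.

Lemma dformD (al be : form) : form_good ch al -> form_good ch be ->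
  dform (fun c a y => al c a y + be c a y) ch x v v' =
  dform al ch x v v' + dform be ch x v v'.
Proof.
move=> ha hb; rewrite /dform.
have E w w' : 'D_w (fun z => al ch (cinv ch z) w' + be ch (cinv ch z) w') (cmap ch x) =
    'D_w (fun z => al ch (cinv ch z) w') (cmap ch x) +
    'D_w (fun z => be ch (cinv ch z) w') (cmap ch x).
  by apply: deriveD; [exact: ha|exact: hb].
apply: etrans (congr2 (fun p q : R => p - q) (E v v') (E v' v)) _.
by rewrite opprD addrACA.
Qed.

Lemma dformN (al : form) : form_good ch al ->
  dform (fun c a y => - al c a y) ch x v v' = - dform al ch x v v'.
Proof.
move=> ha; rewrite /dform.
have E w w' : 'D_w (fun z => - al ch (cinv ch z) w') (cmap ch x) =
    - 'D_w (fun z => al ch (cinv ch z) w') (cmap ch x).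
  by apply: deriveN; exact: ha.
apply: etrans (congr2 (fun p q : R => p - q) (E v v') (E v' v)) _.
by rewrite opprB opprK addrC.
Qed.

End PointForms.

Lemma form_good_ext (al be : form) :
  (forall a y, cdom ch a -> al ch a y = be ch a y) ->
  form_good ch be -> form_good ch al.
Proof.
move=> E hb x w w' cx.
have [//] : is_derive (cmap ch x) w (fun z => al ch (cinv ch z) w' : R^o)
  ('D_w (fun z => be ch (cinv ch z) w') (cmap ch x)).
apply: near_eq_is_derive (derivableP (hb x w w' cx)).
by apply: filterS (near_ch hN hch cx) => z [cz _]; exact: esym (E _ _ cz).
Qed.

Lemma form_goodD (al be : form) : form_good ch al -> form_good ch be ->
  form_good ch (fun c a y => al c a y + be c a y).
Proof. by move=> ha hb x w w' cx; apply: derivableD; [exact: ha|exact: hb]. Qed.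

Lemma form_goodN (al : form) : form_good ch al ->
  form_good ch (fun c a y => - al c a y).
Proof. by move=> ha x w w' cx; apply: derivableN; exact: ha. Qed.

Lemma form_good0 : form_good ch (fun _ _ _ => 0 : R^o).
Proof. by move=> x w w' cx; exact: derivable_cst. Qed.

Lemma dform0 x : dform (fun _ _ _ => 0 : R^o) ch x v v' = 0.
Proof.
apply: etrans (congr2 (fun p q : R => p - q) (derive_cst _ _ _) (derive_cst _ _ _)) _.
exact: subrr.
Qed.

Lemma form_good_sum (r : seq nat) (al : nat -> form) :
  (forall i, i \in r -> form_good ch (al i)) ->
  form_good ch (fun c a y => \sum_(i <- r) al i c a y).
Proof.
elim: r => [_|i r IH ha].
  rewrite (_ : (fun _ _ _ => _) = (fun _ _ _ => 0)); first exact: form_good0.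
  by do 3!apply/funext => ?; rewrite big_nil.
rewrite (_ : (fun _ _ _ => _) =
  (fun c a y => al i c a y + \sum_(i <- r) al i c a y)).
  apply: form_goodD; first by apply: ha; rewrite inE eqxx.
  by apply: IH => j rj; apply: ha; rewrite inE rj orbT.
by do 3!apply/funext => ?; rewrite big_cons.
Qed.

Lemma dform_sum x (r : seq nat) (al : nat -> form) : cdom ch x ->
  (forall i, i \in r -> form_good ch (al i)) ->
  dform (fun c a y => \sum_(i <- r) al i c a y) ch x v v' =
  \sum_(i <- r) dform (al i) ch x v v'.
Proof.
move=> cx; elim: r => [_|i r IH ha].
  rewrite big_nil (_ : (fun _ _ _ => _) = (fun _ _ _ => 0)); first exact: dform0.
  by do 3!apply/funext => ?; rewrite big_nil.
have ha' j : j \in r -> form_good ch (al j).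
  by move=> rj; apply: ha; rewrite inE rj orbT.
rewrite big_cons -(IH ha').
rewrite (_ : (fun _ _ _ => _) =
  (fun c a y => al i c a y + \sum_(i <- r) al i c a y)).
  apply: dformD => //; first by apply: ha; rewrite inE eqxx.
  exact: form_good_sum.
by do 3!apply/funext => ?; rewrite big_cons.
Qed.

Lemma pot_good (X : N -> H) (u : N -> G) : good X -> smoothN ch u -> form_good ch (pot X u).
Proof.
by move=> hX hu x w w' cx; have [+ _] := pot_derive hG hN hch w w' hX hu cx; apply.
Qed.

Section Handle.
Variables A B P : N -> H.
Hypotheses (hA : good A) (hB : good B) (hP : good P).

Let uA a := Hfst (A a).
Let uB a := Hfst (B a).
Let uP a := Hfst (P a).
Let uBAP a := gmul (gmul (ginv (uB a)) (uA a)) (uP a).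
Let uABAP a := gmul (gmul (gmul (ginv (uA a)) (ginv (uB a))) (uA a)) (uP a).
(** With Y = B A^-1 B^-1 one has [B, A^-1] P = Y (A P), so a handle is two successive left
    multiplications, by A and then by Y. *)
Let Y a := gmul (gmul (B a) (ginv (A a))) (ginv (B a)).
Let AP a := gmul (A a) (P a).
Let HP a := gmul (commV (B a) (A a)) (P a).

Let hA' := goodHV hG hN hch hA.
Let hB' := goodHV hG hN hch hB.
Let hBA' := goodHM hG hN hch hB hA'.
Let hY : good Y := goodHM hG hN hch hBA' hB'.
Let hAP : good AP := goodHM hG hN hch hA hP.
Let sA : smoothN ch uA := hA.1.
Let sB : smoothN ch uB := hB.1.
Let sP : smoothN ch uP := hP.1.

Let pairY a be : dpair (momentum (Y a)) be =
  - dpair (momentum (B a)) (Ad (ginv (uB a)) be) +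
  (- dpair (momentum (A a)) (Ad (ginv (uA a)) (Ad (ginv (uB a)) be)) +
   dpair (momentum (B a)) (Ad (ginv (uA a)) (Ad (ginv (uB a)) be))).
Proof.
have E : momentum (Y a) = - Ads (ginv (uB a)) (momentum (B a)) +
    Ads (ginv (uB a)) (- Ads (ginv (uA a)) (momentum (A a)) +
                       Ads (ginv (uA a)) (momentum (B a))).
  apply: etrans (momentumM hG _ _) _; apply: congr2; first exact: momentumV.
  apply: congr1; apply: etrans (momentumM hG _ _) _.
  by apply: congr2; first exact: momentumV.
apply: etrans (congr1 (dpair ^~ be) E) _; apply: etrans (dpairDl _ _ _) _.
apply: congr2.
  exact (etrans (dpairNl _ _) (congr1 -%R (dpair_Ads hG _ _ _))).
apply: etrans (dpair_Ads hG _ _ _) _; apply: etrans (dpairDl _ _ _) _.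
apply: congr2; last exact: dpair_Ads.
exact (etrans (dpairNl _ _) (congr1 -%R (dpair_Ads hG _ _ _))).
Qed.

(** The contribution of one handle to [Theta], with u_P in the role of W_{i-1}. *)
Definition handle_form : form := fun c a y =>
  (dpair (momentum (A a)) (mc_right uP c a y) -
   dpair (momentum (A a)) (mc_right uABAP c a y)) +
  (dpair (momentum (B a)) (mc_right uABAP c a y) -
   dpair (momentum (B a)) (mc_right uBAP c a y)).

Lemma handle_form_good : form_good ch handle_form.
Proof.
have sA' := smoothNV hG sA; have sB' := smoothNV hG sB.
have sBAP := smoothNM hG (smoothNM hG sB' sA) sP.
have sABAP := smoothNM hG (smoothNM hG (smoothNM hG sA' sB') sA) sP.
have p X u := @pot_good X u.
exact: (form_goodD (form_goodD (p _ _ hA sP) (form_goodN (p _ _ hA sABAP)))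
  (form_goodD (p _ _ hB sABAP) (form_goodN (p _ _ hB sBAP)))).
Qed.

Let handle_arith (t g1 g2 d1A d2A d1B d2B rA rB BB A1 B1 : R) :
  g1 = BB + g2 -> d1A = A1 - rA + d2A -> d1B = B1 - rB + d2B ->
  t + (- g1 + (- d1A + d1B)) + rB - (- g2 + (- d2A + d2B)) - rA =
  (t - A1) + (B1 - BB).
Proof. by move=> -> -> ->; ring. Qed.

(** The left-hand side collects the exact terms of the five cocycle identities of [handle_identity].
    They are evaluated by expanding j_Y ([pairY]) and by the product rule for the words u_B^-1 u_A
    u_P and u_A^-1 u_B^-1 u_A u_P. *)
Let handle_point a y : cdom ch a ->
  pot A uP ch a y + pot Y (fun a => Hfst (AP a)) ch a y +
  pot B (fun a => ginv (uA a)) ch a y - pot Y uB ch a y -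
  pot A (fun a => ginv (uA a)) ch a y = handle_form ch a y.
Proof.
move=> ca; have ca' := ch_cinv hN hch ca.
have rA := smoothN_rlog hG hN hch sA ca; have rB := smoothN_rlog hG hN hch sB ca.
have rAP := smoothN_rlog hG hN hch hAP.1 ca.
have rA' := has_rlogV hL ca' rA; have rB' := has_rlogV hL ca' rB.
(* The product rule for u_B^-1 (u_A u_P), solved for the twisted term. *)
have EB : Ad (ginv (uB a)) (mc_right (fun a => Hfst (AP a)) ch a y) =
    mc_right uBAP ch a y + Ad (ginv (uB a)) (mc_right uB ch a y).
  have fE : uBAP = (fun a => gmul (ginv (uB a)) (Hfst (AP a))).
    by apply/funext => b; exact: esym (lc_mulA hL _ _ _).
  apply: etrans _ (congr1 (fun F => mc_right F ch a y + _) (esym fE)).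
  apply: etrans _ (congr1 (fun p => p + _) (esym (mc_rightM hL ca' y rB' rAP))).
  apply: etrans _ (congr1 (fun p => p + _ + _) (esym (mc_rightV hL ca' y rB))).
  by rewrite addrAC addNr add0r.
have EA : Ad (ginv (uA a)) (mc_right uBAP ch a y) =
    mc_right uABAP ch a y - mc_right (fun a => ginv (uA a)) ch a y.
  have fE : uABAP = (fun a => gmul (ginv (uA a)) (uBAP a)).
    by apply/funext => b; rewrite /uABAP /uBAP !(lc_mulA hL).
  have rBAP' : has_rlog ch a uBAP.
    have fE' : uBAP = (fun a => gmul (ginv (uB a)) (Hfst (AP a))).
      by apply/funext => b; exact: esym (lc_mulA hL _ _ _).
    by rewrite fE'; exact (has_rlogM hL ca' rB' rAP).
  apply: etrans _ (congr1 (fun F => mc_right F ch a y - _) (esym fE)).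
  apply: etrans _ (congr1 (fun p => p - _) (esym (mc_rightM hL ca' y rA' rBAP'))).
  by rewrite addrAC subrr add0r.
have EAB := etrans (congr1 (Ad (ginv (uA a))) EB) (AdD hL _ _ _).
have {}EAB := etrans EAB (congr1 (fun p => p + _) EA).
have split3 (j : gs) p q r : dpair j (p - q + r) = dpair j p - dpair j q + dpair j r.
  by rewrite dpairDr (dpairDr j p) dpairNr.
apply: etrans (congr2 (fun p q : R => _ + p + _ - q - _)
  (pairY a (mc_right (fun a => Hfst (AP a)) ch a y)) (pairY a (mc_right uB ch a y))) _.
apply: handle_arith.
- exact (etrans (congr1 (dpair (momentum (B a))) EB) (dpairDr _ _ _)).
- exact (etrans (congr1 (dpair (momentum (A a))) EAB) (split3 _ _ _ _)).
- exact (etrans (congr1 (dpair (momentum (B a))) EAB) (split3 _ _ _ _)).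
Qed.

Let handle_arith2 (K1 K2 K3 K4 cY0 qAP qP qA qHP qY qBA qB qA' q1
    d1 d2 d3 d4 d5 th : R) :
  K1 = qAP - qP - qA - 2 * d1 -> K2 = qHP - qAP - qY - 2 * d2 ->
  cY0 = qBA - qB - qY - 2 * d4 -> K3 = - cY0 ->
  K4 = qBA - qA' - qB - 2 * d3 -> 0 = q1 - qA' - qA - 2 * d5 -> q1 = 0 ->
  th = d1 + d2 + d3 - d4 - d5 ->
  - (K1 + K2) - (K4 + K3) = - qHP + qP + 2 * th.
Proof. by move=> *; lra. Qed.

(** The cocycle identity is used for the pairs (A, P), (Y, AP), (Y, B), (B, A^-1) and (A, A^-1). In
    the sum Q_{AP}, Q_Y, Q_B and Q_{BA^-1} cancel. The last pair has wedge 0 and product 1, which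
    expresses Q_A + Q_{A^-1} as an exact form. *)
Lemma handle_identity x : cdom ch x ->
  - (wedge_at v v' (mc_right (fun a => ginv (AP a)) ch x)
                   (mc_right (fun a => ginv (P a)) ch x) +
     wedge_at v v' (mc_right (fun a => ginv (HP a)) ch x)
                   (mc_right (fun a => ginv (AP a)) ch x)) -
  (wedge_at v v' (mc_left A ch x) (mc_left B ch x) +
   wedge_at v v' (mc_right (fun a => gmul (gmul (B a) (A a)) (ginv (B a))) ch x)
                 (mc_right B ch x)) =
  - Q HP x v v' + Q P x v v' + 2 * dform handle_form ch x v v'.
Proof.
move=> cx.
have fHP : HP = (fun a => gmul (Y a) (AP a)).
  by apply/funext => a; exact: esym (lc_mulA hLH _ _ _).
have fBAB : (fun a => gmul (gmul (B a) (A a)) (ginv (B a))) = (fun a => ginv (Y a)).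
  apply/funext => a; rewrite /Y !(lc_invMg hLH) !(lc_invgK hLH).
  exact: esym (lc_mulA hLH _ _ _).
have fYB : (fun a => gmul (Y a) (B a)) = (fun a => gmul (B a) (ginv (A a))).
  by apply/funext => a; exact: lc_mulgVK hLH _ _.
have fAA : (fun a => gmul (A a) (ginv (A a))) = (fun=> gone H).
  by apply/funext => a; exact: lc_mulgV hLH _.
have K1 := wedge_inverse_products hG hN hch v v' cx hA hP.
have K2 := wedge_inverse_products hG hN hch v v' cx hY hAP.
have c1 := cocycle_at hG hN hch v v' cx hA hP.
have c2 := cocycle_at hG hN hch v v' cx hY hAP.
have c3 := cocycle_at hG hN hch v v' cx hY hB.
have c4 := cocycle_at hG hN hch v v' cx hB hA'.
have c5 := cocycle_at hG hN hch v v' cx hA hA'.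
have RA' := R_inv hG hN hch cx hA.
have K3 : wedge_at v v'
    (mc_right (fun a => gmul (gmul (B a) (A a)) (ginv (B a))) ch x)
    (mc_right B ch x) = - wedge_at v v' (mc_left Y ch x) (mc_right B ch x).
  apply: etrans (congr1 (fun F => wedge_at v v' (mc_right F ch x) _) fBAB) _.
  apply: etrans (congr1 (fun F => wedge_at v v' F _) (R_inv hG hN hch cx hY)) _.
  exact: wedge_atNl.
(* As d (A^-1) A = - A^-1 dA, the sign absorbs the exchange of the two arguments. *)
have K4 : wedge_at v v' (mc_left A ch x) (mc_left B ch x) =
    wedge_at v v' (mc_left B ch x) (mc_right (fun a => ginv (A a)) ch x).
  apply: etrans _ (esym (congr1 (wedge_at v v' _) RA')).
  apply: etrans _ (esym (wedge_atNr v v' _ _)).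
  exact: wedge_atC.
have K5 : 0 = wedge_at v v' (mc_left A ch x) (mc_right (fun a => ginv (A a)) ch x).
  apply: etrans _ (esym (congr1 (wedge_at v v' _) RA')).
  apply: etrans _ (esym (wedge_atNr v v' _ _)).
  by rewrite wedge_at_self oppr0.
have c2' := etrans c2 (congr1 (fun F => Q F x v v' - _ - _ - _) (esym fHP)).
have K2' := etrans (congr1 (fun F => wedge_at v v'
  (mc_right (fun a => ginv (F a)) ch x)
  (mc_right (fun a => ginv (AP a)) ch x)) fHP) K2.
have c3' := etrans c3 (congr1 (fun F => Q F x v v' - _ - _ - _) fYB).
have q1 := etrans (congr1 (fun F => Q F x v v') fAA) (Qform_cst ch v v' x (gone H)).
have sA' := smoothNV hG sA.
have g1 := pot_good hA sP; have g2 := pot_good hY hAP.1.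
have g3 := pot_good hB sA'; have g4 := pot_good hY sB; have g5 := pot_good hA sA'.
have dh := @dform_ext x cx handle_form (fun c a y =>
  pot A uP c a y + pot Y (fun a => Hfst (AP a)) c a y +
  pot B (fun a => ginv (uA a)) c a y - pot Y uB c a y -
  pot A (fun a => ginv (uA a)) c a y) (fun a y ca => esym (handle_point y ca)).
have {dh} dh := etrans dh (dformD cx (form_goodD (form_goodD (form_goodD g1 g2) g3)
  (form_goodN g4)) (form_goodN g5)).
have dh4 := dformD cx (form_goodD (form_goodD g1 g2) g3) (form_goodN g4).
have dh3 := dformD cx (form_goodD g1 g2) g3.
have dh2 := dformD cx g1 g2.
have th := etrans dh (congr2 (fun p q : R => p + q) (etrans dh4
  (congr2 (fun p q : R => p + q) (etrans dh3 (congr1 (fun p : R => p + _) dh2))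
  (dformN cx g4))) (dformN cx g5)).
exact (handle_arith2 (etrans K1 c1) (etrans K2' c2') c3' K3 (etrans K4 c4)
  (etrans K5 c5) q1 th).
Qed.

End Handle.
End Handles.

(** * Conjugates of exponentials *)

Section Arithmetic.
Context {R : realType}.

Lemma conjugate_cst_arith (a b c q q0 p p0 a' : R) :
  a + b - c = - q + q0 - 2 * p + 2 * p0 ->
  b = - 0 -> c = 0 -> p0 = 0 -> q0 = 0 -> a = a' -> a' = - q - 2 * p.
Proof. by move=> *; lra. Qed.

Lemma Qform_exp_arith (p q r r' : R) :
  r' = r -> - (p + r - (q + r')) = - p - - q.
Proof. by move=> ->; ring. Qed.

Lemma end_arith (qX wR wLD wL w qD pX pk ds h t t1 t2 nk : R) :
  - qX - wR = wLD - qD + 2 * pX - 2 * pk -> wL = - wR -> wLD = - w ->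
  qD = - ds -> h = 2^-1 * ds -> t = t1 -> t1 = t2 + h -> t2 = pX + nk -> nk = - pk ->
  - qX + wL + w = 2 * t.
Proof. by move=> *; lra. Qed.

End Arithmetic.

Section Exponentials.
Context {R : realType} {d : nat} {G : lie_data 'rV[R]_d}.
Hypothesis hG : lie_group G.
Context {m : nat} {N : topologicalType} {atlN : set (chart 'rV[R]_m N)}.
Hypothesis hN : smooth_manifold atlN.
Variable ch : chart 'rV[R]_m N.
Hypothesis hch : atlN ch.
Variable e : 'rV[R]_d -> G.
Hypothesis he : exponential_map e.

Local Notation g := 'rV[R]_d.
Local Notation gs := 'cV[R]_d.
Local Notation dpair := Defs.dpair.
Local Notation H := (semidirect G).
Local Notation good := (goodH ch).
Local Notation Q := (Qform ch).
Local Notation form := (form1 'rV[R]_m N R^o).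
Local Notation br := (lie_bracket G).

Let hL := lie_group_calculus hG.
Let hLH := semidirect_calculus hG.

Lemma ginv_exp (xi : g) (j : gs) : @coad _ _ G xi j = 0 ->
  ginv (Hpair (e xi) j) = Hpair (e (- xi)) (- j).
Proof.
move=> co0; rewrite /ginv /= /semi_inv /= (expN hG he) -[RHS]/(_, _).
exact (congr1 (fun p => (ginv (e xi), - p)) (Ads_exp hG he co0)).
Qed.

Section FixedConjugate.
Variables v v' : 'rV[R]_m.

(** [conjugate_form] with the constant D = C^-1, whose Maurer-Cartan forms and Q vanish. *)
Lemma conjugate_cst_form (k : N -> H) (C : H) x : cdom ch x -> good k ->
  wedge_at v v' (fun y => Ad C (mc_left k ch x y)) (mc_left k ch x) =
  - Q (fun a => gmul (gmul (k a) (ginv C)) (ginv (k a))) x v v' -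
  2 * dform (pot (fun a => gmul (gmul (k a) (ginv C)) (ginv (k a)))
                 (fun a => Hfst (k a))) ch x v v'.
Proof.
move=> cx hk; have cx' := ch_cinv hN hch cx.
have hD := goodH_cst hG ch (ginv C).
have E := conjugate_form hG hN hch v v' cx hk hD.
have R0 y : mc_right (fun=> ginv C) ch x y = 0 by exact (mc_right_cst hLH cx' _ y).
have L0 y : mc_left (fun=> ginv C) ch x y = 0.
  apply: etrans (mc_left_right hLH cx' y (has_rlog_cst hLH ch x (ginv C))) _.
  exact (etrans (congr1 (Ad _) (R0 y)) (Ad_0 hLH _)).
have W1 := etrans (wedge_atC v v' _ _) (congr1 -%R (wedge_at0r v v' (mc_left k ch x) L0)).
have W2 := wedge_at0r v v' (mc_left k ch x) R0.
have P0 := dform_pot_cst hG hN hch v v' cx (Hfst (ginv C)) hk.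
have Q0 := Qform_cst ch v v' x (ginv C).
have A0 : wedge_at v v' (fun y => Ad (ginv (ginv C)) (mc_left k ch x y)) (mc_left k ch x)
    = wedge_at v v' (fun y => Ad C (mc_left k ch x y)) (mc_left k ch x).
  exact (congr1 (fun Z => wedge_at v v' (fun y => Ad Z (mc_left k ch x y)) (mc_left k ch x))
    (lc_invgK hLH C)).
exact (conjugate_cst_arith E W1 W2 P0 Q0 A0).
Qed.

End FixedConjugate.

Section EndTerm.
Variables (c0 : {vspace g}) (c1 : {vspace gs}).
Hypothesis c0_abelian : forall xi eta, xi \in c0 -> eta \in c0 -> br xi eta = 0.
Hypothesis c0_c1 : forall xi j, xi \in c0 -> j \in c1 -> @coad _ _ G xi j = 0.

(** In an abelian subalgebra e (f) e (f x)^-1 = e (f - f x), and [exp_curve] gives its velocity. *)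
Lemma mc_right_exp (f : N -> g) x y : (forall a, f a \in c0) -> cdom ch x ->
  differentiable (fun z => f (cinv ch z)) (cmap ch x) ->
  mc_right (fun a => e (f a)) ch x y = dfun f ch x y.
Proof.
move=> fc cx df; have cx' := ch_cinv hN hch cx.
apply: (mc_rightE (h := fun a => e (f a)) cx').
have /is_derive_lineP D := diff_is_derive y df.
have yc t : f (cinv ch (t *: y + cmap ch x)) - f x \in c0 by rewrite memvB.
have D' : is_derive (0 : R) 1 (fun t : R => f (cinv ch (t *: y + cmap ch x)) - f x)
    (dfun f ch x y).
  have := is_deriveB D (is_derive_cst (f x) (0 : R) 1); rewrite subr0; exact.
have y0 : f (cinv ch ((0 : R) *: y + cmap ch x)) - f x = 0.
  by rewrite (line0 cx') subrr.
apply: tangent1_eq (exp_curve hG he c0_abelian yc y0 D') => t.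
rewrite (line0 cx') -(expN hG he); apply: (expD hG he).
by apply: c0_abelian; rewrite ?memvN.
Qed.

Variables (mu : N -> g) (s : N -> gs).
Hypothesis muc : forall a, mu a \in c0.
Hypothesis sc : forall a, s a \in c1.
Hypothesis hmus : smooth_map atlN (vect_atlas (g * gs)%type) (fun x => (mu x, s x)).

Let D a : H := Hpair (e (- mu a)) (- s a).

Lemma momentum_exp a : momentum (D a) = s a.
Proof.
have E : Ads (e (- mu a)) (- s a) = - s a.
  by apply: (Ads_exp hG he); apply: c0_c1; rewrite memvN.
exact (etrans (congr1 -%R E) (opprK _)).
Qed.

Let dmu x : cdom ch x -> differentiable (fun z => mu (cinv ch z)) (cmap ch x).
Proof.
move=> cx; have [U [_ Ux muC _]] := smooth_map_pair hN hch hmus cx.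
exact: smooth_on_differentiable muC Ux.
Qed.

Let ds x : cdom ch x -> differentiable (fun z => s (cinv ch z)) (cmap ch x).
Proof.
move=> cx; have [U [_ Ux _ sC]] := smooth_map_pair hN hch hmus cx.
exact: smooth_on_differentiable sC Ux.
Qed.

Let uD a := Hfst (D a).

Let R_uD x y : cdom ch x -> mc_right uD ch x y = - dfun mu ch x y.
Proof.
move=> cx; have dN := differentiableN (dmu cx).
have := mc_right_exp y (f := fun a => - mu a) _ cx dN => /(_ _)E.
apply: etrans (E _) _; first by move=> a; rewrite memvN.
exact (deriveN (diff_derivable (dmu cx))).
Qed.

Variables (k X : N -> H).
Hypotheses (hk : good k) (hX : good X).
Hypothesis XE : forall a, X a = gmul (gmul (k a) (D a)) (ginv (k a)).

(** Regularity is not obtained from [e], which is only controlled along lines, but from D = k^-1 X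
    k. *)
Let hD : good D.
Proof.
have := goodHM hG hN hch (goodHV hG hN hch hk) (goodHM hG hN hch hX hk).
rewrite (_ : (fun x => _) = D) //; apply/funext => a.
by rewrite XE (lc_mulgVK hLH) (lc_mulKg hLH).
Qed.

Let hD' := goodHV hG hN hch hD.

Let Dinv a : ginv (D a) = Hpair (e (mu a)) (s a).
Proof.
rewrite /D (ginv_exp (xi := - mu a)) ?opprK //.
by apply: c0_c1; rewrite memvN.
Qed.

Let L_uD x y : cdom ch x -> mc_left uD ch x y = - dfun mu ch x y.
Proof.
move=> cx; have cx' := ch_cinv hN hch cx.
have E := mc_rightVE hL cx' y (smoothN_rlog hG hN hch hD.1 cx).
have fE : (fun a => ginv (uD a)) = (fun a => e (mu a)).
  by apply/funext => a; exact (congr1 (@Hfst _ _ G) (Dinv a)).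
have E' := mc_right_exp y muc cx (dmu cx).
apply: etrans (esym (opprK _)) _; apply: (congr1 -%R).
apply: etrans (esym E) _.
exact (etrans (congr1 (fun F => mc_right F ch x y) fE) E').
Qed.

(** D^-1 dD is minus the right form of D^-1 = exp (mu, s), whose components are dmu and [Ads]
    (e^-mu) ds = ds. *)
Let L_D x y : cdom ch x -> mc_left D ch x y = - (dfun mu ch x y, dfun s ch x y).
Proof.
move=> cx.
have E := congr1 (@^~ y) (R_inv hG hN hch cx hD).
apply: etrans (esym (opprK _)) _; apply: (congr1 -%R).
apply: etrans (esym E) _.
apply: etrans (mc_right_semi hG hN hch y hD' cx) _.
have fE : (fun a => Hfst (ginv (D a))) = (fun a => e (mu a)).
  by apply/funext => a; exact (congr1 (@Hfst _ _ G) (Dinv a)).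
apply: congr2.
  exact (etrans (congr1 (fun F => mc_right F ch x y) fE)
    (mc_right_exp y muc cx (dmu cx))).
have dmE : dmom ch (fun a => ginv (D a)) x y = - dfun s ch x y.
  apply: etrans _ (deriveN (diff_derivable (ds cx))).
  apply: (congr1 (fun F => 'D_y F (cmap ch x))); apply/funext => z.
  apply: etrans (congr1 momentum (Dinv _)) _.
  exact (congr1 -%R (Ads_exp hG he (c0_c1 (muc _) (sc _)))).
apply: etrans (congr1 (fun p => - Ads _ p) dmE) _.
apply: etrans (congr1 -%R (AdsN _ _)) (etrans (opprK _) _).
apply: etrans (congr1 (fun q : H => Ads (ginv (Hfst q)) _) (Dinv x)) _.
rewrite /Hfst /= -(expN hG he).
have dl := diff_is_derive y (ds cx).
have dl' := (is_derive_lineP _ _ _ _).1 dl.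
(* [Ads] (e^-mu(x)) fixes every value of s, hence also the derivative of s. *)
apply: (is_derive_unique _ dl').
have := is_derive_Ads_cst (e (- mu x)) dl'; congr is_derive; apply/funext => t.
by apply: (Ads_exp hG he); apply: c0_c1; rewrite ?memvN.
Qed.

Let sdmu : form := fun c a y => dpair (s a) (dfun mu c a y).

Let sdmu_derive x y y' : cdom ch x ->
  is_derive (cmap ch x) y (fun z => sdmu ch (cinv ch z) y' : R^o)
    (dpair (dfun s ch x y) (dfun mu ch x y') +
     dpair (s x) ('D_y ('D_y' (fun z => mu (cinv ch z))) (cmap ch x))).
Proof.
move=> cx; have [U [oU Ux muC sC]] := smooth_map_pair hN hch hmus cx.
have d1 := diff_is_derive y (ds cx).
have d2 := diff_is_derive y (smooth_on_differentiable (smooth_on_derive y' muC) Ux).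
have := is_derive_dpair d1 d2; rewrite (ch_cinv hN hch cx) => /near_eq_is_derive; apply.
apply: filterS (near_ch hN hch cx) => z [cz mz].
by rewrite /sdmu /dfun mz.
Qed.

Lemma sdmu_good : form_good ch sdmu.
Proof. by move=> x y y' cx; have [] := sdmu_derive y y' cx. Qed.

(** D has momentum s and left form - dmu on the group component, and d<s, dmu> = <ds ^ dmu> by
    symmetry of the second derivatives of mu. *)
Let Qform_exp x v v' : cdom ch x -> Q D x v v' = - dform sdmu ch x v v'.
Proof.
move=> cx; have [U [oU Ux muC sC]] := smooth_map_pair hN hch hmus cx.
have [_ E] := sdmu_derive v v' cx; have [_ E'] := sdmu_derive v' v cx.
have S := derive_derive_comm v v' oU Ux muC.
have dm y : dmom ch D x y = dfun s ch x y.
  apply: (congr1 (fun F => 'D_y F (cmap ch x))); apply/funext => z.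
  exact: momentum_exp.
have P y y' : dpair (dmom ch D x y) (mc_left uD ch x y') =
    - dpair (dfun s ch x y) (dfun mu ch x y').
  exact (etrans (congr2 dpair (dm y) (L_uD y' cx)) (dpairNr _ _)).
apply: etrans (congr2 (fun p q : R => p - q) (P v v') (P v' v)) _.
apply: esym; apply: etrans (congr2 (fun p q : R => - (p - q)) E E') _.
have S' := congr1 (dpair (s x)) S.
exact: Qform_exp_arith S'.
Qed.
(** The terms of [potential] that involve g_infinity, here called k. *)
Definition end_form : form := fun c a y =>
  pot X (fun a => Hfst (k a)) c a y -
  dpair (Ads (Hfst (k a)) (Hsnd (k a)) - 2^-1 *: s a) (dfun mu c a y).

Let kdmu : form := pot k uD.

Let end_formE a y : cdom ch a -> end_form ch a y =
  pot X (fun a => Hfst (k a)) ch a y - kdmu ch a y + 2^-1 * sdmu ch a y.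
Proof.
move=> ca; rewrite /end_form -addrA; congr (_ + _).
have E : kdmu ch a y = dpair (Ads (Hfst (k a)) (Hsnd (k a))) (dfun mu ch a y).
  apply: etrans (congr1 (dpair _) (R_uD y ca)) _.
  apply: etrans (dpairNl _ _) _.
  exact (etrans (congr1 -%R (dpairNr _ _)) (opprK _)).
rewrite E dpairDl opprD dpairNl dpairZl opprK; exact: erefl.
Qed.

Let half_good : form_good ch (fun c a y => 2^-1 * sdmu c a y).
Proof. by move=> x y y' cx; apply: derivableZ; exact: sdmu_good. Qed.

Lemma end_form_good : form_good ch end_form.
Proof.
have h1 := form_goodD (form_goodD (pot_good hG hN hch hX hk.1)
  (form_goodN (pot_good hG hN hch hk hD.1))) half_good.
exact: (form_good_ext hN hch (fun a y ca => end_formE y ca)) h1.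
Qed.

(** In [conjugate_form_end] the wedge of D^-1 dD cancels the one with (dmu, ds), and the wedge of
    the right form of X is the one with K^-1 dK up to sign. There remain - Q_D = d<s, dmu>, which is
    2 d of the term s/2, and two exact forms, of which <j_k, du_D u_D^-1> is the pairing of [Ads] v
    x with dmu. *)
Lemma end_term x v v' : cdom ch x ->
  - Q X x v v' +
  wedge_at v v' (mc_left (fun a => ginv (X a)) ch x) (mc_right k ch x) +
  wedge_at v v' (fun y => (dfun mu ch x y, dfun s ch x y)) (mc_left k ch x) =
  2 * dform end_form ch x v v'.
Proof.
move=> cx; have fE : X = (fun a => gmul (gmul (k a) (D a)) (ginv (k a))).
  by apply/funext.
have E := conjugate_form_end hG hN hch v v' cx hk hD; rewrite -fE in E.
have W1 := etrans (congr1 (fun F => wedge_at v v' F _) (L_inv hG hN hch cx hX))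
  (wedge_atNl v v' _ (mc_right k ch x)).
have W2 : wedge_at v v' (mc_left D ch x) (mc_left k ch x) =
    - wedge_at v v' (fun y => (dfun mu ch x y, dfun s ch x y)) (mc_left k ch x).
  apply: etrans _ (wedge_atNl v v' _ (mc_left k ch x)).
  apply: (congr1 (fun F => wedge_at v v' F (mc_left k ch x))).
  by apply/funext => y; exact: L_D.
have Q0 := Qform_exp v v' cx.
have g1 := pot_good hG hN hch hX hk.1; have g2 := pot_good hG hN hch hk hD.1.
have ZE : dform (fun c a y => 2^-1 * sdmu c a y) ch x v v' = 2^-1 * dform sdmu ch x v v'.
  have E' y y' : 'D_y (fun z => 2^-1 * sdmu ch (cinv ch z) y') (cmap ch x) =
      2^-1 * 'D_y (fun z => sdmu ch (cinv ch z) y') (cmap ch x).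
    exact (deriveZ _ (@sdmu_good x y y' cx)).
  by apply: etrans (congr2 (fun p q : R => p - q) (E' v v') (E' v' v)) _; rewrite mulrBr.
have F1 := dform_ext hN hch v v' (al := end_form)
  (be := fun c a y => pot X (fun a => Hfst (k a)) c a y - kdmu c a y + 2^-1 * sdmu c a y)
  cx (fun a y ca => end_formE y ca).
have F2 := dformD v v' cx (form_goodD g1 (form_goodN g2)) half_good.
have F3 := dformD v v' cx g1 (form_goodN g2).
have F4 := dformN v v' cx g2.
exact (end_arith E W1 W2 Q0 ZE F1 F2 F3 F4).
Qed.

End EndTerm.
End Exponentials.

(** * Telescoping *)

Section Sums.
Context {R : realType}.
Implicit Types F q t : nat -> R.

Lemma half_coef (k p : R) : p != 0 -> k / (2 * p) = k / (4 * p) * 2.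
Proof. by move=> p0; field; rewrite p0. Qed.

Lemma sum_shift1 F n : \sum_(1 <= i < n.+1) F i = \sum_(0 <= i < n) F i.+1.
Proof. by rewrite big_add1. Qed.

Lemma sum_telescope F q t n :
  (forall i, (i < n)%N -> F i = - q i.+1 + q i + 2 * t i) ->
  \sum_(0 <= i < n) F i = - q n + q 0%N + 2 * \sum_(0 <= i < n) t i.
Proof.
elim: n => [_|n IH hF]; first by rewrite !big_nil; ring.
rewrite !big_nat_recr //= IH; last by move=> i ltin; apply: hF; exact: ltnW.
by rewrite (hF n) //; ring.
Qed.

Lemma sum_telescope_sub (c k : nat -> R) q t n :
  (forall i, (i < n)%N -> c i.+1 - k i = - q i.+1 + q i + 2 * t i) ->
  \sum_(1 <= i < n.+1) c i - \sum_(0 <= i < n) k i =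
  - q n + q 0%N + 2 * \sum_(0 <= i < n) t i.
Proof. by move=> /sum_telescope <-; rewrite sumrB sum_shift1. Qed.

Lemma sum_telescope_pairs (k h : nat -> R) q t n :
  (forall i, (i < n)%N -> - k i - h i.+1 = - q i.+1 + q i + 2 * t i) ->
  - \sum_(0 <= i < n) k i - \sum_(1 <= i < n.+1) h i =
  - q n + q 0%N + 2 * \sum_(0 <= i < n) t i.
Proof. by move=> /sum_telescope <-; rewrite sumrB sumrN sum_shift1. Qed.

(** The first n terms in K belong to the punctures; the others come in pairs, one pair for each
    handle. *)
Lemma sum_split_pairs F n p : \sum_(1 <= i < (n + 2 * p).+1) F i =
  \sum_(0 <= i < n) F i.+1 +
  \sum_(0 <= j < p) (F (n + 2 * j)%N.+1 + F (n + 2 * j)%N.+2).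
Proof.
rewrite sum_shift1; elim: p => [|p IH].
  by rewrite big_nil addr0 muln0 addn0.
have -> : (n + 2 * p.+1 = (n + 2 * p).+2)%N by rewrite mulnS addnA addnAC addn2.
by rewrite !big_nat_recr //= IH; ring.
Qed.

Lemma M_arith (wC wK q0 q1 qM p1 p2 t : R) :
  wC = - qM - 2 * p2 -> wK = q1 - q0 - qM - 2 * p1 -> t = p1 + - p2 ->
  wC - wK = - q1 + q0 + 2 * t.
Proof. by move=> -> -> ->; ring. Qed.

Lemma total_arith (k4 k2 sC sK sK1 sK2 sH dw w1 w2 qn q0 qg tM tH dE dT dP : R) :
  k2 = k4 * 2 -> sK = sK1 + sK2 -> sC - sK1 = - qn + q0 + 2 * tM -> q0 = 0 ->
  - sK2 - sH = - qg + qn + 2 * tH -> - qg + w1 + w2 = 2 * dE ->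
  dT = tM + tH -> dP = dw + dT + dE ->
  k4 * sC - k4 * sK - k4 * sH + k2 * dw + k4 * w1 + k4 * w2 = k2 * dP.
Proof.
move=> -> -> EM E0 EH EE -> ->.
transitivity (k4 * ((sC - sK1) + (- sK2 - sH) + w1 + w2 + 2 * dw)); first by ring.
by rewrite EM EH E0 -(mulrA k4); congr (_ * _); move: EE; lra.
Qed.

End Sums.

(** * Assembly of the punctures, the handles and the end term *)

Section MainProof.
Context {R : realType} {d : nat} {G : lie_data 'rV[R]_d}.
Hypothesis hG : lie_group G.
Context {m : nat} {N : topologicalType} {atlN : set (chart 'rV[R]_m N)}.
Hypothesis hN : smooth_manifold atlN.
Variable ch : chart 'rV[R]_m N.
Hypothesis hch : atlN ch.
Variable e : 'rV[R]_d -> G.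
Hypothesis he : exponential_map e.

Local Notation g := 'rV[R]_d.
Local Notation gs := 'cV[R]_d.
Local Notation dpair := Defs.dpair.
Local Notation wedge := Defs.wedge.
Local Notation H := (semidirect G).
Local Notation good := (goodH ch).
Local Notation Q := (Qform ch).
Local Notation form := (form1 'rV[R]_m N R^o).


Variables (n gen : nat) (mui : nat -> g) (si : nat -> gs).
Variables (gM A B : nat -> N -> H).
Hypothesis coad0 : forall i, (i < n)%N -> @coad _ _ G (mui i.+1) (si i.+1) = 0.
Hypothesis ggM : forall i, (i < n)%N -> good (gM i.+1).
Hypothesis gA : forall j, (j < gen)%N -> good (A j.+1).
Hypothesis gB : forall j, (j < gen)%N -> good (B j.+1).

Local Notation M_ := (Mfun e mui si gM).
Local Notation K_ := (Kfun e n mui si gM A B).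
Local Notation KV_ := (KVfun e n mui si gM A B).

Let MP i (a : N) : H := Mprod (fun l => M_ l a) i.
Let WP j (a : N) : H := Wprod n (fun l => M_ l a) (fun l => A l a) (fun l => B l a) j.

Let gMf i : (i < n)%N -> good (M_ i.+1).
Proof.
move=> ltin; have hg := ggM ltin.
exact: (goodHM hG hN hch (goodHM hG hN hch hg (goodH_cst hG ch _))
  (goodHV hG hN hch hg)).
Qed.

Let gMP i : (i <= n)%N -> good (MP i).
Proof.
elim: i => [_|i IH ltin]; first exact: goodH_cst.
exact: (goodHM hG hN hch (gMf ltin) (IH (ltnW ltin))).
Qed.

Let gWP j : (j <= gen)%N -> good (WP j).
Proof.
elim: j => [_|j IH ltj]; first exact: gMP.
have hA := gA ltj; have hB := gB ltj; have hA' := goodHV hG hN hch hA.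
have hB' := goodHV hG hN hch hB.
have h1 := goodHM hG hN hch (goodHM hG hN hch hB hA') hB'.
exact: (goodHM hG hN hch (goodHM hG hN hch h1 hA) (IH (ltnW ltj))).
Qed.

Let K_M i : (i <= n)%N -> K_ i = (fun a => ginv (MP i a)).
Proof. by move=> lein; apply/funext => a; rewrite /Kfun /KVfun /Kinv lein. Qed.

Let KV_W j : KV_ (n + 2 * j) = WP j.
Proof.
apply/funext => a; rewrite /KVfun /Kinv.
(* For j = 0 the index n still falls under the first case of [Kinv], whose value [Mprod] at n is
   also [Wprod] at 0. *)
case: j => [|j]; first by rewrite muln0 addn0 leqnn.
have -> : (n + 2 * j.+1 <= n)%N = false by rewrite -[leqRHS]addn0 leq_add2l.
by rewrite addKn mul2n odd_double uphalf_double.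
Qed.

Let KV_A j : KV_ (n + 2 * j).+1 = (fun a => gmul (A j.+1 a) (WP j a)).
Proof.
apply/funext => a; rewrite /KVfun /Kinv.
have -> : ((n + 2 * j).+1 <= n)%N = false by rewrite ltnNge leq_addr.
by rewrite -addnS addKn mul2n /= odd_double /= doubleK.
Qed.

Let Hfst_MP i a : Hfst (MP i a) = PuM e mui si gM i a.
Proof. by elim: i => [|i IH] //=; rewrite /MP /PuM /= -[in RHS]/(PuM e mui si gM i a) -IH. Qed.

Let Hfst_WP j a : Hfst (WP j a) = Wfun e n mui si gM A B j a.
Proof.
elim: j => [|j IH]; first exact: Hfst_MP.
rewrite /WP /Wfun /= -[in RHS]/(Wfun e n mui si gM A B j a) -IH; exact: erefl.
Qed.

Let thM i : form := fun c a y =>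
  pot (M_ i.+1) (fun a => Hfst (MP i a)) c a y -
  pot (M_ i.+1) (fun a => Hfst (gM i.+1 a)) c a y.

Let thH j : form := handle_form (A j.+1) (B j.+1) (WP j).

Let ThetaE c a y : Theta e n gen mui si gM A B c a y =
  \sum_(0 <= i < n) thM i c a y + \sum_(0 <= j < gen) thH j c a y.
Proof.
rewrite /Theta -addrA; apply: congr2.
  apply: etrans (sum_shift1 _ _) _; apply: eq_bigr => i _ /=.
  rewrite (jpartE hG); apply: etrans (dpairDr _ _ _) _.
  apply: congr2; last exact: dpairNr.
  apply: (congr1 (fun F => dpair _ (mc_right F c a y))).
  by apply/funext => b; rewrite Hfst_MP.
apply: etrans (congr2 (fun p q : R => p + q) (sum_shift1 _ _) (sum_shift1 _ _)) _.
rewrite -big_split; apply: eq_bigr => j _ /=.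
have WE : Wfun e n mui si gM A B j = (fun b => Hfst (WP j b)).
  by apply/funext => b; rewrite Hfst_WP.
have E1 : ABAW e n mui si gM A B j.+1 = (fun b => gmul (gmul (gmul
    (ginv (Hfst (A j.+1 b))) (ginv (Hfst (B j.+1 b)))) (Hfst (A j.+1 b))) (Hfst (WP j b))).
  by apply/funext => b; rewrite Hfst_WP.
have E2 : BAW e n mui si gM A B j.+1 = (fun b => gmul (gmul
    (ginv (Hfst (B j.+1 b))) (Hfst (A j.+1 b))) (Hfst (WP j b))).
  by apply/funext => b; rewrite Hfst_WP.
rewrite !(jpartE hG).
apply: etrans (congr1 (fun F => dpair _ (mc_right F c a y) - _ + _) WE) _.
by rewrite E1 E2.
Qed.

Section AtPoint.
Variables (v v' : 'rV[R]_m) (x : N).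
Hypothesis cx : cdom ch x.

(** As [coad] (mu_i) s_i = 0, M_i is the conjugate of C_i^-1 by g_i. Its Q occurs both in the term
    of C_i and in the cocycle identity of (M_i, M_{i-1} ... M_1), and cancels in the difference. *)
Let M_step i : (i < n)%N ->
  wedge pairH (fun c x v => Ad (Cel e mui si i.+1) (mc_left (gM i.+1) c x v))
    (mc_left (gM i.+1)) ch x v v' -
  wedge pairH (mc_right (K_ i.+1)) (mc_right (K_ i)) ch x v v' =
  - Q (MP i.+1) x v v' + Q (MP i) x v v' + 2 * dform (thM i) ch x v v'.
Proof.
move=> ltin; have hg := ggM ltin; have hM := gMf ltin; have hMP := gMP (ltnW ltin).
have fM : M_ i.+1 = (fun a => gmul (gmul (gM i.+1 a) (ginv (Cel e mui si i.+1)))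
    (ginv (gM i.+1 a))).
  apply/funext => a; rewrite /Mfun /Cel.
  exact (congr1 (fun z : H => gmul (gmul (gM i.+1 a) z) (ginv (gM i.+1 a)))
    (esym (ginv_exp hG he (coad0 ltin)))).
have E := conjugate_cst_form hG hN hch v v' (Cel e mui si i.+1) cx hg.
rewrite -fM in E.
have E1 := wedge_inverse_products hG hN hch v v' cx hM hMP.
have E2 := cocycle_at hG hN hch v v' cx hM hMP.
have E3 : wedge pairH (mc_right (K_ i.+1)) (mc_right (K_ i)) ch x v v' =
    wedge_at v v' (mc_right (fun a => ginv (gmul (M_ i.+1 a) (MP i a))) ch x)
      (mc_right (fun a => ginv (MP i a)) ch x).
  exact (congr2 (fun F F' => wedge pairH (mc_right F) (mc_right F') ch x v v')
    (K_M ltin) (K_M (ltnW ltin))).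
have g1 := pot_good hG hN hch hM hMP.1; have g2 := pot_good hG hN hch hM hg.1.
have F1 := dformD v v' cx g1 (form_goodN g2).
have F2 := dformN v v' cx g2.
have F := etrans F1 (congr1 (fun p : R => _ + p) F2).
exact (M_arith E (etrans E3 (etrans E1 E2)) F).
Qed.

Let H_step j : (j < gen)%N ->
  - (wedge pairH (mc_right (K_ (n + 2 * j).+1)) (mc_right (K_ (n + 2 * j))) ch x v v' +
     wedge pairH (mc_right (K_ (n + 2 * j).+2)) (mc_right (K_ (n + 2 * j).+1)) ch x v v') -
  (wedge pairH (mc_left (A j.+1)) (mc_left (B j.+1)) ch x v v' +
   wedge pairH (mc_right (BABV A B j.+1)) (mc_right (B j.+1)) ch x v v') =
  - Q (WP j.+1) x v v' + Q (WP j) x v v' + 2 * dform (thH j) ch x v v'.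
Proof.
move=> ltj; have E := handle_identity hG hN hch v v' (gA ltj) (gB ltj) (gWP (ltnW ltj)) cx.
have E1 : K_ (n + 2 * j).+1 = (fun a => ginv (gmul (A j.+1 a) (WP j a))).
  by apply/funext => a; exact (congr1 (fun F => ginv (F a)) (KV_A j)).
have E0 : K_ (n + 2 * j) = (fun a => ginv (WP j a)).
  by apply/funext => a; exact (congr1 (fun F => ginv (F a)) (KV_W j)).
have E2 : K_ (n + 2 * j).+2 = (fun a => ginv (WP j.+1 a)).
  have -> : ((n + 2 * j).+2 = n + 2 * j.+1)%N by rewrite mulnS addnA addnAC addn2.
  by apply/funext => a; exact (congr1 (fun F => ginv (F a)) (KV_W j.+1)).
rewrite E0 E1 E2; exact E.
Qed.

Section Total.
Variables (c0 : {vspace g}) (c1 : {vspace gs}).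
Hypothesis c0_abelian : forall xi eta, xi \in c0 -> eta \in c0 -> lie_bracket G xi eta = 0.
Hypothesis c0_c1 : forall xi j, xi \in c0 -> j \in c1 -> @coad _ _ G xi j = 0.
Variables (ginf w : N -> H) (mu : N -> g) (s : N -> gs) (k : R).
Hypothesis muc : forall a, mu a \in c0.
Hypothesis sc : forall a, s a \in c1.
Hypothesis hmus : smooth_map atlN (vect_atlas (g * gs)%type) (fun x => (mu x, s x)).
Hypothesis gginf : good ginf.
Hypothesis gmus_w : form_good ch (mus_w w mu s).
Hypothesis hK : forall a, KV_ (n + 2 * gen) a =
  gmul (gmul (ginf a) (Hpair (e (- mu a)) (- s a))) (ginv (ginf a)).

Let potentialE : potential e n gen mui si gM A B ginf w mu s = fun c a y =>
  mus_w w mu s c a y +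
  (\sum_(0 <= i < n) thM i c a y + \sum_(0 <= j < gen) thH j c a y) +
  end_form mu s ginf (KV_ (n + 2 * gen)) c a y.
Proof.
apply/funext => c; apply/funext => a; apply/funext => y.
rewrite /potential -addrA; apply: congr2; first by rewrite ThetaE.
by rewrite /end_form /pot (jpartE hG).
Qed.

(** The puncture steps telescope from the empty product to M_n ... M_1, the handle steps from there
    to K_{n+2g}^-1, and [end_term] disposes of the remaining Q. *)
Lemma Omega_potential :
  Omega e n gen mui si gM A B ginf w mu s k ch x v v' =
  k / (2 * pi) * dform (potential e n gen mui si gM A B ginf w mu s) ch x v v'.
Proof.
have gK : good (KV_ (n + 2 * gen)) by rewrite KV_W; exact: gWP.
have EE := end_term hG hN hch he c0_abelian c0_c1 muc sc hmus gginf gK hK v v' cx.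
have gE := end_form_good hG hN hch he c0_abelian muc hmus gginf gK hK.
have gthM i : i \in index_iota 0 n -> form_good ch (thM i).
  rewrite mem_index_iota => /= ltin; have hM := gMf ltin.
  exact: (form_goodD (pot_good hG hN hch hM (gMP (ltnW ltin)).1)
    (form_goodN (pot_good hG hN hch hM (ggM ltin).1))).
have gthH j : j \in index_iota 0 gen -> form_good ch (thH j).
  rewrite mem_index_iota => /= ltj.
  exact: (handle_form_good hG hN hch (gA ltj) (gB ltj) (gWP (ltnW ltj))).
have gT := form_goodD (form_good_sum gthM) (form_good_sum gthH).
have dP := congr1 (fun F => dform F ch x v v') potentialE.
have dP1 := dformD v v' cx (form_goodD gmus_w gT) gE.
have dP2 := dformD v v' cx gmus_w gT.
have dT := dformD v v' cx (form_good_sum gthM) (form_good_sum gthH).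
have dT' := etrans dT (congr2 (fun p q : R => p + q) (dform_sum v v' cx gthM)
  (dform_sum v v' cx gthH)).
pose wC i := wedge pairH (fun c x v => Ad (Cel e mui si i) (mc_left (gM i) c x v))
  (mc_left (gM i)) ch x v v'.
pose wK i := wedge pairH (mc_right (K_ i)) (mc_right (K_ i.-1)) ch x v v'.
pose wH j := wedge pairH (mc_left (A j)) (mc_left (B j)) ch x v v' +
  wedge pairH (mc_right (BABV A B j)) (mc_right (B j)) ch x v v'.
have SM := sum_telescope_sub (c := wC) (k := fun i => wK i.+1)
  (q := fun i => Q (MP i) x v v') (t := fun i => dform (thM i) ch x v v') M_step.
have SH := sum_telescope_pairs
  (k := fun j => wK (n + 2 * j)%N.+1 + wK (n + 2 * j)%N.+2) (h := wH)
  (q := fun j => Q (WP j) x v v') (t := fun j => dform (thH j) ch x v v') H_step.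
have k2 : k / (2 * pi) = k / (4 * pi) * 2 :> R.
  by apply: half_coef; rewrite lt0r_neq0 // pi_gt0.
pose w1 := wedge pairH (mc_left (K_ (n + 2 * gen))) (mc_right ginf) ch x v v'.
pose w2 := wedge pairH (fun c x v => (dfun mu c x v, dfun s c x v)) (mc_left ginf)
  ch x v v'.
have EW := etrans (congr1 (fun F : N -> H => - Q F x v v' + w1 + w2)
  (esym (KV_W gen))) EE.
apply: etrans _ (congr1 (fun p => k / (2 * pi) * p) (esym (etrans dP dP1))).
rewrite dP2.
(* [WP 0] is [MP n] by computation, which joins the two telescopes, and [MP 0] is the constant 1,
   with Q = 0. *)
exact (total_arith k2 (sum_split_pairs wK n gen) SM (Qform_cst ch v v' x (gone H))
  SH EW dT' erefl).
Qed.

End Total.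
End AtPoint.
End MainProof.

Theorem theorem5p2 (R : realType) (d : nat) (G : lie_data 'rV[R]_d)
  (hG : lie_group G) (hGc : connected [set: G])
  (expG : 'rV[R]_d -> G) (hexp : exponential_map expG)
  (m : nat) (N : topologicalType) (atlN : set (chart 'rV[R]_m N))
  (hN : smooth_manifold atlN)
  (k : R) (hk : k != 0) (n gen : nat)
  (mui : nat -> 'rV[R]_d) (si : nat -> 'cV[R]_d)
  (hmus_cartan : forall i, (1 <= i <= n)%N ->
     exists ci : {vspace 'rV[R]_d * 'cV[R]_d},
       cartan_subalgebra (bracketH G) ci /\ (mui i, si i) \in ci)
  (hmus_comm : forall i, (1 <= i <= n)%N ->
     bracketH G (mui i, 0) (0, si i) = 0)
  (c : {vspace 'rV[R]_d * 'cV[R]_d})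
  (hc_cartan : cartan_subalgebra (bracketH G) c)
  (hc_abelian : abelian_sub (bracketH G) c)
  (hc_split : exists (c0 : {vspace 'rV[R]_d}) (c1 : {vspace 'cV[R]_d}),
     forall xi j, ((xi, j) \in c) = (xi \in c0) && (j \in c1))
  (gM A B : nat -> N -> semidirect G) (ginf w : N -> semidirect G)
  (mu : N -> 'rV[R]_d) (s : N -> 'cV[R]_d)
  (hgM : forall i, (1 <= i <= n)%N ->
     smooth_map atlN (gatlas (semidirect G)) (gM i))
  (hA : forall j, (1 <= j <= gen)%N ->
     smooth_map atlN (gatlas (semidirect G)) (A j))
  (hB : forall j, (1 <= j <= gen)%N ->
     smooth_map atlN (gatlas (semidirect G)) (B j))
  (hginf : smooth_map atlN (gatlas (semidirect G)) ginf)
  (hw : smooth_map atlN (gatlas (semidirect G)) w)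
  (hmus : smooth_map atlN (vect_atlas ('rV[R]_d * 'cV[R]_d)%type)
            (fun x => (mu x, s x)))
  (hmus_c : forall x, (mu x, s x) \in c)
  (hK : forall x, KVfun expG n mui si gM A B (n + 2 * gen) x =
     gmul (gmul (ginf x) (Hpair (expG (- mu x)) (- s x))) (ginv (ginf x))) :
  forall ch, atlN ch -> forall x, cdom ch x -> forall v v' : 'rV[R]_m,
    Omega expG n gen mui si gM A B ginf w mu s k ch x v v' =
    k / (2 * pi) *
      dform (potential expG n gen mui si gM A B ginf w mu s) ch x v v'.
Proof.
move=> ch hch x cx v v'; have [c0 [c1 cE]] := hc_split.
(* Through the splitting of c, its commutativity says two things: c0 is abelian, and c0 annihilates
   c1 in the coadjoint representation. *)
have cfst xi : xi \in c0 -> (xi, 0) \in c by move=> h; rewrite cE h mem0v.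
have csnd j : j \in c1 -> (0, j) \in c by move=> h; rewrite cE h mem0v.
have c0_abelian xi eta : xi \in c0 -> eta \in c0 -> lie_bracket G xi eta = 0.
  by move=> hxi heta; have /(congr1 fst) := hc_abelian _ _ (cfst _ hxi) (cfst _ heta).
have coad_snd xi (j : 'cV[R]_d) : bracketH G (xi, 0) (0, j) = 0 -> @coad _ _ G xi j = 0.
  by move=> /(congr1 snd)/= <-; rewrite coad0r subr0.
have c0_c1 xi j : xi \in c0 -> j \in c1 -> @coad _ _ G xi j = 0.
  by move=> hxi hj; exact: coad_snd (hc_abelian _ _ (cfst _ hxi) (csnd _ hj)).
have coad0 i : (i < n)%N -> @coad _ _ G (mui i.+1) (si i.+1) = 0.
  by move=> ltin; exact: coad_snd (hmus_comm i.+1 ltin).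
have smooth_good X := @smooth_map_good _ _ _ hG _ _ _ hN _ hch X.
have muc a : mu a \in c0 by have := hmus_c a; rewrite cE => /andP[].
have sc a : s a \in c1 by have := hmus_c a; rewrite cE => /andP[].
exact (Omega_potential hG hN hch hexp coad0
  (fun i h => smooth_good _ (hgM i.+1 h)) (fun j h => smooth_good _ (hA j.+1 h))
  (fun j h => smooth_good _ (hB j.+1 h)) v v' cx c0_abelian c0_c1 k muc sc hmus
  (smooth_good _ hginf) (mus_w_good hG hN hch hmus hw) hK).
Qed.
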